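(* For every $\varepsilon>0$ there exists $\ell_0=\ell_0(\varepsilon)$ such that for all integers $\ell\ge \ell_0$, every oriented cycle $C_\ell$ on $\ell$ vertices, and every integer $m\ge 1$, the following holds: every oriented graph $G$ on $\ell m$ vertices with minimum semi-degree $\delta^0(G)\ge (3/8+\varepsilon)m\ell$ contains a $C_\ell$-factor.
   Context: An oriented graph is a digraph with no loops, no multiple edges and at most one edge between any pair of vertices (i.e. an orientation of a simple graph). An oriented cycle $C_\ell$ on $\ell$ vertices is any orientation of the (undirected) cycle on $\ell$ vertices; edges need not all point the same way. For a digraph $G$, $d^+(v)$ and $d^-(v)$ denote the out-degree and in-degree of $v$, and the minimum semi-degree is $\delta^0(G)=\min\{d^+(v),d^-(v): v\in V(G)\}$. A $C_\ell$-factor in $G$ is a collection of vertex-disjoint copies of $C_\ell$ in $G$ covering all vertices of $G$. *)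

(* Defs.v *)
From mathcomp Require Import all_boot all_order all_algebra.
From mathcomp Require Export reals.
Set Implicit Arguments. Unset Strict Implicit. Unset Printing Implicit Defensive.

Definition oriented (V : finType) (e : rel V) : Prop :=
  (forall x, ~~ e x x) /\ (forall x y, e x y -> ~~ e y x).

Definition outdeg (V : finType) (e : rel V) (v : V) : nat := #|[set w | e v w]|.
Definition indeg (V : finType) (e : rel V) (v : V) : nat := #|[set w | e w v]|.

(* An oriented cycle on l vertices (l >= 3): vertices 0..l-1, the undirected
   edges are {i, i+1 mod l}; o i = true means the edge is oriented i -> i+1,
   o i = false means i+1 -> i. *)
Definition cyc_edge (l : nat) (o : 'I_l -> bool) (i : 'I_l) : 'I_l * 'I_l :=
  if o i then (i, ordS i) else (ordS i, i).

Definition is_cycle_copy (V : finType) (e : rel V) (l : nat) (o : 'I_l -> bool)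
  (f : 'I_l -> V) : Prop :=
  injective f /\ forall i : 'I_l, e (f (cyc_edge o i).1) (f (cyc_edge o i).2).

Definition has_cycle_factor (V : finType) (e : rel V) (l : nat) (o : 'I_l -> bool)
  : Prop :=
  exists (k : nat) (F : 'I_k -> 'I_l -> V),
    (forall j, is_cycle_copy e o (F j)) /\
    (forall j1 j2 i1 i2, F j1 i1 = F j2 i2 -> j1 = j2 /\ i1 = i2) /\
    (forall v : V, exists j i, F j i = v).

(* Main.v *)
Require Import Defs.
From mathcomp Require Import all_boot all_order all_algebra.
From mathcomp Require Import reals sequences exp.
From mathcomp Require Import zify ring lra.
Import Order.TTheory GRing.Theory Num.Theory.
Set Implicit Arguments. Unset Strict Implicit. Unset Printing Implicit Defensive.
Local Open Scope ring_scope.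

(** All [m] cycles are embedded at once, by absorption and without the
    regularity lemma. If [S] contains between 3/8 and 5/8 of the vertices, the
    vertices with many neighbours in [S] outnumber [S] by a linear amount;
    hence every long enough orientation word is carried by many paths from any
    vertex to any set of linear size. Applied to antidirected words, this
    produces, for any word and any two vertices [u] and [y], many gadgets: small
    families of paths carrying that word that can be rerouted, keeping their end
    vertices, so as to use [u] instead of [y]. By multiplicative weights, a
    sparse disjoint family of gadgets is chosen such that every vertex can be
    inserted in many of them, and the vertex released fits any given hole, a hole
    being an open position whose two neighbours are embedded and have many common
    candidates. Almost all other positions are covered by paths of bounded length
    that follow near-perfect matchings between random parts, and these are
    linked through a reserved random set. There remain as many vertices as
    holes: each of them is inserted in its own gadget and the released vertex is
    moved to a hole. *)

(** * Walks *)

(** At density 3/8 the edge count behind expansion just breaks even; below 3/8 a single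
    neighbourhood is larger than the set, above 5/8 the set meets every neighbourhood. The
    orientation of the cycle is arbitrary, so no local pattern can be relied on. What every long
    cycle does contain is one word repeated on many bounded windows; hence a gadget is a family of
    rows with equal words, which can trade vertices. Two vertices are interchangeable in a row when
    they see a third one in the same way, and chaining such exchanges gives an antidirected walk
    whatever the word is. If the released vertex were prescribed, gadgets would be only a fraction
    of order [1 / #|V|] of all tuples. It therefore ranges over a set of linear size, the fillers of
    a hole, and a constant fraction of tuples survives. There are [4 * #|V| ^ 3] conditions
    (inserted vertex, hole) against an exponential gain in weight, so each is met at least as often
    as there are holes, and distinct gadgets follow. In a graph with uneven degrees the matchings
    between random parts need not be nearly perfect; so a regular subgraph is extracted first. *)

Section Walks.
Variables (V : finType) (e : rel V).

Definition step (s : bool) (x y : V) : bool := if s then e x y else e y x.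
Definition nb (s : bool) (x : V) : {set V} := [set y | step s x y].

Lemma stepN s x y : step (~~ s) x y = step s y x.
Proof. by case: s. Qed.

Lemma in_nb s x y : (y \in nb s x) = step s x y.
Proof. by rewrite inE. Qed.

Fixpoint wpath (w : seq bool) (x : V) (p : seq V) : bool :=
  match w, p with
  | [::], [::] => true
  | s :: w', y :: p' => step s x y && wpath w' y p'
  | _, _ => false
  end.

Lemma size_wpath w x p : wpath w x p -> size p = size w.
Proof. by elim: w x p => [|s w IH] x [|y p] //= /andP[_ /IH->]. Qed.

Lemma wpath_cat w1 w2 x p1 p2 : size p1 = size w1 ->
  wpath (w1 ++ w2) x (p1 ++ p2) = wpath w1 x p1 && wpath w2 (last x p1) p2.
Proof.
elim: w1 x p1 => [|s w IH] x [|y p] //= [sz].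
by rewrite IH // andbA.
Qed.

Lemma wpath_step w x p i : wpath w x p -> (i < size w)%N ->
  step (nth true w i) (nth x (x :: p) i) (nth x p i).
Proof.
elim: w x p i => [|s w IH] x [|y p] //= [|i] /andP[h1 h2] //= hi.
have := IH y p i h2 hi.
have sz := size_wpath h2.
rewrite (set_nth_default x) /=; last by rewrite sz ltnW.
by rewrite (set_nth_default x y) ?sz.
Qed.

Lemma wpathP w x p : size p = size w ->
  (forall i, (i < size w)%N -> step (nth true w i) (nth x (x :: p) i) (nth x p i)) ->
  wpath w x p.
Proof.
elim: w x p => [|s w IH] x [|y p] //= [sz] H.
rewrite (H 0%N) //=; apply: IH => // i hi.
have := H i.+1 hi; rewrite /= (set_nth_default y) /=; last by rewrite sz ltnW.
by rewrite (set_nth_default y x) ?sz.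
Qed.

Variables (W : {set V}).

(* [rich W h N P]: a list of length [N] satisfying [P] can be built entry by
   entry with at least [h] choices in [W] at each step. This yields both many
   such lists ([rich_card]) and lists avoiding given vertices ([rich_avoid]). *)
Fixpoint rich (h N : nat) (P : pred (seq V)) : bool :=
  if N is N'.+1 then (h <= #|[set v in W | rich h N' (fun l => P (v :: l))]|)%N
  else P [::].

Lemma rich_sub h h' N (P Q : pred (seq V)) : (h' <= h)%N ->
  (forall l, size l = N -> all (mem W) l -> P l -> Q l) ->
  rich h N P -> rich h' N Q.
Proof.
move=> hh; elim: N P Q => [|N IH] P Q PQ /=; first exact: PQ.
move=> H; apply: leq_trans hh (leq_trans H _); apply: subset_leq_card.
apply/subsetP=> v; rewrite !inE => /andP[vW]; rewrite vW /=.
by apply: IH => l sl al; apply: PQ => /=; rewrite ?sl ?al ?vW.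
Qed.

Lemma rich_cat h N1 N2 (P : pred (seq V)) :
  rich h N1 (fun l1 => rich h N2 (fun l2 => P (l1 ++ l2))) -> rich h (N1 + N2) P.
Proof.
elim: N1 P => [|N IH] P //= H.
apply: leq_trans H _; apply: subset_leq_card.
by apply/subsetP=> v; rewrite !inE => /andP[-> H1]; apply: IH.
Qed.

(** A chosen vertex joins the forbidden set while [N] drops by one, so [#|F| + N] is constant along
    the induction and bounds the choices lost at any entry. *)
Lemma rich_avoid (F : {set V}) h N (P : pred (seq V)) :
  rich h N P ->
  rich (h - (#|F| + N)) N (fun l => [&& P l, uniq l & all (fun v => v \notin F) l]).
Proof.
elim: N P F => [|N IH] P F /=; first by move=> ->.
move=> H.
apply: (@leq_trans (#|[set v in W | rich h N (fun l => P (v :: l))]| - #|F|)).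
  by rewrite addnS subnS; apply: leq_trans (leq_pred _) _; rewrite subnDA; 
     apply: leq_trans (leq_subr _ _) _; apply: leq_sub2r.
rewrite leq_subLR; apply: leq_trans (leq_card_setU _ _).
apply: subset_leq_card; apply/subsetP=> v; rewrite !inE => /andP[vW Hv].
rewrite vW /=; case: (boolP (v \in F)) => //= vF.
have := IH _ (v |: F) Hv; apply: rich_sub.
  by rewrite cardsU1 vF /= add1n addSn addnS.
move=> l _ _ /and3P[-> u al] /=; rewrite u andbT.
apply/andP; split.
  by apply/negP=> vl; move/allP: al => /(_ v vl); rewrite !inE eqxx.
by apply: sub_all al => x; rewrite !inE negb_or => /andP[].
Qed.

Lemma rich_ex h N (P : pred (seq V)) : (0 < h)%N -> rich h N P ->
  exists l, [/\ size l = N, all (mem W) l & P l].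
Proof.
move=> h0; elim: N P => [|N IH] P /=; first by exists [::].
move=> H; have /card_gt0P[v] := leq_trans h0 H.
rewrite inE => /andP[vW /IH[l [sl al Pl]]].
by exists (v :: l); split; rewrite /= ?sl ?vW.
Qed.

Lemma rich_flat h n M (P : nat -> pred (seq V)) :
  (forall t, (t < M)%N -> rich h n (P t)) ->
  rich h (M * n) (fun l => [forall t : 'I_M, P t (take n (drop (t * n) l))]).
Proof.
elim: M P => [|M IH] P H.
  by rewrite mul0n /=; apply/forallP=> -[].
rewrite mulSn; apply: rich_cat.
apply: rich_sub (H 0%N _) => // l1 sl1 _ P1.
apply: rich_sub (IH (fun t => P t.+1) _) => // [l2 sl2 _ /forallP H2|t ht]; last exact: H.
apply/forallP=> -[[|t] ht] /=; first by rewrite mul0n drop0 take_size_cat.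
rewrite mulSn drop_cat sl1 ifN; last by rewrite -leqNgt leq_addr.
by rewrite addKn; apply: (H2 (Ordinal (ht : (t < M)%N))).
Qed.

End Walks.

(** For [h] linear in [#|V|] and fixed [N] this is a constant fraction of all tuples, the form
    needed for multiplicative weights. *)
Lemma rich_card (V : finType) h N (P : pred (seq V)) :
  rich setT h N P -> (h ^ N <= #|[set t : N.-tuple V | P t]|)%N.
Proof.
elim: N P => [|N IH] P /=.
  by move=> P0; rewrite expn0; apply/card_gt0P; exists [tuple]; rewrite inE.
set X := [set v in _ | _] => H.
have -> : #|[set t : N.+1.-tuple V | P t]| =
    (\sum_(v : V) #|[set t : N.-tuple V | P (v :: t)]|)%N.
  pose f (v : V) (t : N.-tuple V) := [tuple of v :: t].
  rewrite -[LHS]sum1_card (partition_big (fun t => thead t) predT) //=.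
  apply: eq_bigr => v _.
  rewrite -[RHS]sum1_card (reindex (f v)) /=; last first.
    exists (fun t : N.+1.-tuple V => [tuple of behead t] : N.-tuple V) => t.
      by move=> _; apply/val_inj.
    rewrite !inE => /andP[_ /eqP <-]; by rewrite /f [t in RHS]tuple_eta.
  by apply: eq_bigl => t; rewrite !inE theadE eqxx andbT.
rewrite expnS; apply: leq_trans (leq_mul H (leqnn _)) _.
rewrite -sum_nat_const big_mkcond /=; apply: leq_sum => v _.
by case: ifP => // ; rewrite inE => /andP[_ /IH].
Qed.

(** * Expansion *)

Section EdgeCounts.
Variables (V : finType) (e : rel V).
Implicit Types (s : bool) (X Y Z : {set V}).

Definition edges s X Y : nat := (\sum_(x in X) #|nb e s x :&: Y|)%N.

Lemma edgesE s X Y : edges s X Y = (\sum_(x in X) \sum_(y in Y) step e s x y)%N.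
Proof.
rewrite /edges; apply: eq_bigr => x _; rewrite -sum1_card big_mkcond [RHS]big_mkcond /=.
by apply: eq_bigr => y _; rewrite !inE; case: step; case: (y \in Y).
Qed.

Lemma edgesC s X Y : edges s X Y = edges (~~ s) Y X.
Proof.
rewrite !edgesE exchange_big /=; apply: eq_bigr => y _; apply: eq_bigr => x _.
by rewrite stepN.
Qed.

Lemma edgesUr s X Y Z : [disjoint Y & Z] ->
  edges s X (Y :|: Z) = (edges s X Y + edges s X Z)%N.
Proof.
move=> d; rewrite /edges -big_split /=; apply: eq_bigr => x _.
rewrite setIUr cardsU setIACA setIid; move: d; rewrite -setI_eq0 => /eqP->.
by rewrite setI0 cards0 subn0.
Qed.

Lemma edges_le s X Y k : (forall x, x \in X -> #|nb e s x :&: Y| <= k)%N ->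
  (edges s X Y <= #|X| * k)%N.
Proof. by move=> H; rewrite -sum_nat_const; apply: leq_sum. Qed.

Lemma edges_le_mul s X Y : (edges s X Y <= #|X| * #|Y|)%N.
Proof. by apply: edges_le => x _; rewrite subset_leq_card ?subsetIr. Qed.

Hypothesis oe : oriented e.

Lemma nb_disjoint s x : [disjoint nb e s x & nb e (~~ s) x].
Proof.
rewrite -setI_eq0; apply/eqP/setP=> y; rewrite !inE.
by case: s => /=; apply/negP => /andP[h1 h2]; move: (oe.2 _ _ h1); rewrite h2.
Qed.

Lemma edges_opp s X Y : (edges s X Y + edges (~~ s) X Y <= #|X| * #|Y|)%N.
Proof.
rewrite /edges -big_split -sum_nat_const /=; apply: leq_sum => x _.
have := nb_disjoint s x; rewrite -setI_eq0 => /eqP d.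
have : #|(nb e s x :&: Y) :&: (nb e (~~ s) x :&: Y)| = 0%N.
  by rewrite setIACA d set0I cards0.
have := cardsUI (nb e s x :&: Y) (nb e (~~ s) x :&: Y) => <- ->; rewrite addn0.
by apply: subset_leq_card; rewrite subUset !subsetIr.
Qed.

Lemma edges_self s X : (2 * edges s X X <= #|X| * #|X|)%N.
Proof. by have := edges_opp s X X; rewrite -(edgesC s X X) mul2n addnn. Qed.

End EdgeCounts.

Section Expansion.
Variable R : realType.
Variables (V : finType) (e : rel V).
Implicit Types (s : bool) (S T W : {set V}).

(* The bound concerns every vertex of the graph, also those outside [W]. *)
Definition semideg (a : R) W : Prop :=
  forall v s, a * #|W|%:R <= #|nb e s v :&: W|%:R.

Hypothesis oe : oriented e.
Variables (eps : R) (W : {set V}).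
Hypothesis eps0 : 0 < eps.
Hypothesis eps8 : eps <= 1/8.
Hypothesis degW : semideg (3/8 + eps) W.

Definition back s (h : nat) S := [set x in W | (h <= #|nb e s x :&: S|)%N].

(** Inside [W] a neighbourhood and [S] have total size at least [(1 + eps) * #|W|], so they share
    [eps * #|W|] vertices. *)
Lemma back_full s h S : h%:R <= eps * #|W|%:R -> S \subset W ->
  5/8 * #|W|%:R <= #|S|%:R :> R -> forall x, (h <= #|nb e s x :&: S|)%N.
Proof.
move=> hh SW S5 x.
rewrite -(ler_nat R).
have := cardsUI (nb e s x :&: W) S => H.
have : (#|(nb e s x :&: W) :|: S| <= #|W|)%N.
  by apply: subset_leq_card; rewrite subUset subsetIr.
rewrite -setIA (setIidPr SW) in H.
rewrite -(ler_nat R).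
move: (congr1 (fun k : nat => k%:R : R) H); rewrite !natrD.
have := degW x s.
lra.
Qed.

(* Split [W] into [A = S :&: T], [B = T :\: S], [D = S :\: T] and the rest [C],
   where [T = back s h S]. Vertices outside [T] send few edges into [S], so
   counting all edges at [D], the in-edges of [A] and the out-edges of [C] gives
   [#|D| <= (1/4 - 2 eps) #|W|] and [3 #|B| - #|D| >= (1/2 + 4 eps) #|W|] up to
   small errors, which contradicts [#|B| < #|D| + eps / 8 * #|W|]. *)
Lemma expansion s h S : S \subset W -> h%:R <= eps / 8 * #|W|%:R ->
  3/8 * #|W|%:R <= #|S|%:R :> R -> #|S|%:R <= 5/8 * #|W|%:R :> R ->
  #|S|%:R + eps / 8 * #|W|%:R <= #|back s h S|%:R :> R.
Proof.
move=> SW hh S3 S5; set T := back s h S.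
case: (posnP #|W|) => [W0|Wpos].
  have: (#|S| <= 0)%N by rewrite -W0 subset_leq_card.
  by rewrite W0 leqn0 => /eqP->; rewrite mulr0 addr0.
have TW : T \subset W by apply/subsetP=> x; rewrite inE => /andP[].
pose A := S :&: T; pose B := T :\: S; pose D := S :\: T; pose C := W :\: (S :|: T).
have Th x : x \in W -> x \notin T -> (#|nb e s x :&: S| <= h)%N.
  by rewrite inE => ->/=; rewrite -ltnNge => /ltnW.
have key x : ((x \in S) ==> (x \in W)) && ((x \in T) ==> (x \in W)).
  by apply/andP; split; apply/implyP; [apply: (subsetP SW)|apply: (subsetP TW)].
have ED : W = S :|: (B :|: C).
  apply/setP=> x; move: (key x); rewrite !(in_setU, in_setD).
  by case: (x \in S); case: (x \in W); case: (x \in T).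
have dS : [disjoint S & B :|: C].
  rewrite -setI_eq0; apply/eqP/setP=> x; rewrite in_set0 !(in_setI, in_setU, in_setD).
  by case: (x \in S); case: (x \in W); case: (x \in T).
have dBC : [disjoint B & C].
  rewrite -setI_eq0; apply/eqP/setP=> x; rewrite in_set0 !(in_setI, in_setU, in_setD).
  by case: (x \in S); case: (x \in W); case: (x \in T).
have cS : #|S| = (#|A| + #|D|)%N by rewrite cardsID.
have cT : #|T| = (#|A| + #|B|)%N by rewrite /A setIC cardsID.
have cW : #|W| = (#|S| + (#|B| + #|C|))%N.
  rewrite [in LHS]ED cardsU; move: dS; rewrite -setI_eq0 => /eqP->.
  by rewrite cards0 subn0 cardsU; move: dBC; rewrite -setI_eq0 => /eqP->; rewrite cards0 subn0.
have SAD : S = A :|: D by rewrite /A /D setID.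
have dAD : [disjoint A & D].
  rewrite -setI_eq0; apply/eqP/setP=> x; rewrite in_set0 !(in_setI, in_setU, in_setD).
  by case: (x \in S); case: (x \in W); case: (x \in T).
have split4 s' (X : {set V}) : edges e s' X W = (edges e s' X A + edges e s' X D +
    (edges e s' X B + edges e s' X C))%N.
  by rewrite {1}ED (edgesUr _ _ _ dS) (edgesUr _ _ _ dBC) {1}SAD (edgesUr _ _ _ dAD).
have degX s' (X : {set V}) : (3/8 + eps) * #|W|%:R * #|X|%:R <= (edges e s' X W)%:R.
  rewrite /edges natr_sum [X in X <= _]mulr_natr -sumr_const.
  by apply: ler_sum => x _; apply: degW.
have lowD : (edges e s D A + edges e s D D <= #|D| * h)%N.
  rewrite -(edgesUr _ _ _ dAD) -SAD; apply: edges_le => x; rewrite inE => /andP[xT xS].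
  by apply: Th => //; apply: (subsetP SW).
have lowC : (edges e s C A + edges e s C D <= #|C| * h)%N.
  rewrite -(edgesUr _ _ _ dAD) -SAD; apply: edges_le => x.
  by rewrite inE => /andP[]; rewrite inE negb_or => /andP[xS xT] xW; apply: Th.
have D1 := degX s D; have D2 := degX (~~ s) D.
have A2 := degX (~~ s) A; have C1 := degX s C.
rewrite !split4 in D1 D2 A2 C1.
have o1 := edges_opp oe s D A; have o2 := edges_opp oe s D B.
have o3 := edges_opp oe s D C.
have o4 := edgesC e s D D.
have q1 := edges_self oe (~~ s) A.
have q2 := edges_le_mul e (~~ s) A B.
have q3 := edgesC e s C A; have q4 := edgesC e s D A.
have q5 := edges_self oe s C.
have q6 := edges_le_mul e s C B.
rewrite -q3 -q4 in A2; rewrite -o4 in D2.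
move/(congr1 (fun k : nat => k%:R : R)): cS; rewrite natrD => cS.
move/(congr1 (fun k : nat => k%:R : R)): cT; rewrite natrD => cT.
move/(congr1 (fun k : nat => k%:R : R)): cW; rewrite !natrD => cW.
rewrite !natrD in D1 D2 A2 C1.
rewrite -(ler_nat R) !natrD natrM in lowD.
rewrite -(ler_nat R) !natrD natrM in lowC.
rewrite -(ler_nat R) !natrD natrM in o1.
rewrite -(ler_nat R) !natrD natrM in o2.
rewrite -(ler_nat R) !natrD natrM in o3.
rewrite -(ler_nat R) !natrM in q1.
rewrite -(ler_nat R) !natrM in q2.
rewrite -(ler_nat R) !natrM in q5.
rewrite -(ler_nat R) !natrM in q6.
have n0 : 0 < #|W|%:R :> R by rewrite ltr0n.
have h0 : 0 <= h%:R :> R by [].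
move: D1 D2 A2 C1 lowD lowC o1 o2 o3 q1 q2 q5 q6 cS cT cW S3 S5 hh.
have g0 k : 0 <= k%:R :> R by [].
move: (g0 (edges e s C D)) (g0 (edges e s D D)) (g0 (edges e s D A))
  (g0 (edges e s C A)) (g0 #|A|) (g0 #|B|) (g0 #|C|) (g0 #|D|).
move: (edges e s D A)%:R (edges e s D D)%:R (edges e s D B)%:R (edges e s D C)%:R
  (edges e (~~ s) D A)%:R (edges e (~~ s) D B)%:R (edges e (~~ s) D C)%:R
  (edges e (~~ s) A A)%:R (edges e (~~ s) A B)%:R (edges e s C A)%:R (edges e s C D)%:R
  (edges e s C B)%:R (edges e s C C)%:R => da dd db dc da' db' dc' aa ab ca cd cb cc.
move: #|A|%:R #|B|%:R #|C|%:R #|D|%:R #|S|%:R #|T|%:R h%:R h0 #|W|%:R n0 => a b c d m k r r0 n n0.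
clear - eps0 eps8 r0 n0.
move=> cd0 dd0 da0 ca0 a0 b0 c0 d0 D1 D2 A2 C1 lowD lowC o1 o2 o3 q1 q2 q5 q6 cS cT cW S3 S5 hh.
rewrite leNgt; apply/negP => klt.
have en0 : 0 < eps * n by rewrite mulr_gt0.
have e8n : eps * n <= n / 8 by have := ler_wpM2r (ltW n0) eps8; lra.
(* The counts at [D] and [C] are inequalities multiplied by the size of the part; the part may be
   empty, and that case is settled directly. *)
have cancel (x y : R) : 0 <= x -> x * y <= 0 -> x = 0 \/ y <= 0.
  rewrite le_eqVlt => /orP[/eqP<-|x0]; first by left.
  by rewrite pmulr_rle0 //; right.
have dle : d <= (1/4 - 2 * eps) * n + 2 * r.
  have [->|] : d = 0 \/ (3/4 + 2 * eps) * n - a - b - c - 2 * r <= 0 by apply: cancel => //; lra.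
    by lra.
  by lra.
(* [A] must have linear size: its count carries an error [r * n], which becomes [16 * r] after
   division by [a]. *)
have age : a >= n / 16 by lra.
have Ale : (3/8 + eps) * n - a / 2 - b <= 16 * r.
  have : a * ((3/8 + eps) * n - a / 2 - b) <= r * n.
    suff : r * (c + d) <= r * n by lra.
    by apply: ler_wpM2l => //; lra.
  move=> H; rewrite leNgt; apply/negP => H2.
  have a1 : 0 < a by apply: lt_le_trans age; rewrite divr_gt0.
  have : r * n < r * n; last by rewrite ltxx.
  have : a * (16 * r) < a * ((3/8 + eps) * n - a / 2 - b) by rewrite ltr_pM2l.
  have : n / 16 * (16 * r) <= a * (16 * r) by apply: ler_wpM2r => //; lra.
  by lra.
have Cle : (3/8 + eps) * n - c / 2 - b <= r.
  have [c00|] : c = 0 \/ (3/8 + eps) * n - c / 2 - b - r <= 0 by apply: cancel => //; lra.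
    have : 0 < 0 :> R by lra.
    by rewrite ltxx.
  by lra.
(* Adding [Ale] and [Cle] gives [(1/2 + 4 * eps) * n <= 3 * b - d + 34 * r]. With [klt] and [dle]
   this yields [8 * eps * n < 41/8 * eps * n]. *)
have : 0 < 0 :> R by lra.
by rewrite ltxx.
Qed.

Lemma eps8_le : eps / 8 <= eps.
Proof. by have e0 := eps0; lra. Qed.

Lemma back_sub s h S : back s h S \subset W.
Proof. by apply/subsetP=> x; rewrite inE => /andP[]. Qed.

Variables (h : nat) (c : R) (Tgt : {set V}).
Hypotheses (c0 : 0 < c) (he : h%:R <= eps / 8 * #|W|%:R) (hc : h%:R <= c * eps * #|W|%:R).
Hypotheses (TgtW : Tgt \subset W) (cTgt : c * #|W|%:R <= #|Tgt|%:R).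

(** Built from the end of the word, because expansion bounds the set of vertices that see a given
    set. *)
Fixpoint reach (w : seq bool) : {set V} :=
  if w is s :: w' then back s h (reach w') else Tgt.

Lemma reach_sub w : reach w \subset W.
Proof. by case: w => [|s w] //=; apply: back_sub. Qed.

Lemma reach_rich w u : u \in reach w ->
  rich W h (size w) (fun l => wpath e w u l && (last u l \in Tgt)).
Proof.
elim: w u => [|s w IH] u //=.
rewrite inE => /andP[_ H]; apply: leq_trans H _; apply: subset_leq_card.
apply/subsetP => v; rewrite !inE => /andP[sv vr].
rewrite (subsetP (reach_sub w) _ vr) /=; apply: rich_sub (IH v vr) => // l _ _.
by rewrite sv.
Qed.

(** Double counting of the edges between [Tgt] and [W]: the vertices outside the new set account for
    at most [h * #|W|] of them, which by [hc] and [cTgt] is at most [eps * #|W| * #|Tgt|]. *)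
Lemma reach1_ge s : 3/8 * #|W|%:R <= #|reach [:: s]|%:R :> R.
Proof.
rewrite /=; set T := back s h Tgt.
have : (edges e (~~ s) Tgt W <= #|T| * #|Tgt| + #|W| * h)%N.
  rewrite edgesC negbK /edges (bigID (mem T)) /=.
  apply: leq_add.
    apply: (@leq_trans (\sum_(x in T) #|Tgt|)%N); last by rewrite sum_nat_const.
    rewrite big_mkcond [X in (_ <= X)%N]big_mkcond /=; apply: leq_sum => x _.
    case: (boolP (x \in T)) => [_|_]; last by rewrite andbF.
    by case: ifP => // _; rewrite subset_leq_card ?subsetIr.
  apply: (@leq_trans (\sum_(x in W) h)%N); last by rewrite sum_nat_const.
  rewrite big_mkcond [X in (_ <= X)%N]big_mkcond /=; apply: leq_sum => x _.
  case: (boolP (x \in W)) => //= xW; case: ifP => // /negbTE.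
  by rewrite inE xW /= => /negbT; rewrite -ltnNge => /ltnW.
rewrite -(ler_nat R) natrD !natrM.
have : (3/8 + eps) * #|W|%:R * #|Tgt|%:R <= (edges e (~~ s) Tgt W)%:R.
  rewrite /edges natr_sum [X in X <= _]mulr_natr -sumr_const.
  by apply: ler_sum => x _; apply: degW.
case: (posnP #|W|) => [->|Wpos]; first by rewrite !mulr0.
have W0 : 0 < #|W|%:R :> R by rewrite ltr0n.
have T0 : 0 < #|Tgt|%:R :> R by apply: lt_le_trans cTgt; rewrite mulr_gt0.
have : #|W|%:R * h%:R <= eps * #|W|%:R * #|Tgt|%:R.
  apply: le_trans (_ : #|W|%:R * (c * eps * #|W|%:R) <= _); first by rewrite ler_pM2l.
  have := ler_wpM2l (ltW (mulr_gt0 eps0 W0)) cTgt; lra.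
move: (edges _ _ _ _)%:R => E H1 H2 H3.
by rewrite -(ler_pM2r T0); lra.
Qed.

Lemma reach_ge s w : 5/8 * #|W|%:R <= #|reach (s :: w)|%:R :> R \/
  (3/8 + (size w)%:R * eps / 8) * #|W|%:R <= #|reach (s :: w)|%:R :> R.
Proof.
elim: w s => [|s' w IH] s.
  by right; rewrite mulr0n !mul0r addr0; apply: reach1_ge.
have [big|small] := leP (5/8 * #|W|%:R) (#|reach (s' :: w)|%:R : R).
  left; rewrite [reach _]/=; set S := reach (s' :: w) in big *.
  suff -> : back s h S = W.
    by have := ler0n R #|W|; lra.
  apply/eqP; rewrite eqEsubset back_sub; apply/subsetP => x xW.
  rewrite inE xW /=; apply: back_full => //; last exact: reach_sub.
  by apply: le_trans he _; apply: ler_wpM2r => //; apply: eps8_le.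
right; have [|H] := IH s'; first by rewrite leNgt small.
have : #|reach (s' :: w)|%:R + eps / 8 * #|W|%:R <= #|reach [:: s, s' & w]|%:R :> R.
  apply: expansion => //; [exact: reach_sub| |exact: ltW].
  apply: le_trans H; apply: ler_wpM2r => //.
  by rewrite lerDl divr_ge0 // mulr_ge0 // ltW.
have -> : (size (s' :: w))%:R = (size w)%:R + 1 :> R by rewrite natr1.
lra.
Qed.

(** Read from the end, one letter leads from the target to 3/8 of [W], then [2 / eps] letters
    gaining [eps / 8] each lead to 5/8, and the first letter uses [back_full], valid at every
    vertex, so [u] may lie outside [W]. *)
Lemma walk_rich w u : 2 + 2 / eps <= (size w)%:R ->
  rich W h (size w) (fun l => wpath e w u l && (last u l \in Tgt)).
Proof.
have e2 : 0 < 2 / eps by rewrite divr_gt0.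
case: w => [|s [|s' w]] sw.
- by have : 0 < 0 :> R; [move: sw; rewrite /=; lra | rewrite ltxx].
- by have : 0 < 0 :> R; [move: sw; rewrite /=; lra | rewrite ltxx].
have W0 : 0 <= #|W|%:R :> R by [].
have big : 5/8 * #|W|%:R <= #|reach (s' :: w)|%:R :> R.
  have [//|] := reach_ge s' w; apply: le_trans; apply: ler_wpM2r => //.
  have E : (size [:: s, s' & w])%:R = (size w)%:R + 2 :> R by rewrite -natrD addn2.
  have : 2 / eps <= (size w)%:R by move: sw; rewrite E; lra.
  by rewrite ler_pdivrMr //; lra.
have := @back_full s h (reach (s' :: w)) _ (reach_sub _) big u.
have -> : h%:R <= eps * #|W|%:R by by apply: le_trans he _; apply: ler_wpM2r => //; apply: eps8_le.
move=> /(_ isT) H.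
change (h <= #|[set v in W | rich W h (size (s' :: w))
  (fun l => wpath e [:: s, s' & w] u (v :: l) && (last u (v :: l) \in Tgt))]|)%N.
apply: leq_trans H _; apply: subset_leq_card.
apply/subsetP => v; rewrite in_setI in_nb inE => /andP[sv vr].
rewrite (subsetP (reach_sub (s' :: w)) v vr) andTb.
apply: rich_sub (reach_rich vr) => // l _ _.
by rewrite /= sv.
Qed.

End Expansion.

(** * Absorbers *)

Section RichTools.
Variables (V : finType) (e : rel V).

Lemma rich_indep (x0 : V) (W : {set V}) h M (Q : nat -> pred V) :
  (forall t, (t < M)%N -> (h <= #|[set v in W | Q t v]|)%N) ->
  rich W h M (fun l => [forall t : 'I_M, Q t (nth x0 l t)]).
Proof.
move=> H; rewrite -[X in rich _ _ X]muln1.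
apply: rich_sub (@rich_flat V W h 1 M (fun t l => Q t (head x0 l)) _) => //.
  rewrite muln1 => l sl _ /forallP Hl; apply/forallP => t; move: (Hl t).
  have -> : nth x0 l t = nth x0 (drop t l) 0 by rewrite nth_drop addn0.
  rewrite muln1.
  have : (0 < size (drop t l))%N by rewrite size_drop sl subn_gt0.
  by case: (drop t l).
Qed.

Lemma wpath_rcons w s x p y : size p = size w ->
  wpath e (rcons w s) x (rcons p y) = wpath e w x p && step e s (last x p) y.
Proof. by move=> sz; rewrite -!cats1 wpath_cat //= andbT. Qed.

Variable R : realType.
Hypothesis oe : oriented e.
Variables (eps : R).
Hypothesis eps0 : 0 < eps.
Hypothesis eps8 : eps <= 1/8.

(** The prescribed end [v] is reached by aiming the walk at its neighbourhood in [W], a target of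
    density more than 3/8. *)
Lemma connect_rich (W : {set V}) h w s u v :
  semideg e (3/8 + eps) W -> h%:R <= eps / 8 * #|W|%:R ->
  2 + 2 / eps <= (size w)%:R ->
  rich W h (size w) (fun l => wpath e (rcons w s) u (rcons l v)).
Proof.
move=> degW hh sw.
have TW : nb e (~~ s) v :&: W \subset W by apply: subsetIr.
have c0 : 0 < 3/8 :> R by rewrite divr_gt0.
have e0 := eps0.
have W0 : 0 <= eps * #|W|%:R by rewrite mulr_ge0 // ltW.
apply: rich_sub (walk_rich oe eps0 eps8 degW c0 hh _ TW _ u sw) => //.
- move=> l sl _ /andP[wl]; rewrite !inE => /andP[sv _].
  by rewrite wpath_rcons // wl -stepN.
- by lra.
- by have := degW v (~~ s); have := W0; rewrite mulrDl; lra.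
Qed.

Hypothesis degV : semideg e (3/8 + eps) setT.

(** At least 3/8 of the pairs between [T] and the vertices are edges; vertices seeing less than an
    eighth of [T] contribute at most 1/8, and the remaining 1/4 needs a quarter of all vertices. *)
Lemma codegree_card s (T : {set V}) :
  (#|V| <= 4 * #|[set b | (#|T| <= 8 * #|T :&: nb e (~~ s) b|)%N]|)%N.
Proof.
set G := [set b | _].
have E2 : (8 * edges e s T setT <= 8 * (#|G| * #|T|) + #|V| * #|T|)%N.
  rewrite edgesC /edges (bigID (mem G)) /= mulnDr leq_add //.
    rewrite leq_mul2l /= -sum_nat_const big_mkcond [X in (_ <= X)%N]big_mkcond leq_sum // => b _ /=.
    by rewrite inE /=; case: ifP => // _; rewrite subset_leq_card ?subsetIr.
  rewrite big_distrr /= -sum_nat_const big_mkcond leq_sum // => b _.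
  rewrite inE /=; case: ifP => // bG; move: (bG); rewrite inE -ltnNge => /ltnW.
  by rewrite setIC.
have E3 : (3/8 + eps) * #|V|%:R * #|T|%:R <= (edges e s T setT)%:R.
  rewrite /edges natr_sum [X in X <= _]mulr_natr -sumr_const.
  by apply: ler_sum => x _; have := degV x s; rewrite cardsT.
case: (posnP #|T|) => [T0|T0].
  suff -> : G = setT by rewrite cardsT leq_pmull.
  by apply/setP => b; rewrite !inE T0.
have T1 : 0 < #|T|%:R :> R by rewrite ltr0n.
rewrite -(ler_nat R) natrD !natrM in E2.
have V0 : 0 <= eps * #|V|%:R * #|T|%:R by rewrite !mulr_ge0 // ltW.
rewrite -(ler_nat R) natrM -(ler_pM2r T1).
move: (edges _ _ _ _)%:R E2 E3 => E; lra.
Qed.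

(** Each new entry keeps an eighth of the current set. The surviving set is a target common to all
    tails of an absorber, so that any tail can be followed by any [b_t]. *)
Lemma common_rich s h M (T : {set V}) : (4 * h <= #|V|)%N ->
  rich setT h M (fun lb =>
    (#|T| <= 8 ^ M * #|[set x in T | all (step e s x) lb]|)%N).
Proof.
move=> hV; elim: M T => [|M IH] T /=.
  by rewrite mul1n subset_leq_card //; apply/subsetP => x xT; rewrite inE xT.
have := leq_trans hV (codegree_card s T); rewrite leq_pmul2l // => H.
apply: leq_trans H _; apply: subset_leq_card; apply/subsetP => b.
rewrite !inE => Tb; apply: rich_sub (IH (T :&: nb e (~~ s) b)) => // l _ _ H.
apply: leq_trans Tb _; rewrite expnS -mulnA leq_pmul2l //.
apply: leq_trans H _; rewrite leq_mul2l; apply/orP; right.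
apply: subset_leq_card; apply/subsetP => x.
by rewrite !inE stepN -!andbA.
Qed.

End RichTools.

(* An absorber exchanging [u] for [y] with respect to a word [s1 :: s2 :: _] is a
   family of [M = 2k - 1] rows, each a path carrying that word. It is built from
   - a closed chain [Y_0 = u, Y_1, .., Y_k = y, .., Y_M, Y_(M+1) = u] in which
     [Y_t, Y_(t+1)] are both [s1]-neighbours of [a_t] when [t < k], and both have
     the [s2]-neighbour [d_t] when [k <= t] ([d_t] follows [Y_t] alone if [t < k]);
   - paths [r_t] from [d_t], [1 <= t <= M], to a common neighbourhood of the [b_t].
   Row [t] is [a_t, Y_(t+1), d_(t+1), r_(t+1), b_t] before the exchange. After it
   the tail of row [t] is [d_t, r_t] (with [d_0 = d_M]), and its second vertex is
   [Y_t] if [t < k]: each row hands its tail to the next one, so that all vertices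
   but [y = Y_k] are used again and [u] has been inserted.
   The list [l] holds these vertices in the order in which they are chosen:
   [a] and [Y] for [t < k], then [d] and [Y] for [t >= k], then the other [d],
   the other [a], the [b] and the [r]. *)
Section AbsorberRows.
Variables (V : finType) (x0 : V) (k q : nat).

Definition abs_rows : nat := (2 * k).-1.
Definition abs_size : nat := (abs_rows * (q + 4))%N.

(** The blocks of [l] start at [0], [2k], [4k - 1], [5k - 2], [6k - 3] and [6k - 3 + abs_rows]. In
    the first, [Y_t] is at [2t - 1] and [a_t] at [2t]; in the second, relative to [2k], [Y_t] is at
    [2(t - k) - 1] and [d_t] at [2(t - k)]. *)
Definition abs_a (l : seq V) t := nth x0 l (if (t < k)%N then 2 * t else (5 * k).-2 + (t - k))%N.
Definition abs_y (l : seq V) t :=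
  nth x0 l (if (t <= k)%N then (2 * t).-1 else 2 * k + (2 * (t - k)).-1)%N.
Definition abs_d (l : seq V) t :=
  nth x0 l (if (t < k)%N then (4 * k).-1 + t.-1 else 2 * k + 2 * (t - k))%N.
Definition abs_b (l : seq V) t := nth x0 l ((6 * k - 3) + t)%N.
Definition abs_r (l : seq V) t := take q (drop (6 * k - 3 + abs_rows + t.-1 * q) l).

Definition row_before l t := abs_y l t.+1 :: abs_d l t.+1 :: rcons (abs_r l t.+1) (abs_b l t).

Definition row_after u l t :=
  let t' := if t == 0%N then abs_rows else t in
  (if t == 0%N then u else if (t < k)%N then abs_y l t else abs_y l t.+1)
    :: abs_d l t' :: rcons (abs_r l t') (abs_b l t).

Lemma mem_row_before l v : (0 < k)%N -> size l = abs_size -> v \in l ->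
  exists2 t, (t < abs_rows)%N & v \in abs_a l t :: row_before l t.
Proof.
rewrite /abs_size /abs_rows => k0 sl vl; have := vl; rewrite -index_mem sl.
have := nth_index x0 vl; move: (index v l) => i Ei hi.
have [i1|i1] := ltnP i (2 * k).
  have [t [b Et]] : exists t, exists b : bool, i = (2 * t + b)%N.
    by exists i./2, (odd i); rewrite addnC mul2n odd_double_half.
  exists t; first by case: b Et; lia.
  rewrite inE /row_before inE; case: b Et => Et.
    apply/orP; right; apply/orP; left; rewrite /abs_y -Ei; apply/eqP; congr nth.
    by case: ifP; lia.
  apply/orP; left; rewrite /abs_a -Ei; apply/eqP; congr nth.
  by case: ifP; lia.
have [i2|i2] := ltnP i (4 * k).-1.
  have [t [b Et]] : exists t, exists b : bool, i = (2 * k + 2 * t + b)%N.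
    exists (i - 2 * k)./2, (odd (i - 2 * k)).
    have := odd_double_half (i - 2 * k); rewrite -mul2n; lia.
  case: b Et => Et.
    exists (k + t)%N; first by lia.
    rewrite inE /row_before inE; apply/orP; right; apply/orP; left.
    by rewrite /abs_y -Ei; apply/eqP; congr nth; case: ifP; lia.
  exists (k + t).-1%N; first by lia.
  rewrite !inE; apply/orP; right; apply/orP; right; apply/orP; left.
  by rewrite /abs_d -Ei; apply/eqP; congr nth; case: ifP; lia.
have [i3|i3] := ltnP i (5 * k).-2.
  exists (i - (4 * k).-1)%N; first by lia.
  rewrite !inE; apply/orP; right; apply/orP; right; apply/orP; left.
  by rewrite /abs_d -Ei; apply/eqP; congr nth; case: ifP; lia.
have [i4|i4] := ltnP i (6 * k - 3)%N.
  exists (k + (i - (5 * k).-2))%N; first by lia.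
  rewrite inE; apply/orP; left.
  by rewrite /abs_a -Ei; apply/eqP; congr nth; case: ifP; lia.
have [i5|i5] := ltnP i (6 * k - 3 + (2 * k).-1)%N.
  exists (i - (6 * k - 3))%N; first by lia.
  rewrite !inE mem_rcons inE; do 3 (apply/orP; right); apply/orP; left.
  by rewrite /abs_b -Ei; apply/eqP; congr nth; lia.
pose j := (i - (6 * k - 3 + (2 * k).-1))%N.
have q0 : (0 < q)%N by case: (q) hi => //; lia.
have jq : (j < (2 * k).-1 * q)%N by rewrite /j; nia.
exists (j %/ q)%N; first by rewrite ltn_divLR.
rewrite !inE mem_rcons inE; do 4 (apply/orP; right).
have -> : v = nth x0 (abs_r l (j %/ q).+1) (j %% q).
  rewrite nth_take ?ltn_pmod // nth_drop -Ei; congr nth.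
  by rewrite /= -addnA -divn_eq /j /abs_rows; lia.
apply: mem_nth; rewrite size_take size_drop sl /abs_rows.
have jm := ltn_pmod j q0; have jd := divn_eq j q.
have : (j %/ q < (2 * k).-1)%N by rewrite ltn_divLR.
by case: ifP => // _; move: (j %/ q)%N (j %% q)%N jd jm => d r jd jm; rewrite /=; nia.
Qed.

(** [Y_t] with [t < k] moves from row [t - 1] to row [t], and [Y_t] with [t > k] stays in row
    [t - 1]. The tail of each row moves to the next one, cyclically. Only [Y_k] finds no new
    place. *)
Lemma mem_row_after u l v : (0 < k)%N -> size l = abs_size -> v \in l -> v != abs_y l k ->
  exists2 t, (t < abs_rows)%N & v \in abs_a l t :: row_after u l t.
Proof.
move=> k0 sl /(mem_row_before k0 sl)[t]; rewrite /abs_rows => ht.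
rewrite !inE mem_rcons inE => /or4P[/eqP->|/eqP->|/eqP->|/orP[/eqP->|vr]] vy.
- by exists t => //; rewrite inE eqxx.
- have [tk|tk] := ltnP t.+1 k.
    by exists t.+1; first lia; rewrite /row_after /= tk !inE eqxx orbT.
  exists t => //; rewrite /row_after.
  have tk' : t.+1 != k by apply: contra_neq vy => ->.
  by rewrite ifN 1?ifF ?inE ?eqxx ?orbT //; lia.
- have [tM|tM] := ltnP t.+1 (2 * k).-1.
    by exists t.+1 => //; rewrite /row_after /= !inE eqxx !orbT.
  exists 0%N; first by lia.
  rewrite /row_after /= /abs_rows; have -> : (2 * k).-1 = t.+1 by lia.
  by rewrite !inE eqxx !orbT.
- by exists t => //; rewrite /row_after !inE mem_rcons inE eqxx !orbT.
have [tM|tM] := ltnP t.+1 (2 * k).-1.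
  by exists t.+1 => //; rewrite /row_after /= !inE mem_rcons inE vr !orbT.
exists 0%N; first by lia.
rewrite /row_after /= /abs_rows; have E : (2 * k).-1 = t.+1 by lia.
by rewrite !inE mem_rcons inE; rewrite E vr !orbT.
Qed.

Lemma abs_sizeE : (0 < k)%N -> abs_size =
  (2 * k + ((2 * k).-1 + (k.-1 + (k.-1 + (abs_rows + abs_rows * q)))))%N.
Proof. by rewrite /abs_size /abs_rows; lia. Qed.

(** The ends of a row are untouched by the exchange, so the paths attached to it stay valid. *)
Lemma last_row u l t z : last z (row_before l t) = last z (row_after u l t).
Proof. by rewrite /row_before /row_after /= !last_rcons. Qed.

End AbsorberRows.

Section AbsorberRich.
Variables (V : finType) (e : rel V) (x0 : V) (k q : nat).

Definition absorbs (w : seq bool) (u : V) (U : {set V}) (l : seq V) : bool :=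
  (abs_y x0 k l k \in U) &&
  [forall t : 'I_(abs_rows k),
    wpath e w (abs_a x0 k l t) (row_before x0 k q l t) &&
    wpath e w (abs_a x0 k l t) (row_after x0 k q u l t)].

(** In a walk with this word two vertices at distance two see the vertex between them in the same
    way. *)
Definition alternating (a : bool) n := mkseq (fun i => a (+) odd i) n.

Section AbsorberCat.
Variables (lx lz ld la lb lD : seq V) (s1 s2 s3 : bool) (sg : seq bool) (u : V) (U : {set V}).
Hypotheses (k0 : (0 < k)%N) (slx : size lx = (2 * k)%N) (slz : size lz = (2 * k).-1)
  (sld : size ld = k.-1) (sla : size la = k.-1) (slb : size lb = abs_rows k)
  (slD : size lD = (abs_rows k * q)%N) (sq : size sg = q).
Let l := lx ++ (lz ++ (ld ++ (la ++ (lb ++ lD)))).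
Let yy t := (if (t <= k)%N then nth x0 lx (2 * t).-1 else nth x0 lz (2 * (t - k)).-1)%N.
Let aa t := (if (t < k)%N then nth x0 lx (2 * t) else nth x0 la (t - k))%N.
Let dd t := (if (t < k)%N then nth x0 ld t.-1 else nth x0 lz (2 * (t - k)))%N.
Let rr t := (take q (drop (t.-1 * q) lD))%N.

Let nthl i : nth x0 l i =
  if (i < 2 * k)%N then nth x0 lx i else
  if (i < (4 * k).-1)%N then nth x0 lz (i - 2 * k) else
  if (i < (5 * k).-2)%N then nth x0 ld (i - (4 * k).-1) else
  if (i < 6 * k - 3)%N then nth x0 la (i - (5 * k).-2) else
  if (i < 6 * k - 3 + (2 * k).-1)%N then nth x0 lb (i - (6 * k - 3)) else
  nth x0 lD (i - (6 * k - 3 + (2 * k).-1)).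
Proof.
rewrite /l nth_cat slx; case: ltnP => h1 //.
rewrite nth_cat slz; case: ltnP => h2; first by rewrite ifT //; lia.
rewrite ifF; last by lia.
rewrite nth_cat sld; case: ltnP => h3; first by rewrite ifT; [congr nth; lia|lia].
rewrite ifF; last by lia.
rewrite nth_cat sla; case: ltnP => h4; first by rewrite ifT; [congr nth; lia|lia].
rewrite ifF; last by lia.
rewrite nth_cat slb /abs_rows; case: ltnP => h5; first by rewrite ifT; [congr nth; lia|lia].
by rewrite ifF; [congr nth; lia|lia].
Qed.

Let Fy t : (0 < t <= abs_rows k)%N -> abs_y x0 k l t = yy t.
Proof.
rewrite /abs_rows /abs_y /yy => ht; case: leqP => tk; rewrite nthl.
  by rewrite ifT //; lia.
by rewrite ifF 1?ifT; [congr nth; lia|lia|lia].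
Qed.

Let Fd t : (0 < t <= abs_rows k)%N -> abs_d x0 k l t = dd t.
Proof.
rewrite /abs_rows /abs_d /dd => ht; case: ltnP => tk; rewrite nthl.
  by rewrite ifF 1?ifF 1?ifT; [congr nth; lia|lia|lia|lia].
by rewrite ifF 1?ifT; [congr nth; lia|lia|lia].
Qed.

Let Fa t : (t < abs_rows k)%N -> abs_a x0 k l t = aa t.
Proof.
rewrite /abs_rows /abs_a /aa => ht; case: ltnP => tk; rewrite nthl.
  by rewrite ifT //; lia.
by rewrite ifF 1?ifF 1?ifF 1?ifT; [congr nth; lia|lia|lia|lia|lia].
Qed.

Let Fb t : (t < abs_rows k)%N -> abs_b x0 k l t = nth x0 lb t.
Proof.
rewrite /abs_rows /abs_b => ht; rewrite nthl.
by rewrite ifF 1?ifF 1?ifF 1?ifF 1?ifT; [congr nth; lia|lia|lia|lia|lia|lia].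
Qed.

Let Fr t : (0 < t <= abs_rows k)%N -> abs_r k q l t = rr t.
Proof.
rewrite /abs_r /rr => ht; congr take.
rewrite -addnA addnC -drop_drop.
have -> : drop (6 * k - 3) l = lb ++ lD.
  rewrite /l !catA -(catA _ lb) drop_size_cat // !size_cat slx slz sld sla; lia.
by rewrite addnC -drop_drop drop_size_cat.
Qed.

Hypothesis wx : wpath e (alternating (~~ s1) (2 * k)) u lx.
Hypothesis wz : wpath e (rcons (alternating s2 (2 * k).-1) (~~ s2)) (last u lx) (rcons lz u).
Hypothesis Hd : forall t, (t < k.-1)%N -> step e s2 (nth x0 lx (2 * t).+1) (nth x0 ld t).
Hypothesis Ha : forall t, (t < k.-1)%N -> step e (~~ s1) (nth x0 lz (2 * t).+1) (nth x0 la t).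
Hypothesis HD : forall t, (t < abs_rows k)%N -> let r := take q (drop (t * q) lD) in
  wpath e sg (dd t.+1) r && all (step e s3 (last (dd t.+1) r)) lb.
Hypothesis yU : last u lx \in U.

Let Py : yy k = last u lx.
Proof.
rewrite /yy leqnn (last_nth x0) slx.
have : (0 < 2 * k)%N by lia.
by case: (2 * k)%N.
Qed.

Let Hx i : (i < 2 * k)%N -> step e (~~ s1 (+) odd i) (nth x0 (u :: lx) i) (nth x0 lx i).
Proof.
move=> hi; have := wpath_step wx; rewrite size_mkseq => /(_ i hi).
by rewrite nth_mkseq // !(set_nth_default x0 u) //= slx // ltnW.
Qed.

Let Hz i : (i < 2 * k)%N -> step e (s2 (+) odd i)
    (nth x0 (last u lx :: lz) i) (nth x0 (rcons lz u) i).
Proof.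
move=> hi; have := wpath_step wz; rewrite size_rcons size_mkseq => /(_ i).
have -> : (i < (2 * k).-1.+1)%N by lia.
move=> /(_ isT).
rewrite nth_rcons size_mkseq; have -> : (if (i < (2 * k).-1)%N then nth true (alternating s2 (2 * k).-1) i
    else if i == (2 * k).-1 then ~~ s2 else true) = s2 (+) odd i.
  case: ifP => hi2; first by rewrite nth_mkseq.
  have -> : i = (2 * k).-1 by lia.
  by rewrite eqxx -subn1 oddB ?oddM ?addbT //; lia.
have -> : nth (last u lx) (rcons lz u) i = nth x0 (rcons lz u) i.
  by apply: set_nth_default; rewrite size_rcons slz; lia.
suff -> : nth (last u lx) (last u lx :: rcons lz u) i = nth x0 (last u lx :: lz) i by [].
case: i hi => // i hi; rewrite /= nth_rcons slz ifT; last by lia.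
by apply: set_nth_default; rewrite slz; lia.
Qed.

Let Px t : (t < k)%N -> step e s1 (aa t) (yy t.+1).
Proof.
move=> tk; have := Hx (i := (2 * t).+1); rewrite /= oddM /= addbT negbK /aa /yy tk.
have -> : (2 * t.+1).-1 = (2 * t).+1 by lia.
by apply; lia.
Qed.

Let Px' t : (t < k)%N -> step e s1 (aa t) (if t == 0%N then u else yy t).
Proof.
move=> tk; have := Hx (i := (2 * t)%N); have -> : odd (2 * t) = false by rewrite oddM.
rewrite /aa /yy tk addbF stepN; case: t tk => [|t] tk H.
  by rewrite muln0 in H *; apply: H; lia.
rewrite (ltnW tk) (_ : t.+1 == 0%N = false) //.
have E : (2 * t.+1 = (2 * t).+2)%N by lia.
by rewrite E in H *; apply: H; lia.
Qed.

Let Pz t : (k <= t <= abs_rows k)%N -> step e s2 (yy t) (dd t).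
Proof.
rewrite /abs_rows => ht; have := Hz (i := (2 * (t - k))%N).
have -> : odd (2 * (t - k)) = false by rewrite oddM.
rewrite addbF /dd ifF; last by lia.
rewrite nth_rcons slz ifT; last by lia.
suff -> : nth x0 (last u lx :: lz) (2 * (t - k)) = yy t by apply; lia.
have [->|tk] := eqVneq t k; first by rewrite Py subnn.
rewrite /yy ifF; last by lia.
by have -> : (2 * (t - k) = (2 * (t - k)).-1.+1)%N by lia.
Qed.

Let Pz' t : (k <= t < abs_rows k)%N -> step e s2 (yy t.+1) (dd t).
Proof.
rewrite /abs_rows => ht; have := Hz (i := (2 * (t - k)).+1).
have -> : odd (2 * (t - k)).+1 = true by rewrite /= oddM.
rewrite addbT stepN /dd ifF; last by lia.
rewrite nth_rcons slz ifT; last by lia.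
rewrite /yy ifF; last by lia.
have -> : (2 * (t.+1 - k)).-1 = (2 * (t - k)).+1 by lia.
by apply; lia.
Qed.

Let Pu : step e s2 u (dd (abs_rows k)).
Proof.
have := Hz (i := (2 * k).-1).
have -> : odd (2 * k).-1 = true by rewrite -subn1 oddB ?oddM //; lia.
rewrite addbT stepN /dd /abs_rows ifF; last by lia.
rewrite nth_rcons slz ltnn eqxx.
have E : ((2 * k).-1 = (2 * ((2 * k).-1 - k)).+1)%N by lia.
by rewrite {1 2}E; apply; lia.
Qed.

Let Pa t : (t < abs_rows k)%N -> step e s1 (aa t) (yy t.+1).
Proof.
rewrite /abs_rows => ht; have [tk|tk] := ltnP t k; first exact: Px.
have := Ha (t := (t - k)%N); rewrite stepN /aa /yy !ifF; try by lia.
have -> : (2 * (t.+1 - k)).-1 = (2 * (t - k)).+1 by lia.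
by apply; lia.
Qed.

Let Pd t : (0 < t <= abs_rows k)%N -> step e s2 (yy t) (dd t).
Proof.
move=> ht; have [tk|tk] := ltnP t k; last by apply: Pz; lia.
have := Hd (t := t.-1); rewrite /dd /yy tk (ltnW tk).
have -> : (2 * t).-1 = (2 * t.-1).+1 by lia.
by apply; lia.
Qed.

Let Pr t j : (0 < t <= abs_rows k)%N -> (j < abs_rows k)%N ->
  wpath e (rcons sg s3) (dd t) (rcons (rr t) (nth x0 lb j)).
Proof.
case: t => // t ht hj; have /andP[w1 /allP w2] := HD ht.
have sr := size_wpath w1.
by rewrite wpath_rcons // w1 w2 // mem_nth // slb.
Qed.

(** The walk [lx] is [a_0, Y_1, a_1, .., Y_k], starting from [u] and ending at [y]; the walk [lz] is
    [d_k, Y_(k+1), d_(k+1), .., d_M], leading from [y] back to [u]. Alternation provides at each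
    [a_t] or [d_t] on them the two edges used before and after the exchange. *)
Lemma absorbs_cat : absorbs (s1 :: s2 :: rcons sg s3) u U l.
Proof.
have M0 : (0 < abs_rows k)%N by rewrite /abs_rows; lia.
have kM : (k <= abs_rows k)%N by rewrite /abs_rows; lia.
rewrite /absorbs Fy ?k0 // Py yU; apply/forallP => -[t ht] /=.
rewrite /row_before /row_after.
rewrite Fa // Fb // Fy // Fd // Fr // Pa // Pd // Pr //=.
have [t0|t0] := eqVneq t 0%N.
  rewrite Fd ?Fr ?M0 ?leqnn // Pr ?M0 ?leqnn // Pu.
  by have := Px' (t := t); rewrite t0 /= k0 => ->.
have ht' : (0 < t <= abs_rows k)%N by rewrite lt0n t0 ltnW.
rewrite Fd // Fr // Pr //; case: ltnP => tk.
  by rewrite Fy // Pd // andbT; have := Px' tk; rewrite (negbTE t0) => ->.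
by rewrite Pa // Pz' // tk.
Qed.

End AbsorberCat.

Variable R : realType.
Hypothesis oe : oriented e.
Variables (eps : R).
Hypothesis eps0 : 0 < eps.
Hypothesis eps8 : eps <= 1/8.
Hypothesis degV : semideg e (3/8 + eps) setT.

(** The blocks are chosen in list order. [U] is the target of the first walk, and the common
    neighbourhood of [lb], of density at least [8 ^- abs_rows k], is the target of every tail; [c]
    bounds both densities from below. *)
Lemma absorber_rich h (c : R) s1 s2 sg s3 u (U : {set V}) :
  (0 < k)%N -> 2 + 2 / eps <= (2 * k).-1%:R -> 2 + 2 / eps <= q%:R -> size sg = q ->
  0 < c -> c <= (8 ^ abs_rows k)%:R^-1 -> c * #|V|%:R <= #|U|%:R ->
  (4 * h <= #|V|)%N -> h%:R <= eps / 8 * #|V|%:R -> h%:R <= c * eps * #|V|%:R ->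
  rich setT h (abs_size k q) (absorbs (s1 :: s2 :: rcons sg s3) u U).
Proof.
move=> k0 k2 hq sq c0 c8 cU h4 h8 hc.
have e0 := eps0.
have kk2 : 2 + 2 / eps <= (2 * k)%:R.
  by apply: le_trans k2 _; rewrite ler_nat leq_pred.
pose alt := alternating.
have salt a n : size (alt a n) = n by rewrite size_mkseq.
have h8T : h%:R <= eps / 8 * #|[set: V]|%:R by rewrite cardsT.
have dege v s : (h <= #|[set x in [set: V] | step e s v x]|)%N.
  rewrite -(ler_nat R); apply: le_trans h8 _.
  have := degV v s; rewrite setIT cardsT /nb.
  have -> : [set y | step e s v y] = [set x in [set: V] | step e s v x].
    by apply/setP => x; rewrite !inE.
  apply: le_trans; apply: ler_wpM2r => //; lra.
rewrite abs_sizeE //.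
apply: rich_cat.
have := walk_rich oe eps0 eps8 degV c0 h8T _ (subsetT U) _ u.
rewrite cardsT => /(_ hc cU (alt (~~ s1) (2 * k)%N)); rewrite salt => /(_ kk2).
apply: rich_sub => // lx slx _ /andP[wx yU].
apply: rich_cat.
have := @connect_rich V e R oe eps eps0 eps8 setT h (alt s2 (2 * k).-1) (~~ s2)
  (last u lx) u degV h8T; rewrite salt => /(_ k2).
apply: rich_sub => // lz slz _ wz.
apply: rich_cat.
apply: rich_sub (@rich_indep V x0 setT h k.-1
  (fun t v => step e s2 (nth x0 lx (2 * t).+1) v) _) => // ld sld _ /forallP Hd.
apply: rich_cat.
apply: rich_sub (@rich_indep V x0 setT h k.-1
  (fun t v => step e (~~ s1) (nth x0 lz (2 * t).+1) v) _) => // la sla _ /forallP Ha.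
apply: rich_cat.
apply: rich_sub (common_rich eps0 degV s3 (abs_rows k) setT h4) => // lb slb _ Hb.
set Tgt := [set x in _ | _] in Hb.
pose dd t := (if (t < k)%N then nth x0 ld t.-1 else nth x0 lz (2 * (t - k)))%N.
have Tc : c * #|[set: V]|%:R <= #|Tgt|%:R.
  rewrite -(ler_nat R) natrM cardsT in Hb; rewrite cardsT.
  have p8 : 0 < (8 ^ abs_rows k)%:R :> R by rewrite ltr0n expn_gt0.
  rewrite -(ler_pM2l p8); apply: le_trans Hb.
  rewrite mulrA -[X in _ <= X]mul1r; apply: ler_wpM2r => //.
  by rewrite mulrC -ler_pdivlMr // div1r.
have hcT : h%:R <= c * eps * #|[set: V]|%:R by rewrite cardsT.
apply: rich_sub (@rich_flat V setT h q (abs_rows k)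
  (fun t l => wpath e sg (dd t.+1) l && (last (dd t.+1) l \in Tgt)) _) => //; last first.
  move=> t _; have := walk_rich oe eps0 eps8 degV c0 h8T hcT (subsetT Tgt) Tc (dd t.+1).
  by move=> /(_ sg); rewrite sq => /(_ hq).
move=> lD slD _ /forallP HD.
apply: absorbs_cat => //.
- by move=> t ht; have := Hd (Ordinal ht).
- by move=> t ht; have := Ha (Ordinal ht).
move=> t ht /=; have /andP[-> ] := HD (Ordinal ht).
by rewrite inE => /andP[].
Qed.

End AbsorberRich.

(** * Hall's theorem and regular subgraphs *)

Section Hall.
Variables (X Y : finType).
Implicit Types (A S : {set X}) (r : X -> Y -> bool).

Definition nbhd r S : {set Y} := [set y | [exists x in S, r x y]].

Lemma nbhdU r A S : nbhd r (A :|: S) = nbhd r A :|: nbhd r S.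
Proof.
apply/setP => y; rewrite !inE; apply/exists_inP/orP.
  by case=> x; rewrite inE => /orP[] xA rxy; [left|right]; apply/exists_inP; exists x.
by case=> /exists_inP[x xA rxy]; exists x => //; rewrite inE xA ?orbT.
Qed.

(* Halmos and Vaughan's induction. *)
Lemma hall r A (y0 : Y) : (forall S, S \subset A -> (#|S| <= #|nbhd r S|)%N) ->
  exists f : X -> Y, {in A &, injective f} /\ {in A, forall x, r x (f x)}.
Proof.
move: {2}#|A|.+1 (ltnSn #|A|) => n; elim: n A r => // n IH A r; rewrite ltnS => An H.
have [->|[x xA]] := set_0Vmem A.
  by exists (fun _ => y0); split=> x; rewrite inE.
have [/existsP[S /and4P[SA Sn0 SnA NS]]|] := boolP [exists S : {set X},
    [&& S \subset A, S != set0, S != A & (#|nbhd r S| <= #|S|)%N]].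
  have Slt : (#|S| < #|A|)%N by apply: proper_card; rewrite properEneq SnA.
  have [|f1 [f1i f1r]] := IH S r (leq_trans Slt An).
    by move=> T TS; apply: H; apply: subset_trans SA.
  have [||f2 [f2i f2r]] := IH (A :\: S) (fun x y => r x y && (y \notin nbhd r S)).
  - apply: leq_trans An; apply: proper_card; rewrite properE subsetDl /=.
    case/set0Pn: Sn0 => z zS; apply/negP => /subsetP/(_ z).
    by rewrite !inE zS (subsetP SA) //= => /(_ isT).
  - move=> T TAS.
    have TS : [disjoint T & S].
      by rewrite disjoints_subset; apply: subset_trans TAS _; rewrite setDE subsetIr.
    have := H (T :|: S); rewrite subUset SA (subset_trans TAS) ?subsetDl // => /(_ isT).
    rewrite nbhdU => H1.
    have : (#|T| + #|S| <= #|nbhd r T :\: nbhd r S| + #|S|)%N.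
      have -> : (#|T| + #|S| = #|T :|: S|)%N.
        by rewrite cardsU; move: TS; rewrite -setI_eq0 => /eqP->; rewrite cards0 subn0.
      apply: leq_trans H1 _; apply: leq_trans (_ : #|nbhd r T :\: nbhd r S| + #|nbhd r S| <= _)%N.
        have -> : nbhd r T :|: nbhd r S = (nbhd r T :\: nbhd r S) :|: nbhd r S.
          by apply/setP => y; rewrite !in_setU in_setD; case: (y \in nbhd r S); rewrite ?orbT.
        exact: leq_card_setU.
      by rewrite leq_add2l.
    rewrite leq_add2r => /leq_trans; apply; apply: subset_leq_card.
    apply/subsetP => y; rewrite in_setD => /andP[yS]; rewrite inE => /exists_inP[z zT rz].
    by rewrite inE; apply/exists_inP; exists z => //=; rewrite rz.
  exists (fun x => if x \in S then f1 x else f2 x); split.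
    move=> a b aA bA; case: ifP => aS; case: ifP => bS E.
    - exact: f1i.
    - have /f2r/andP[_] : b \in A :\: S by rewrite inE bS.
      rewrite inE -E => /negP[]; apply/exists_inP; exists a => //; exact: f1r.
    - have /f2r/andP[_] : a \in A :\: S by rewrite inE aS.
      rewrite inE E => /negP[]; apply/exists_inP; exists b => //; exact: f1r.
    - by apply: f2i; rewrite ?inE ?aS ?bS.
  move=> a aA; case: ifP => aS; first exact: f1r.
  by have /f2r/andP[] : a \in A :\: S by rewrite inE aS.
move/existsPn => H2.
have [y rxy] : exists y, r x y.
  have := H [set x]; rewrite sub1set xA cards1 => /(_ isT)/card_gt0P[y].
  by rewrite inE => /exists_inP[z /set1P-> rz]; exists y.
have [||f [fi fr]] := IH (A :\ x) (fun x' y' => r x' y' && (y' != y)).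
- by apply: leq_trans An; rewrite (cardsD1 x A) xA.
- move=> S SA; have [->|Sn0] := eqVneq S set0; first by rewrite cards0.
  have SA' : S \subset A by apply: subset_trans SA (subsetDl _ _).
  have := H2 S; rewrite SA' Sn0 /= negb_and negbK -ltnNge => /orP[/eqP SE|].
    by move: SA; rewrite SE => /subsetP/(_ x xA); rewrite !inE eqxx.
  move=> lt; rewrite -ltnS; apply: leq_trans lt _.
  rewrite (cardsD1 y) -add1n leq_add ?leq_b1 //; apply: subset_leq_card.
  apply/subsetP => z; rewrite !inE => /andP[zy /exists_inP[w wS rw]].
  by apply/exists_inP; exists w; rewrite // rw.
exists (fun a => if a == x then y else f a); split.
  move=> a b aA bA; case: eqP => [->|/eqP ax]; case: eqP => [->|/eqP bx] // E.
  - have /fr/andP[_] : b \in A :\ x by rewrite !inE bx.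
    by rewrite -E eqxx.
  - have /fr/andP[_] : a \in A :\ x by rewrite !inE ax.
    by rewrite E eqxx.
  - by apply: fi; rewrite ?inE ?ax ?bx.
move=> a aA; case: eqP => [->//|/eqP ax].
by have /fr/andP[] : a \in A :\ x by rewrite !inE ax.
Qed.

End Hall.

(** Hall's theorem after adding [d] vertices joined to everything; the elements matched to them are
    dropped. *)
Lemma hall_deficiency (X Y : finType) (r : X -> Y -> bool) (A : {set X}) (y0 : Y) (d : nat) :
  (forall S : {set X}, S \subset A -> (#|S| <= #|nbhd r S| + d)%N) ->
  exists (A' : {set X}) (f : X -> Y), [/\ A' \subset A, (#|A :\: A'| <= d)%N,
    {in A' &, injective f} & {in A', forall x, r x (f x)}].
Proof.
move=> H.
pose r' x (y : Y + 'I_d) := if y is inl y then r x y else true.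
have [|f [fi fr]] := @hall _ _ r' A (inl y0).
  move=> S SA; have [->|/set0Pn[x xS]] := eqVneq S set0; first by rewrite cards0.
  apply: leq_trans (H S SA) _.
  have -> : nbhd r' S = [set inl y | y in nbhd r S] :|: [set inr i | i in [set: 'I_d]].
    apply/setP => -[y|i]; rewrite !inE.
      apply/exists_inP/orP.
        by case=> z zS rz; left; apply: imset_f; rewrite inE; apply/exists_inP; exists z.
      case=> /imsetP[z] //; rewrite inE => /exists_inP[w wS rw] [->].
      by exists w.
    rewrite [X in _ || X]imset_f ?inE // orbT; apply/exists_inP; by exists x.
  rewrite cardsU card_imset; last by move=> ? ? [].
  rewrite card_imset; last by move=> ? ? [].
  rewrite cardsT card_ord [X in (_ - X)%N](_ : _ = 0%N) ?subn0 //.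
  apply/eqP; rewrite cards_eq0; apply/eqP/setP => -[y|i]; rewrite !inE.
    by apply/negP => /andP[_ /imsetP[]].
  by apply/negP => /andP[/imsetP[]].
exists [set x in A | if f x is inl _ then true else false].
exists (fun x => if f x is inl y then y else y0); split.
- by apply/subsetP => x; rewrite inE => /andP[].
- rewrite -[X in (_ <= X)%N]card_ord.
  have [->|/set0Pn[x xA]] := eqVneq (A :\: [set x in A | if f x is inl _ then true else false]) set0.
    by rewrite cards0.
  have [i0 _] : exists i : 'I_d, f x = inr i.
    by move: xA; rewrite !inE => /andP[+ xA]; rewrite xA /=; case: (f x) => // i _; exists i.
  rewrite -(@card_in_imset _ _ (fun x => if f x is inr i then i else i0)).
    by apply: max_card.
  move=> a b; rewrite !inE => /andP[+ aA] /andP[+ bA]; rewrite aA bA /=.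
  case Ea: (f a) => // [i]; case Eb: (f b) => // [j] _ _ ij.
  by apply: fi => //; rewrite Ea Eb ij.
- move=> a b; rewrite !inE => /andP[aA +] /andP[bA +].
  by case Ea: (f a) => // [y]; case Eb: (f b) => // [z] _ _ yz; apply: fi => //; rewrite Ea Eb yz.
move=> a; rewrite inE => /andP[aA]; have := fr a aA.
by case: (f a).
Qed.

Section Regular.
Variable R : realType.

(** Hall's condition by the size of [S]: below 3/8 one out-neighbourhood is larger, up to 5/8
    [expansion] with [h = 1] applies, and above 5/8 every vertex of [W] has an in-neighbour in
    [S]. *)
Lemma perfect_matching (V : finType) (e : rel V) (eps : R) (W : {set V}) :
  oriented e -> 0 < eps -> eps <= 1/8 -> semideg e (3/8 + eps) W ->
  1 <= eps / 8 * #|W|%:R ->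
  exists f : V -> V, {in W &, injective f} /\ {in W, forall x, (f x \in W) && e x (f x)}.
Proof.
move=> oe eps0 eps8 degW W1.
have /card_gt0P[y0 _] : (0 < #|W|)%N.
  rewrite lt0n; apply/negP => /eqP W0; move: W1; rewrite W0 mulr0; lra.
have W0 : 0 <= #|W|%:R :> R by [].
apply: (@hall _ _ (fun x y => (y \in W) && e x y) W y0) => S SW.
set N := nbhd _ S.
have NE : N = back e W false 1 S.
  apply/setP => y; rewrite !inE; apply/exists_inP/andP.
    case=> x xS /andP[yW xy]; split=> //; apply/card_gt0P; exists x.
    by rewrite !inE /step xy.
  case=> yW /card_gt0P[x]; rewrite !inE => /andP[xy xS].
  by exists x; rewrite ?yW.
have [->|/set0Pn[x xS]] := eqVneq S set0; first by rewrite cards0.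
have [S3|S3] := leP (3/8 * #|W|%:R) (#|S|%:R : R); last first.
  rewrite -(ler_nat R); apply: le_trans (ltW S3) _.
  apply: (@le_trans _ _ #|nb e true x :&: W|%:R).
    by apply: le_trans (degW x true); apply: ler_wpM2r => //; lra.
  rewrite ler_nat subset_leq_card //; apply/subsetP => y; rewrite !inE => /andP[xy yW].
  by apply/exists_inP; exists x => //; rewrite yW.
have [S5|S5] := leP (#|S|%:R : R) (5/8 * #|W|%:R).
  rewrite NE -(ler_nat R).
  have := expansion oe eps0 eps8 degW false SW (W1 : 1%:R <= _) S3 S5; lra.
have -> : N = W; last exact: subset_leq_card.
rewrite NE; apply/eqP; rewrite eqEsubset back_sub; apply/subsetP => y yW.
rewrite inE yW /=; have W1' : 1%:R <= eps * #|W|%:R.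
  by apply: le_trans W1 _; apply: ler_wpM2r => //; lra.
exact: (@back_full _ _ e eps W degW false 1%N S W1' SW (ltW S5)).
Qed.

(* Perfect matchings are removed one by one; the remaining graph keeps
   semidegree [3/8 + eps / 2] into [W] throughout. *)
Lemma regular_subgraph (V : finType) (e : rel V) (eps : R) (W : {set V}) j :
  oriented e -> 0 < eps -> eps <= 1/8 -> semideg e (3/8 + eps) W ->
  1 <= eps / 16 * #|W|%:R -> j%:R <= eps / 2 * #|W|%:R ->
  exists H : rel V, (forall x y, H x y -> [/\ e x y, x \in W & y \in W]) /\
    (forall s, {in W, forall x, #|nb H s x| = j}).
Proof.
move=> oe eps0 eps8 degW W1; elim: j => [|j IH] jW.
  exists (fun _ _ => false); split=> // s x _; apply/eqP; rewrite cards_eq0.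
  by apply/eqP/setP => y; rewrite !inE /step; case: s.
have jW' : j%:R <= eps / 2 * #|W|%:R :> R by apply: le_trans jW; rewrite ler_nat.
have [H [He Hr]] := IH jW'.
pose e' x y := e x y && ~~ H x y.
have oe' : oriented e'.
  split=> [x|x y /andP[xy _]]; first by rewrite negb_and oe.1.
  by rewrite negb_and (oe.2 _ _ xy).
have deg' : semideg e' (3/8 + eps / 2) W.
  move=> v s.
  have -> : nb e' s v :&: W = (nb e s v :&: W) :\: nb H s v.
    by apply/setP => y; rewrite !inE /step /e'; case: s; rewrite -andbA andbC -andbA (andbC (_ \in W)).
  have : (#|nb e s v :&: W| <= #|(nb e s v :&: W) :\: nb H s v| + j)%N.
    rewrite cardsD; have : (#|(nb e s v :&: W) :&: nb H s v| <= j)%N.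
      apply: leq_trans (subset_leq_card (subsetIr _ _)) _.
      case: (boolP (v \in W)) => [vW|vW]; first by rewrite Hr.
      rewrite (_ : nb H s v = set0) ?cards0 //; apply/setP => y; rewrite !inE /step.
      apply/negP; case: (s) => /He[] => [_ vW'|_ _ vW']; by rewrite vW' in vW.
    lia.
  rewrite -(ler_nat R) natrD; have := degW v s; lra.
have e20 : 0 < eps / 2 by rewrite divr_gt0.
have [||f [fi fW]] := perfect_matching oe' e20 _ deg'; [lra| lra|].
have W0 : 0 <= #|W|%:R :> R by [].
(* Surjectivity is what raises the in-degrees by one as well. *)
have fimg : f @: W = W.
  apply/eqP; rewrite eqEcard card_in_imset // leqnn andbT.
  by apply/subsetP => y /imsetP[x xW ->]; case/andP: (fW x xW).
exists (fun x y => H x y || [&& x \in W & y == f x]); split.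
  move=> x y /orP[/He //|/andP[xW /eqP->]].
  by case/andP: (fW x xW) => -> /andP[].
move=> s x xW; case: s.
  rewrite (_ : nb _ _ _ = f x |: nb H true x); last first.
    by apply/setP => y; rewrite !inE /step xW orbC.
  by rewrite cardsU1 Hr // inE /step; case/andP: (fW x xW) => _ /andP[_ ->].
have : x \in f @: W by rewrite fimg.
case/imsetP => z zW xz.
rewrite (_ : nb _ _ _ = z |: nb H false x); last first.
  apply/setP => y; rewrite !inE /step orbC; congr (_ || _).
  apply/andP/eqP => [[yW /eqP E]|->]; last by rewrite zW xz.
  by apply: fi; rewrite // -E -xz.
rewrite cardsU1 Hr // inE /step xz.
by case/andP: (fW z zW) => _ /andP[_ ->].
Qed.

End Regular.

(** * Greedy selection *)

Lemma averaging (R : realType) (A : finType) (a0 : A) (f : A -> R) (x : R) :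
  #|A|%:R * x <= \sum_a f a -> exists a, x <= f a.
Proof.
move=> H; case: (pickP (fun a => x <= f a)) => [a Ha|Hn]; first by exists a.
have : \sum_a f a < \sum_(a : A) x.
  by apply: ltr_sum => [|a _]; [apply/hasP; exists a0; rewrite ?mem_index_enum|rewrite ltNge Hn].
rewrite sumr_const -[_ *+ _]mulr_natl; move=> /(le_lt_trans H).
by rewrite cardT ltxx.
Qed.

(* Multiplicative weights: a condition [e] met [j] times weighs [2 ^- j]; a
   choice that meets at least a [c]-fraction of the current weight shrinks the
   total by [1 - c / 2], which forces every condition to be met often. *)
Lemma greedy_selection (R : realType) (E A V : finType) (a0 : A) (supp : A -> seq V)
    (N n : nat) (good : nat -> E -> A -> bool) (c : R) :
  0 < c -> c <= 1 -> (0 < #|E|)%N -> (forall a, size (supp a) = N) ->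
  (forall i e (F : {set V}), (i < n)%N -> (#|F| <= n * N)%N -> c * #|A|%:R <=
     #|[set a | [&& good i e a, uniq (supp a) & all (fun v => v \notin F) (supp a)]]|%:R) ->
  exists a : nat -> A, [/\ uniq (flatten (mkseq (fun i => supp (a i)) n)),
    (forall i, (i < n)%N -> exists e, good i e (a i)) &
    forall e, (1 + c / 2) ^+ n <= #|E|%:R * 2 ^+ (\sum_(i < n) good i e (a i))].
Proof.
move=> c0 c1 E0 sN H.
suff Hj j : (j <= n)%N -> exists a : nat -> A,
    [/\ uniq (flatten (mkseq (fun i => supp (a i)) j)),
    (forall i, (i < j)%N -> exists e, good i e (a i)) &
    \sum_(e : E) 2 ^- (\sum_(i < j) good i e (a i)) <= #|E|%:R * (1 - c / 2) ^+ j].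
  have [a [ua ga wa]] := Hj n (leqnn n).
  exists a; split=> // e; set h := (\sum_(i < n) _)%N.
  have h1 : 2 ^- h <= #|E|%:R * (1 - c / 2) ^+ n.
    apply: le_trans wa; rewrite (bigD1 e) //= lerDl sumr_ge0 // => e' _.
    by rewrite invr_ge0 exprn_ge0.
  have h2 : 0 < 2 ^+ h :> R by rewrite exprn_gt0.
  have c2 : 0 <= (1 + c / 2) ^+ n by rewrite exprn_ge0 //; lra.
  (* Multiplying by [1 + c / 2] replaces division by [1 - c / 2], since the product of the two is at
     most [1]. *)
  have : (1 + c / 2) ^+ n * 2 ^- h * 2 ^+ h <= #|E|%:R * ((1 - c/2) * (1 + c/2)) ^+ n * 2 ^+ h.
    rewrite ler_pM2r // exprMn mulrA mulrC [X in _ <= X]mulrC.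
    by rewrite [X in _ <= X]mulrC ler_wpM2r.
  rewrite divfK ?gt_eqF // => /le_trans; apply; rewrite ler_pM2r //.
  rewrite -[X in _ <= X]mulr1 ler_wpM2l // exprn_ile1 //; first by apply: mulr_ge0; lra.
  have : 0 <= c * c by rewrite mulr_ge0 // ltW.
  lra.
elim: j => [_|j IH jn].
  exists (fun _ => a0); split=> //=; rewrite expr0 mulr1.
  by under eq_bigr do rewrite big_ord0 expr0 invr1; rewrite sumr_const.
have [a [ua ga wa]] := IH (ltnW jn).
pose w (e : E) : R := 2 ^- (\sum_(i < j) good i e (a i)).
pose F := [set v | v \in flatten (mkseq (fun i => supp (a i)) j)].
have w0 e : 0 < w e by rewrite invr_gt0 exprn_gt0.
have sF : (#|F| <= n * N)%N.
  rewrite cardsE; apply: leq_trans (card_size _) _; rewrite size_flatten /shape -map_comp.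
  rewrite (eq_map (g := fun=> N)) => [|i /=]; last exact: sN.
  have : all (pred1 N) (map (fun=> N) (iota 0 j)) by elim: (iota 0 j) => //= ? ?; rewrite eqxx.
  move=> /all_pred1P ->; rewrite size_map size_iota sumn_nseq mulnC leq_mul2r (ltnW jn) ?orbT //.
pose good' e b := [&& good j e b, uniq (supp b) & all (fun v => v \notin F) (supp b)].
have sw0 : 0 < \sum_e w e.
  have /card_gt0P[e0 _] := E0.
  by rewrite (bigD1 e0) //= ltr_pwDl // sumr_ge0 // => e _; exact: ltW.
have [|b Hb] := @averaging R A a0 (fun b => \sum_e w e * (good' e b)%:R) (c * \sum_e w e).
  rewrite exchange_big /= mulrA mulr_sumr; apply: ler_sum => e _.
  rewrite -mulr_sumr [X in X <= _]mulrC ler_pM2l // mulrC; apply: le_trans (H j e F jn sF) _.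
  rewrite -sum1_card natr_sum big_mkcond /=; apply: ler_sum => b _.
  by rewrite inE /good'; case: ifP.
(* The score of [b] is positive, so [b] meets some condition, and [good'] then makes it disjoint
   from the earlier choices. *)
have [e /and3P[g1 g2 g3]] : exists e, good' e b.
  case: (pickP (good' ^~ b)) => [e He|Hn]; first by exists e.
  move: Hb => /=; rewrite [X in _ <= X]big1 => [|e _]; last by have /= -> := Hn e; rewrite mulr0.
  by rewrite leNgt mulr_gt0.
exists (fun i => if i == j then b else a i).
have Em T (f : A -> T) : map (fun i => f (if i == j then b else a i)) (iota 0 j) =
    map (fun i => f (a i)) (iota 0 j).
  by apply/eq_in_map => i; rewrite mem_iota /= => hi; rewrite ifN // neq_ltn hi.
split.
- rewrite mkseqS flatten_rcons eqxx /mkseq (Em _ supp) cat_uniq ua g2 andbT /=.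
  by apply/hasPn => v vb; move/allP: g3 => /(_ v vb); rewrite inE.
- move=> i; rewrite ltnS leq_eqVlt; case: eqVneq => [-> _|ij /= hi]; first by exists e.
  exact: ga.
apply: le_trans (_ : \sum_e' w e' * (1 - (good' e' b)%:R / 2) <= _).
  apply: ler_sum => e' _; rewrite big_ord_recr /= eqxx exprD invfM.
  rewrite (eq_bigr (fun i : 'I_j => (good i e' (a i) : nat))) => [|i _]; last first.
    by rewrite ifN // neq_ltn ltn_ord.
  rewrite ler_pM2l //; last exact: w0.
  by rewrite /good'; case: (good j e' b); [case: (_ && _)|] => /=; rewrite ?expr1 ?expr0 ?invr1; lra.
under eq_bigr do rewrite mulrBr mulr1 mulrA.
rewrite sumrB -mulr_suml exprSr.
have : c * \sum_e w e <= \sum_e w e * (good' e b)%:R by [].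
have : (1 - c / 2) * \sum_e w e <= (1 - c/2) * (#|E|%:R * (1 - c / 2) ^+ j).
  by apply: ler_wpM2l; [lra|exact: wa].
lra.
Qed.

(** * Random partitions *)

(** Apply [1 + y <= expR y] at [y = - x / (1 + x)], where the left side is [1 / (1 + x)]; then use
    [x / (1 + x) = x - x ^+ 2 / (1 + x)] and [1 + x >= 1/2]. *)
Lemma expR_le1D (R : realType) (x t : R) : 0 <= t -> t <= 1/2 -> `|x| <= t ->
  expR (x - 2 * t ^+ 2) <= 1 + x.
Proof.
move=> t0 t1; rewrite ler_norml => /andP[x1 x2].
have x3 : 0 < 1 + x by lra.
have h1 : x * x <= t * t.
  have : 0 <= (t - x) * (t + x) by apply: mulr_ge0; lra.
  lra.
rewrite -[X in X <= _]invrK -expRN -[X in _ <= X]invrK lef_pV2 ?posrE ?invr_gt0 ?expR_gt0 //.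
have : 1 + (- (x / (1 + x))) <= expR (- (x / (1 + x))) := expR_ge1Dx _.
have -> : 1 + (- (x / (1 + x))) = (1 + x)^-1 by field; rewrite gt_eqF.
move=> /le_trans; apply; rewrite ler_expR lerN2 ler_pdivlMr // expr2.
have : t * t * (1/2) <= t * t * (1 + x) by apply: ler_wpM2l; [apply: mulr_ge0|lra].
lra.
Qed.

(* Colour the vertices independently with law [p]. For every set [X g], colour
   [a] and sign, the product of the [1 +- t * z a (phi v)] over [X g] has mean
   [1], so some [phi] keeps all of them below their number; a deviation of
   [d * #|V|] would make one of them larger than [expR (d ^+ 2 / 8 * #|V|)]. *)
Lemma random_partition (R : realType) (V P G : finType) (p : P -> R)
    (X : G -> {set V}) (d : R) :
  (forall a, 0 <= p a) -> \sum_a p a = 1 -> 0 < d -> d <= 1 ->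
  (2 * (#|G| * #|P|))%:R < expR (d ^+ 2 / 8 * #|V|%:R) ->
  exists phi : V -> P, forall g a,
    `| #|[set v in X g | phi v == a]|%:R - p a * #|X g|%:R | <= d * #|V|%:R.
Proof.
move=> p0 p1 d0 d1 big.
pose z a x : R := (x == a)%:R - p a.
(* This maximises [t * d - 2 * t ^+ 2], the gain from a deviation [d] minus the loss in [expR_le1D];
   the maximum is [d ^+ 2 / 8]. *)
pose t := d / 4.
have t0 : 0 <= t by rewrite /t; lra.
have t1 : t <= 1/2 by rewrite /t; lra.
have pa1 a : p a <= 1 by rewrite -p1 (bigD1 a) //= lerDl sumr_ge0.
have z1 a x : `|z a x| <= 1.
  by rewrite /z ler_norml; have := p0 a; have := pa1 a; case: (x == a); rewrite /= ?mulr1n ?mulr0n; lra.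
pose sg (b : bool) : R := if b then 1 else -1.
have sz b a x : `|t * (sg b * z a x)| <= t.
  rewrite normrM (ger0_norm t0) -[X in _ <= X]mulr1 ler_wpM2l // normrM /sg.
  by case: b; rewrite ?normrN normr1 mul1r.
pose F (i : G * P * bool) (phi : {ffun V -> P}) : R :=
  \prod_(v in X i.1.1) (1 + t * (sg i.2 * z i.1.2 (phi v))).
pose mu (phi : {ffun V -> P}) : R := \prod_v p (phi v).
have mu0 phi : 0 <= mu phi by apply: prodr_ge0.
have mu1 : \sum_phi mu phi = 1.
  by rewrite -(bigA_distr_bigA (fun _ x => p x)) big1.
have EF i : \sum_phi mu phi * F i phi = 1.
  pose h v x := p x * (if v \in X i.1.1 then 1 + t * (sg i.2 * z i.1.2 x) else 1).
  rewrite (eq_bigr (fun phi : {ffun V -> P} => \prod_v h v (phi v))); last first.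
    by move=> phi _; rewrite /F /mu [X in _ * X]big_mkcond -big_split.
  rewrite -bigA_distr_bigA big1 // => v _; rewrite /h; case: (v \in X i.1.1).
    under eq_bigr do rewrite mulrDr mulr1.
    rewrite big_split /= p1.
    suff -> : \sum_x p x * (t * (sg i.2 * z i.1.2 x)) = 0 by rewrite addr0.
    under eq_bigr do rewrite mulrCA (mulrCA (p _)).
    rewrite -!mulr_sumr /z.
    under eq_bigr do rewrite mulrBr.
    rewrite sumrB -mulr_suml p1 mul1r (bigD1 i.1.2) //= eqxx mulr1 big1 ?addr0 ?subrr ?mulr0 //.
    by move=> x /negbTE->; rewrite mulr0.
  by under eq_bigr do rewrite mulr1.
have F0 i phi : 0 <= F i phi.
  apply: prodr_ge0 => v _; have := sz i.2 i.1.2 (phi v); rewrite ler_norml; lra.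
pose K : R := #|{: G * P * bool}|%:R.
have [phi Hphi] : exists phi, \sum_i F i phi <= K.
  case: (pickP (fun phi => \sum_i F i phi <= K)) => [phi H|H]; first by exists phi.
  have : \sum_phi mu phi * (\sum_i F i phi - K) = 0.
    under eq_bigr do rewrite mulrBr.
    rewrite sumrB -mulr_suml mu1 mul1r.
    under eq_bigr do rewrite mulr_sumr.
    by rewrite exchange_big /= (eq_bigr (fun=> 1)) ?sumr_const ?subrr.
  move/eqP; rewrite psumr_eq0 => [/allP H0|phi _]; last first.
    by rewrite mulr_ge0 // subr_ge0 ltW // ltNge H.
  suff : \sum_phi mu phi = 0 by rewrite mu1 => /eqP; rewrite oner_eq0.
  rewrite big1 // => phi _; have /= := H0 phi (mem_index_enum _); rewrite mulf_eq0.
  by case/orP => [/eqP //|]; rewrite subr_eq0 => /eqP E; have := H phi; rewrite E lexx.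
have FK i : F i phi <= K.
  by apply: le_trans Hphi; rewrite (bigD1 i) //= lerDl sumr_ge0.
have dev g a b : sg b * \sum_(v in X g) z a (phi v) <= d * #|V|%:R.
  rewrite leNgt; apply/negP => Hd.
  have : expR (d ^+ 2 / 8 * #|V|%:R) <= K.
    apply: le_trans (FK (g, a, b)).
    apply: le_trans (_ : expR (\sum_(v in X g) (t * (sg b * z a (phi v)) - 2 * t ^+ 2)) <= _).
      rewrite ler_expR sumrB -!mulr_sumr sumr_const -[_ *+ _]mulr_natr.
      have XV : #|X g|%:R <= #|V|%:R :> R by rewrite ler_nat max_card.
      have := ler_wpM2l (exprn_ge0 2 t0) XV.
      have t2 : 0 < t by rewrite /t divr_gt0.
      have := Hd; rewrite -(ltr_pM2l t2) /t !expr2; lra.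
    by rewrite expR_sum; apply: ler_prod => v _; rewrite expR_ge0 expR_le1D.
  rewrite leNgt; apply/negP; rewrite negbK; apply: le_lt_trans big.
  by rewrite /K ler_nat !card_prod card_bool mulnC.
exists phi => g a.
have -> : #|[set v in X g | phi v == a]|%:R - p a * #|X g|%:R = \sum_(v in X g) z a (phi v).
  rewrite /z sumrB sumr_const -[p a *+ _]mulr_natr -natr_sum; congr (_%:R - _).
  rewrite -sum1_card big_mkcond [RHS]big_mkcond; apply: eq_bigr => v _.
  by rewrite inE; case: (v \in X g); case: eqP.
have := dev g a true; have := dev g a false; rewrite /sg ler_norml; lra.
Qed.

(** * Families of disjoint paths *)

(** Counting edges between [S] and its neighbourhood [N] gives [#|S| * lo <= #|N| * hi], so the
    deficiency is at most [#|X| * (hi - lo) / hi]. *)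
Lemma near_matching (R : realType) (V : finType) (H : rel V) (X Y : {set V}) s (lo hi : R) (D : nat) :
  {in X, forall x, lo <= #|nb H s x :&: Y|%:R} ->
  {in Y, forall y, #|nb H (~~ s) y :&: X|%:R <= hi} ->
  0 <= lo -> lo <= hi -> #|X|%:R * (hi - lo) < D%:R * hi ->
  exists (Z : {set V}) (f : V -> V), [/\ Z \subset X, (#|X :\: Z| <= D)%N,
    {in Z &, injective f} & {in Z, forall x, (f x \in Y) && step H s x (f x)}].
Proof.
move=> Xlo Yhi lo0 lohi HD.
have [->|/set0Pn[x0 _]] := eqVneq X set0.
  exists set0, id; split=> //; first by rewrite setD0 cards0.
  by move=> x; rewrite inE.
apply: (@hall_deficiency _ _ (fun x y => (y \in Y) && step H s x y) X x0 D) => S SX.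
set N := nbhd _ S.
have E1 : #|S|%:R * lo <= (edges H s S N)%:R.
  rewrite /edges natr_sum mulrC mulr_natr -sumr_const; apply: ler_sum => x xS.
  apply: le_trans (Xlo x (subsetP SX _ xS)) _; rewrite ler_nat subset_leq_card //.
  apply/subsetP => y; rewrite !inE => /andP[xy yY]; rewrite xy.
  by apply/exists_inP; exists x; rewrite ?yY.
have E2 : (edges H s S N)%:R <= #|N|%:R * hi.
  rewrite edgesC /edges natr_sum mulrC mulr_natr -sumr_const; apply: ler_sum => y.
  rewrite inE => /exists_inP[x _ /andP[yY _]].
  by apply: le_trans (Yhi y yY); rewrite ler_nat subset_leq_card // setIS.
rewrite leqNgt; apply/negP => lt.
have lt' : #|N|%:R + D%:R <= #|S|%:R :> R by rewrite -natrD ler_nat ltnW.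
have SX' : #|S|%:R <= #|X|%:R :> R by rewrite ler_nat subset_leq_card.
have h0 : 0 <= hi by apply: le_trans lohi.
have h1 := ler_wpM2r h0 lt'.
have h2 : #|S|%:R * (hi - lo) <= #|X|%:R * (hi - lo) by apply: ler_wpM2r => //; lra.
have : 0 < 0 :> R by lra.
by rewrite ltxx.
Qed.

Section Chain.
Variables (V : finType) (e : rel V) (f : nat -> V -> V) (X Y : nat -> {set V}) (D : nat).

Fixpoint follow i x := if i is i'.+1 then f i' (follow i' x) else x.

(** A path is lost at step [i] when its current end lies in [X i] but outside [Y i]. As [follow i]
    is injective on the survivors, at most [D] paths are lost there. *)
Lemma chain_paths k (w : seq bool) :
  (forall i, (i < k)%N -> [/\ Y i \subset X i, (#|X i :\: Y i| <= D)%N,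
     {in Y i &, injective (f i)} &
     {in Y i, forall x, (f i x \in X i.+1) && step e (nth true w i) x (f i x)}]) ->
  exists G : {set V}, [/\ (#|X 0%N| <= #|G| + k * D)%N,
    (forall i, (i <= k)%N -> {in G &, injective (follow i)}),
    (forall i x, (i <= k)%N -> x \in G -> follow i x \in X i) &
    (forall i x, (i < k)%N -> x \in G -> step e (nth true w i) (follow i x) (follow i.+1 x))].
Proof.
elim: k => [|k IH] H.
  exists (X 0%N); split=> //; first by rewrite mul0n addn0.
    by case=> // _ x y _ _.
  by case.
have [i hi|G [cG iG XG sG]] := IH; first by apply: H; apply: ltnW.
have [YX cY iY fY] := H k (ltnSn k).
pose G' := [set x in G | follow k x \in Y k].
have G'G x : x \in G' -> x \in G by rewrite inE => /andP[].
exists G'; split.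
- apply: leq_trans cG _; rewrite mulSn addnA leq_add2r.
  rewrite -(cardsID G' G) leq_add ?subset_leq_card ?subsetIr //.
  apply: leq_trans cY; rewrite -(card_in_imset (f := follow k) (D := G :\: G')).
    apply: subset_leq_card; apply/subsetP => y /imsetP[x].
    rewrite !inE => /andP[+ xG] ->; rewrite xG /= => ->.
    exact: XG.
  by move=> x y /setDP[xG _] /setDP[yG _]; apply: iG.
- move=> i; rewrite leq_eqVlt => /orP[/eqP-> x y|]; last first.
    by rewrite ltnS => hi x y /G'G xG /G'G yG; apply: iG.
  rewrite !inE => /andP[xG xY] /andP[yG yY] /= /iY E; apply: (iG k) => //.
  exact: E.
- move=> i x; rewrite leq_eqVlt => /orP[/eqP->|].
    by rewrite inE => /andP[xG /fY/andP[]].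
  by rewrite ltnS => hi /G'G; apply: XG.
move=> i x; rewrite ltnS leq_eqVlt => /orP[/eqP->|hi /G'G]; last exact: sG.
by rewrite inE => /andP[xG /fY/andP[]].
Qed.

End Chain.

Lemma flatten_uniq (I : finType) (A : eqType) (l : I -> seq A) :
  (forall i, uniq (l i)) -> (forall i j x, x \in l i -> x \in l j -> i = j) ->
  uniq (flatten [seq l i | i <- enum I]).
Proof.
move=> ul dl; elim: (enum I) (enum_uniq I) => //= i s IH /andP[nis us].
rewrite cat_uniq ul IH // andbT; apply/hasPn => x /flattenP[t /mapP[j js ->] xj].
by apply/negP => xi; move: nis; rewrite (dl _ _ _ xi xj) js.
Qed.

Lemma exists_floor (R : realType) (x : R) : 0 <= x -> exists j : nat, j%:R <= x /\ x < j%:R + 1.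
Proof.
by move=> x0; exists (Num.truncn x); have /andP[] := truncn_itv x0; rewrite -natr1.
Qed.

(** The left side is linear in [m] and the quadratic term of the exponential beats it. In its use
    [4 * m + 1] counts the sets to be split evenly and [K] the colours. *)
Lemma quadratic_lt_expR (R : realType) (d : R) (K : nat) : 0 < d ->
  exists n0 : nat, forall m, (n0 <= m)%N -> (2 * ((4 * m + 1) * K))%:R < expR (d ^+ 2 / 8 * m%:R).
Proof.
move=> d0; pose a := d ^+ 2 / 8; have a0 : 0 < a by rewrite /a divr_gt0 ?exprn_gt0.
have a2 : 0 < a ^+ 2 by rewrite exprn_gt0.
have x0 : 0 <= 20 * K%:R / a ^+ 2 by apply: divr_ge0; [apply: mulr_ge0|apply: ltW].
have [j [_ hj]] := exists_floor x0.
exists j.+1 => m hm; have am : 0 <= a * m%:R by rewrite mulr_ge0 // ltW.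
apply: lt_le_trans (@expR_ge1Dxn R _ 1 am).
rewrite exprMn.
have m1 : 1 <= m%:R :> R by rewrite ler1n; apply: leq_trans hm.
have mj : 20 * K%:R / a ^+ 2 <= m%:R.
  by apply: ltW; apply: lt_le_trans hj _; rewrite natr1 ler_nat.
rewrite ler_pdivrMr // in mj.
have : 20 * K%:R * m%:R <= m%:R * a ^+ 2 * m%:R by apply: ler_wpM2r => //; lra.
have : K%:R * 1 <= K%:R * m%:R :> R by apply: ler_wpM2l.
rewrite !natrM natrD natrM /factorial /= !expr2; lra.
Qed.

Section MainPaths.
Variables (R : realType) (V : finType) (e H : rel V) (W : {set V}) (k : nat).
Variables (phi : V -> option ('I_k.+1 * k.-tuple bool)) (eps kappa n r c : R) (w : k.-tuple bool).
Hypotheses (eps0 : 0 < eps) (kappa0 : 0 < kappa) (n0 : 0 < n).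
Hypotheses (rn : eps / 4 * n <= r) (kc : kappa <= c) (kn : k.+1%:R <= kappa / 4 * n).
Let d := kappa * eps / (64 * k.+1%:R).
Hypothesis eps8 : eps <= 1 / 8.
Hypothesis He : forall x y, H x y -> [/\ e x y, x \in W & y \in W].

Definition part a := [set v in W | phi v == a].

Hypothesis size_part : forall i, `| #|part (Some (i, w))|%:R - c * n | <= d * n.
Hypothesis deg_part : forall s x i, x \in W ->
  `| #|nb H s x :&: part (Some (i, w))|%:R - c * r | <= d * n.

(** The hypothesis [deg_part] will come from an [H] regular on [W]: all degrees between consecutive
    parts are close to [c * r] in both directions, which makes Hall's deficiency small. The losses
    along the chain are paid by the excess [kappa * n]. *)
Lemma part_paths (N : nat) : N%:R + kappa * n <= c * n ->
  exists (G : {set V}) (g : nat -> V -> V), [/\ (N <= #|G|)%N,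
    (forall i, (i <= k)%N -> {in G &, injective (g i)}),
    (forall (i : 'I_k.+1) x, x \in G -> g i x \in part (Some (i, w))) &
    (forall i x, (i < k)%N -> x \in G -> step e (nth true w i) (g i x) (g i.+1 x))].
Proof.
move=> Nc; have k0 := kappa0; have kc' := kc; have kn' := kn; have n0' := n0; have e0 := eps0.
have T0 : 1 <= k.+1%:R :> R by rewrite ler1n.
have T00 : 0 < k.+1%:R :> R by rewrite ltr0n.
have dE : d * (64 * k.+1%:R) = kappa * eps.
  by rewrite /d divfK // gt_eqF // mulr_gt0.
have d0 : 0 < d by rewrite /d divr_gt0 ?mulr_gt0.
have dk : 64 * d <= kappa * eps.
  by rewrite -dE mulrC ler_pM2l // -[X in X <= _]mulr1 ler_pM2l.
have ke8 : kappa * eps <= kappa * (1/8) by rewrite ler_pM2l.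
(* The defect allowed per matching, so that all of them cost about a quarter of [kappa * n]. The
   choice of [d] gives [x * eps = 16 * (d * n)], which is what the condition of [near_matching]
   amounts to. *)
pose x := kappa * n / (4 * k.+1%:R).
have x0 : 0 <= x by rewrite /x divr_ge0 ?mulr_ge0 // ltW.
have xE : x * (4 * k.+1%:R) = kappa * n.
  by rewrite /x divfK // gt_eqF // mulr_gt0.
have [D0 [D1 D2]] := exists_floor x0.
pose D := D0.+1.
have DE : D%:R = D0%:R + 1 :> R by rewrite natr1.
have c0 : 0 < c by apply: lt_le_trans kc.
have cn0 : 0 < c * n by rewrite mulr_gt0.
have xd : x * eps = 16 * (d * n).
  apply: (@mulIf _ (4 * k.+1%:R)); first by rewrite gt_eqF // mulr_gt0.
  have : x * (4 * k.+1%:R) * eps = kappa * n * eps by rewrite xE.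
  have : d * (64 * k.+1%:R) * n = kappa * eps * n by rewrite dE.
  lra.
have dcn : d * n <= c * n by rewrite ler_pM2r //; lra.
have dcr : d * n <= c * r.
  apply: le_trans (_ : c * (eps / 4 * n) <= _); last by rewrite ler_pM2l.
  have : kappa * eps * n <= c * eps * n by rewrite !ler_pM2r.
  have : 64 * d * n <= kappa * eps * n by rewrite ler_pM2r.
  have : 0 < d * n by rewrite mulr_gt0.
  lra.
have hmatch i : exists (Zf : {set V} * (V -> V)), (i < k)%N ->
   [/\ Zf.1 \subset part (Some (inord i, w)), (#|part (Some (inord i, w)) :\: Zf.1| <= D)%N,
    {in Zf.1 &, injective Zf.2} &
    {in Zf.1, forall x, (Zf.2 x \in part (Some (inord i.+1, w))) && step H (nth true w i) x (Zf.2 x)}].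
  have [hi|hi] := ltnP i k; last by exists (set0, id).
  have [|||||Z [f [f1 f2 f3 f4]]] := @near_matching R V H (part (Some (inord i, w)))
    (part (Some (inord i.+1, w))) (nth true w i) (c * r - d * n) (c * r + d * n) D.
  - move=> y; rewrite inE => /andP[yW _]; have := deg_part (nth true w i) (inord i.+1) yW.
    by rewrite ler_norml => /andP[]; lra.
  - move=> y; rewrite inE => /andP[yW _]; have := deg_part (~~ nth true w i) (inord i) yW.
    by rewrite ler_norml => /andP[]; lra.
  - by lra.
  - by have : 0 < d * n; [rewrite mulr_gt0 | lra].
  - have := size_part (inord i); rewrite ler_norml => /andP[_ h1].
    have h2 : #|part (Some (inord i, w))|%:R <= 2 * (c * n) by lra.
    apply: le_lt_trans (_ : 2 * (c * n) * (2 * (d * n)) < _).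
      have -> : c * r + d * n - (c * r - d * n) = 2 * (d * n) by lra.
      by apply: ler_wpM2r => //; have : 0 < d * n; [rewrite mulr_gt0 | lra].
    have h3 : c * (eps / 4 * n) <= c * r by rewrite ler_pM2l.
    have h4 : x * (c * (eps / 4 * n)) < D%:R * (c * (eps / 4 * n)).
      by rewrite ltr_pM2r ?DE // mulr_gt0 // mulr_gt0 // divr_gt0.
    have h5 : D%:R * (c * (eps / 4 * n)) <= D%:R * (c * r + d * n).
      by apply: ler_wpM2l => //; have : 0 < d * n; [rewrite mulr_gt0 | lra].
    apply: le_lt_trans (lt_le_trans h4 h5).
    have : x * eps * (c * n) = 16 * (d * n) * (c * n) by rewrite xd.
    lra.
  by exists (Z, f).
have [Zf hZ] := boolp.choice hmatch.
have [G [cG iG XG sG]] := @chain_paths V H (fun i => (Zf i).2) (fun i => part (Some (inord i, w)))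
  (fun i => (Zf i).1) D k w hZ.
exists G, (follow (fun i => (Zf i).2)); split=> //.
- have := size_part (inord 0); rewrite ler_norml => /andP[h1 _].
  rewrite -(ler_nat R); rewrite -(ler_nat R) natrD natrM in cG.
  have h2 : k%:R * D%:R <= k.+1%:R * (x + 1) :> R.
    apply: ler_pM => //; first by rewrite ler_nat.
    by rewrite DE; lra.
  have h3 : 64 * (d * n) <= kappa * n / 8.
    have : (64 * d) * n <= (kappa * (1/8)) * n by rewrite ler_pM2r //; lra.
    by lra.
  by lra.
- by move=> i y yG; have := XG i y (ltn_ord i) yG; rewrite inord_val.
move=> i y hi yG; have := sG i y hi yG; rewrite /step.
by case: (nth true w i) => /He[].
Qed.

End MainPaths.

Lemma card_le_injection (I A : finType) (a0 : A) (X : {set I}) (Y : {set A}) :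
  (#|X| <= #|Y|)%N -> exists f : I -> A,
    {in X, forall i, f i \in Y} /\ {in X &, injective f}.
Proof.
move=> XY; exists (fun i => nth a0 (enum Y) (index i (enum X))).
have lt i : i \in X -> (index i (enum X) < size (enum Y))%N.
  by move=> iX; rewrite -cardE; apply: leq_trans XY; rewrite cardE index_mem mem_enum.
split=> [i /lt ?|i j iX jX /eqP]; first by rewrite -mem_enum mem_nth.
rewrite nth_uniq ?enum_uniq ?lt // => /eqP E.
by rewrite -(@nth_index _ i i (enum X)) ?mem_enum // E nth_index ?mem_enum.
Qed.

Lemma big_option (R : realType) (A : finType) (F : option A -> R) :
  \sum_a F a = F None + \sum_a F (Some a).
Proof.
rewrite (bigD1 None) //=; congr (_ + _).
rewrite (reindex_omap Some id) /=; last by case.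
by apply: eq_bigl => a; rewrite eqxx.
Qed.

(* A random partition of [W] provides [k + 1] parts for every word and the set
   [Res]. Inside a regular subgraph, consecutive parts are joined by matchings
   that miss few vertices, and following them gives the paths with that word. *)
Lemma main_paths (R : realType) (eps rho : R) (k : nat) :
  0 < eps -> eps <= 1/8 -> 0 < rho -> rho <= 1 ->
  exists n0 : nat, forall (V : finType) (e : rel V) (W : {set V}) (J : finType)
    (w : J -> k.-tuple bool),
  oriented e -> semideg e (3/8 + eps) W -> (n0 <= #|W|)%N -> (#|V| <= 2 * #|W|)%N ->
  k.+1%:R * #|J|%:R <= (1 - rho) * #|W|%:R :> R ->
  exists (Res : {set V}) (x : J -> V) (p : J -> seq V),
    [/\ Res \subset W, rho / 2 * #|W|%:R <= #|Res|%:R & semideg e (3/8 + eps / 2) Res] /\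
    [/\ forall j, wpath e (w j) (x j) (p j),
        uniq (flatten [seq x j :: p j | j <- enum J]) &
        forall j, all (mem (W :\: Res)) (x j :: p j)].
Proof.
move=> eps0 eps8 rho0 rho1.
pose Q := (k.+1 * 2 ^ k)%N.
have Q0 : 0 < Q%:R :> R by rewrite ltr0n muln_gt0 expn_gt0.
(* The [Q] parts receive a total excess [kappa * Q = rho / 4], leaving at least [3/4 * rho] for the
   reserve. *)
pose kappa := rho / (4 * Q%:R).
have kappa0 : 0 < kappa by rewrite divr_gt0 // mulr_gt0.
have kQ : kappa * Q%:R = rho / 4.
  by rewrite /kappa; field; rewrite gt_eqF.
have T0 : 0 < k.+1%:R :> R by rewrite ltr0n.
have T1 : 1 <= k.+1%:R :> R by rewrite ler1n.
pose d := kappa * eps / (64 * k.+1%:R).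
have d0 : 0 < d by apply: divr_gt0; apply: mulr_gt0.
have Q1 : 1 <= Q%:R :> R by rewrite ler1n muln_gt0 expn_gt0.
have kr : kappa <= rho / 4 by rewrite -kQ -[X in X <= _]mulr1 ler_pM2l.
have dE : d * (64 * k.+1%:R) = kappa * eps.
  by rewrite /d divfK // gt_eqF // mulr_gt0.
have dk : 64 * d <= kappa * eps.
  by rewrite -dE mulrC ler_pM2l // -[X in X <= _]mulr1 ler_pM2l.
have kre : kappa * eps <= rho / 4 * eps by rewrite ler_pM2r.
have re8 : rho * eps <= rho * (1/8) by rewrite ler_pM2l.
have d20 : 0 < d / 2 by rewrite divr_gt0.
have [m0 hm0] := quadratic_lt_expR (Q + 1) d20.
have e0' := ltW eps0; have k0' := ltW kappa0.
have y0 : 0 <= 16 / eps + 4 * k.+1%:R / kappa.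
  by apply: addr_ge0; apply: divr_ge0 => //; apply: mulr_ge0.
have [j0 [_ hj0]] := exists_floor y0.
exists (maxn m0 j0.+1) => V e W J w oe degW; rewrite geq_max => /andP[Wm0 Wj0] VW JW.
have n1 : 16 / eps + 4 * k.+1%:R / kappa <= #|W|%:R.
  by apply: ltW; apply: lt_le_trans hj0 _; rewrite natr1 ler_nat.
have n0 : 0 < #|W|%:R :> R by rewrite ltr0n; apply: leq_trans Wj0.
have e16 : 16 / eps <= #|W|%:R by apply: le_trans n1; rewrite lerDl divr_ge0 // mulr_ge0.
have k4 : 4 * k.+1%:R / kappa <= #|W|%:R by apply: le_trans n1; rewrite lerDr divr_ge0.
rewrite ler_pdivrMr // in e16; rewrite ler_pdivrMr // in k4.
have en2 : 0 <= eps / 2 * #|W|%:R by rewrite mulr_ge0 // divr_ge0.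
have [r [r1 r2]] := exists_floor en2.
have [|H [He Hr]] := regular_subgraph oe eps0 eps8 degW _ r1; first by clear - e16; lra.
pose N tau := #|[set j | w j == tau]|.
(* Room for the [N tau] paths with this word plus the excess; the excess also keeps parts of rare
   words linear in size. *)
pose c tau := (N tau)%:R / #|W|%:R + kappa.
pose p (a : option ('I_k.+1 * k.-tuple bool)) : R :=
  if a is Some (i, tau) then c tau else 1 - \sum_(x : 'I_k.+1 * k.-tuple bool) c x.2.
have sumN : (\sum_tau N tau = #|J|)%N.
  rewrite -sum1_card (partition_big w predT) //=; apply: eq_bigr => tau _.
  by rewrite /N -sum1_card; apply: eq_bigl => j; rewrite inE.
have sumc : \sum_(x : 'I_k.+1 * k.-tuple bool) c x.2 = k.+1%:R * #|J|%:R / #|W|%:R + rho / 4.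
  rewrite -(pair_bigA _ (fun _ tau => c tau)) /= sumr_const card_ord -[_ *+ _]mulr_natl.
  rewrite /c big_split /= -mulr_suml -natr_sum sumN sumr_const card_tuple card_bool.
  by rewrite -[kappa *+ _]mulr_natl mulrDr mulrA -kQ /Q natrM; clear; lra.
have pN : 3/4 * rho <= p None.
  rewrite /p sumc; have : k.+1%:R * #|J|%:R / #|W|%:R <= 1 - rho by rewrite ler_pdivrMr.
  by clear; lra.
have c0 tau : kappa <= c tau by rewrite lerDr divr_ge0.
have p0 a : 0 <= p a.
  case: a => [[i tau]|]; last by apply: le_trans pN; clear - rho0; lra.
  exact: le_trans k0' (c0 tau).
have p1 : \sum_a p a = 1.
  rewrite big_option; suff -> : \sum_x p (Some x) = \sum_(x : 'I_k.+1 * k.-tuple bool) c x.2.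
    by rewrite /p subrK.
  by apply: eq_bigr => -[].
(* Three kinds of counts must stay near their means: degrees in [H] for the matchings, degrees of
   [e] into [W] for the reserve, and the sizes of the parts. *)
pose X (g : bool * bool * V + unit) : {set V} :=
  match g with inl (true, s, v) => nb H s v | inl (false, s, v) => nb e s v :&: W | inr _ => W end.
have [||phi hphi] := @random_partition R V _ _ p X (d / 2) p0 p1 d20.
- have : kappa * eps <= 1/4 * (1/8) by clear - kr k0' e0' eps8 rho1; apply: ler_pM; lra.
  by clear - dk d0; lra.
- rewrite card_option card_sum !card_prod card_unit card_bool card_ord card_tuple card_bool.
  have -> : ((2 * 2 * #|V| + 1) * (k.+1 * 2 ^ k).+1 = (4 * #|V| + 1) * (Q + 1))%N by rewrite [(Q + 1)%N]addn1.
  by apply: hm0; apply: leq_trans Wm0 _; apply: max_card.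
have VW2 : d / 2 * #|V|%:R <= d * #|W|%:R.
  have : d * #|V|%:R <= d * (2 * #|W|)%:R by rewrite ler_pM2l // ler_nat.
  by rewrite natrM; clear; lra.
have dev g a : `| #|[set v in X g | phi v == a]|%:R - p a * #|X g|%:R | <= d * #|W|%:R.
  exact: le_trans (hphi g a) VW2.
have rn : eps / 4 * #|W|%:R <= r%:R by clear - r2 e16; lra.
have HW s x : x \in W -> nb H s x \subset W.
  move=> xW; apply/subsetP => y; rewrite inE /step.
  by case: s => /He[].
have partE s x a : x \in W -> nb H s x :&: part W phi a = [set v in nb H s x | phi v == a].
  move=> xW; apply/setP => v; apply/setIP/setIdP => -[vH].
    by case/setIdP.
  by move=> pv; split=> //; apply/setIdP; split=> //; apply: subsetP vH; apply: HW.
have dsize tau i : `| #|part W phi (Some (i, tau))|%:R - c tau * #|W|%:R | <= d * #|W|%:R.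
  exact: (dev (inr tt) (Some (i, tau))).
have ddeg tau s x i : x \in W ->
    `| #|nb H s x :&: part W phi (Some (i, tau))|%:R - c tau * r%:R | <= d * #|W|%:R.
  by move=> xW; rewrite partE // -(Hr s x xW); apply: (dev (inl (true, s, x)) (Some (i, tau))).
have kn : k.+1%:R <= kappa / 4 * #|W|%:R by clear - k4; lra.
have hG tau : exists Gg : {set V} * (nat -> V -> V), [/\ (N tau <= #|Gg.1|)%N,
    (forall i, (i <= k)%N -> {in Gg.1 &, injective (Gg.2 i)}),
    (forall (i : 'I_k.+1) x, x \in Gg.1 -> Gg.2 i x \in part W phi (Some (i, tau))) &
    (forall i x, (i < k)%N -> x \in Gg.1 -> step e (nth true tau i) (Gg.2 i x) (Gg.2 i.+1 x))].
  have [|G [g [h1 h2 h3 h4]]] := part_paths eps0 kappa0 n0 rn (c0 tau) kn eps8 He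
    (dsize tau) (ddeg tau) (N := N tau).
    by rewrite /c mulrDl divfK // gt_eqF.
  by exists (G, g).
have [Gg hGg] := boolp.choice hG.
have /card_gt0P[v0 _] : (0 < #|W|)%N by rewrite -(ltr0n R).
have hx tau : exists x : J -> V, {in [set j | w j == tau], forall j, x j \in (Gg tau).1} /\
    {in [set j | w j == tau] &, injective x}.
  by have [h _ _ _] := hGg tau; exact: (@card_le_injection J V v0 [set j | w j == tau] (Gg tau).1 h).
have [x hxx] := boolp.choice hx.
pose g j i := (Gg (w j)).2 i (x (w j) j).
have xG j : x (w j) j \in (Gg (w j)).1 by have [h _] := hxx (w j); apply: h; rewrite inE.
have gpart j i : (i <= k)%N -> phi (g j i) = Some (inord i, w j) /\ g j i \in W.
  move=> ik; have [_ _ h _] := hGg (w j).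
  have := h (inord i) _ (xG j); rewrite inordK ?ltnS // inE => /andP[gW /eqP gp].
  by split.
have lE j v : v \in g j 0%N :: [seq g j i | i <- iota 1 k] -> exists2 i, (i <= k)%N & v = g j i.
  have -> : g j 0%N :: [seq g j i | i <- iota 1 k] = [seq g j i | i <- iota 0 k.+1] by [].
  by case/mapP => i; rewrite mem_iota /= add0n ltnS => ik ->; exists i.
exists (part W phi None), (fun j => g j 0%N), (fun j => [seq g j i | i <- iota 1 k]).
split; split.
- by apply/subsetP => v; rewrite inE => /andP[].
- have := dev (inr tt) None; rewrite ler_norml => /andP[h _].
  have h2 : 3/4 * rho * #|W|%:R <= p None * #|W|%:R by rewrite ler_pM2r.
  have h3 : d * #|W|%:R <= rho / 4 * #|W|%:R by rewrite ler_pM2r //; clear - dk kre re8 rho0 d0; lra.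
  have h4 : (p None * #|X (inr tt)|%:R - d * #|W|%:R) <= #|part W phi None|%:R.
    have : [set v in X (inr tt) | phi v == None] = part W phi None by [].
    by move=> <-; clear - h; lra.
  by move: h4; rewrite [X (inr tt)]/=; clear - h2 h3; lra.
- move=> v s.
  have -> : nb e s v :&: part W phi None = [set u in X (inl (false, s, v)) | phi u == None].
    by apply/setP => u; rewrite !inE andbA.
  have := dev (inl (false, s, v)) None; have := dev (inr tt) None.
  rewrite [X (inr tt)]/= [X (inl _)]/= -/(part W phi None).
  rewrite !ler_norml => /andP[_ h1] /andP[h2 _].
  have h3 : p None * ((3/8 + eps) * #|W|%:R) <= p None * #|nb e s v :&: W|%:R by apply: ler_wpM2l.
  have h4 : 3/4 * rho * (eps * #|W|%:R) <= p None * (eps * #|W|%:R).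
    by apply: ler_wpM2r => //; rewrite mulr_ge0.
  have h5 : (3/8 + eps / 2) * #|part W phi None|%:R <= (3/8 + eps / 2) * (p None * #|W|%:R + d * #|W|%:R).
    by apply: ler_wpM2l; clear - h1 eps0; lra.
  have h6 : 64 * (d * #|W|%:R) <= rho / 4 * eps * #|W|%:R.
    by rewrite mulrA ler_pM2r // (le_trans dk).
  have h7 : eps / 2 * (d * #|W|%:R) <= 1/16 * (d * #|W|%:R).
    by apply: ler_wpM2r; [rewrite mulr_ge0 // ltW //|clear - eps8; lra].
  have h8 : 0 < d * #|W|%:R by rewrite mulr_gt0.
  by clear - h1 h2 h3 h4 h5 h6 h7 h8 eps0; lra.
- move=> j; have [_ _ _ h] := hGg (w j).
  apply: wpathP => [|i]; first by rewrite size_map size_iota size_tuple.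
  rewrite size_tuple => ik.
  have -> : nth (g j 0%N) (g j 0%N :: [seq g j i | i <- iota 1 k]) i = g j i.
    have -> : g j 0%N :: [seq g j i | i <- iota 1 k] = [seq g j i | i <- iota 0 k.+1] by [].
    by rewrite (nth_map 0%N) ?size_iota ?nth_iota // ltnW.
  by rewrite (nth_map 0%N) ?size_iota // nth_iota // add1n; apply: h.
- apply: flatten_uniq => [j|j j' v /lE[i ik ->] /lE[i' ik' E]].
    have -> : g j 0%N :: [seq g j i | i <- iota 1 k] = [seq g j i | i <- iota 0 k.+1] by [].
    rewrite map_inj_in_uniq ?iota_uniq // => i i'; rewrite !mem_iota /= !add0n !ltnS => ik ik' E.
    have [h1 _] := gpart j i ik; have [h2 _] := gpart j i' ik'.
    by move: h1; rewrite E h2 => -[/(congr1 val)] /=; rewrite !inordK.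
  have [h1 _] := gpart j i ik; have [h2 _] := gpart j' i' ik'.
  move: h1; rewrite E h2 => -[/(congr1 val)] /=; rewrite !inordK // => ii ww.
  subst i'; have [_ h] := hxx (w j); apply: h; rewrite ?inE ?ww //.
  have [_ hi _ _] := hGg (w j); apply: (hi i ik) => //.
    by have := xG j'; rewrite ww.
  by move: E; rewrite /g ww.
move=> j; apply/allP => v /lE[i ik ->]; have [h1 h2] := gpart j i ik.
by rewrite !inE h2 h1 /= .
Qed.

(** * Assembly *)

Section GreedyRich.
Variables (V : finType) (W F : {set V}) (I : finType) (N : I -> nat) (P : I -> pred (seq V)) (h : nat).

(** Each list in turn avoids [F] and all earlier lists; the bound on the total keeps a choice
    available at every entry. *)
Lemma greedy_rich : (forall i, rich W h (N i) (P i)) -> (#|F| + \sum_i N i < h)%N ->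
  exists l : I -> seq V, [/\ forall i, [/\ size (l i) = N i, P i (l i) & all (mem W) (l i)],
    uniq (flatten [seq l i | i <- enum I]) &
    all (fun v => v \notin F) (flatten [seq l i | i <- enum I])].
Proof.
move=> HP hF.
suff Hs s : uniq s -> (#|F| + \sum_(i <- s) N i < h)%N -> exists l : I -> seq V,
    [/\ forall i, i \in s -> [/\ size (l i) = N i, P i (l i) & all (mem W) (l i)],
    uniq (flatten [seq l i | i <- s]) & all (fun v => v \notin F) (flatten [seq l i | i <- s])].
  have [|l [h1 h2 h3]] := Hs (enum I) (enum_uniq I); first by rewrite big_enum.
  by exists l; split=> // i; apply: h1; rewrite mem_enum.
elim: s => [|i s IH] /=; first by exists (fun=> [::]).
rewrite big_cons => /andP[nis us] hs.
have [|l [h1 h2 h3]] := IH us.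
  by apply: leq_ltn_trans hs; rewrite leq_add2l leq_addl.
pose F' := F :|: [set v | v \in flatten [seq l i | i <- s]].
have F'le : (#|F'| <= #|F| + \sum_(i <- s) N i)%N.
  apply: leq_trans (leq_card_setU _ _) _; rewrite leq_add2l cardsE.
  apply: leq_trans (card_size _) _; rewrite size_flatten /shape -map_comp sumnE big_map.
  by rewrite [leqLHS]big_seq [leqRHS]big_seq leq_sum // => j /h1[sj _ _] /=; rewrite sj.
have [|li [sli ali /and3P[Pli uli Fli]]] := rich_ex _ (rich_avoid F' (HP i)).
  by rewrite subn_gt0; apply: leq_ltn_trans hs; rewrite [leqRHS]addnCA [leqLHS]addnC leq_add2l.
exists (fun j => if j == i then li else l j).
have E : [seq (if j == i then li else l j) | j <- s] = [seq l j | j <- s].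
  by apply/eq_in_map => j js; rewrite ifN //; apply: contraNneq nis => <-.
rewrite eqxx E; split.
- move=> j; rewrite inE; case: eqVneq => [-> _|_ /= /h1 //]; by split.
- rewrite cat_uniq uli h2 andbT /=; apply/hasPn => v vs; apply/negP => vi.
  by move/allP: Fli => /(_ v vi); rewrite !inE vs orbT.
- rewrite all_cat h3 andbT; apply: sub_all Fli => v.
  by rewrite !inE negb_or => /andP[].
Qed.

End GreedyRich.

Lemma greedy_selection_fin (R : realType) (E A V I : finType) (a0 : A) (supp : A -> seq V)
    (N : nat) (good : I -> E -> A -> bool) (c : R) :
  0 < c -> c <= 1 -> (0 < #|E|)%N -> (forall a, size (supp a) = N) ->
  (forall i e (F : {set V}), (#|F| <= #|I| * N)%N -> c * #|A|%:R <=
     #|[set a | [&& good i e a, uniq (supp a) & all (fun v => v \notin F) (supp a)]]|%:R) ->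
  exists a : I -> A, [/\ uniq (flatten [seq supp (a i) | i <- enum I]),
    (forall i, exists e, good i e (a i)) &
    forall e, (1 + c / 2) ^+ #|I| <= #|E|%:R * 2 ^+ #|[set i | good i e (a i)]|].
Proof.
move=> c0 c1 E0 sN H.
have [|a [h1 h2 h3]] := @greedy_selection R E A V a0 supp N #|I|
   (fun n e b => if insub n is Some x then good (enum_val (x : 'I_#|I|)) e b else false) c c0 c1 E0 sN.
  by move=> n e F hn hF; rewrite insubT; apply: H.
exists (fun i => a (enum_rank i)); split.
- have -> : [seq supp (a (enum_rank i)) | i <- enum I] = mkseq (fun n => supp (a n)) #|I|; last exact: h1.
  rewrite /mkseq -val_enum_ord -map_comp.
  suff -> : enum 'I_#|I| = [seq enum_rank i | i <- enum I] by rewrite -[RHS]map_comp.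
  have [i0 _|I0] := pickP (@predT I); last first.
    have -> : enum I = [::] by apply: size0nil; rewrite -cardE; apply: eq_card0 => i; have := I0 i.
    by apply: size0nil; rewrite size_enum_ord; apply: eq_card0 => i; have := I0 i.
  apply: (@eq_from_nth _ (enum_rank i0)) => [|n]; first by rewrite size_map size_enum_ord -cardE.
  rewrite size_enum_ord => hn; rewrite (nth_map i0) -?cardE //.
  by rewrite -(enum_val_nth i0 (Ordinal hn)) enum_valK (nth_ord_enum _ (Ordinal hn)).
- move=> i; have [e] := h2 (enum_rank i) (ltn_ord _); rewrite valK enum_rankK; by exists e.
move=> e; have := h3 e.
suff -> : (\sum_(i < #|I|) nat_of_bool
    (if insub (val i) is Some x then good (enum_val (x : 'I_#|I|)) e (a i) else false)
   = #|[set i | good i e (a (enum_rank i))]|)%N by [].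
under eq_bigr do rewrite valK.
rewrite -sum1_card [RHS](reindex (fun i : 'I_#|I| => enum_val i)) /=;
  last by apply: onW_bij; apply: enum_val_bij.
rewrite [RHS]big_mkcond /=; apply: eq_bigr => i _; rewrite inE enum_valK.
by case: (good _ _ _).
Qed.

(** Hall's condition is immediate: the candidates of a single element of [S] already number at least
    [#|L|]. *)
Lemma distinct_representatives (V I : finType) (i0 : I) (L : {set V}) (C : V -> {set I}) :
  (forall v, v \in L -> (#|L| <= #|C v|)%N) ->
  exists f : V -> I, {in L &, injective f} /\ {in L, forall v, f v \in C v}.
Proof.
move=> H; apply: (@hall V I (fun v i => i \in C v) L i0) => S SL.
have [->|/set0Pn[v vS]] := eqVneq S set0; first by rewrite cards0.
apply: leq_trans (subset_leq_card SL) (leq_trans (H v (subsetP SL _ vS)) _).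
apply: subset_leq_card; apply/subsetP => i iv; rewrite inE; apply/exists_inP.
by exists v.
Qed.

Lemma word_split (w : seq bool) (a b : nat -> nat) n :
  (\sum_(i < n) (a i + b i))%N = size w -> exists ws wc : nat -> seq bool,
    (forall i, (i < n)%N -> size (ws i) = a i /\ size (wc i) = b i) /\
    w = flatten (mkseq (fun i => ws i ++ wc i) n).
Proof.
elim: n w => [|n IH] w.
  by rewrite big_ord0 => /esym/size0nil ->; exists (fun=> [::]), (fun=> [::]).
rewrite big_ord_recr [nat_of_ord _]/= => sw.
have [|ws [wc [h1 h2]]] := IH (take (\sum_(i < n) (a i + b i)) w).
  by rewrite size_takel // -sw leq_addr.
pose w' := drop (\sum_(i < n) (a i + b i)) w.
have sw' : size w' = (a n + b n)%N by rewrite size_drop -sw addKn.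
exists (fun i => if i == n then take (a n) w' else ws i), (fun i => if i == n then drop (a n) w' else wc i).
rewrite mkseqS; split.
  move=> i; rewrite ltnS leq_eqVlt; case: eqVneq => [-> _|_ /= hi]; last exact: h1.
  by rewrite size_drop sw' addKn size_takel // sw' leq_addr.
rewrite flatten_rcons eqxx cat_take_drop -[LHS](cat_take_drop (\sum_(i < n) (a i + b i))).
congr (_ ++ _); rewrite h2; congr flatten; apply/eq_in_map => i; rewrite mem_iota /= => hi.
by rewrite ifN ?ifN // neq_ltn hi.
Qed.

Lemma pigeonhole_word (M b : nat) (f : nat -> seq bool) :
  (forall i, (i < M * 2 ^ b)%N -> size (f i) = b) ->
  exists (w : seq bool) (pos : nat -> nat), [/\ size w = b,
    (forall t, (t < M)%N -> (pos t < M * 2 ^ b)%N /\ f (pos t) = w) &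
    (forall t t', (t < M)%N -> (t' < M)%N -> pos t = pos t' -> t = t')].
Proof.
move=> sf; set C := (M * 2 ^ b)%N in sf *.
case: (posnP M) => [M0|M0]; first by exists (nseq b true), id; rewrite M0 size_nseq.
pose S (w : b.-tuple bool) := [set i : 'I_C | f i == w].
have [w Hw] : exists w, (M <= #|S w|)%N.
  case: (pickP (fun w => M <= #|S w|)%N) => [w hw|Hn]; first by exists w.
  have : (\sum_w #|S w| = C)%N.
    rewrite -[RHS]card_ord -sum1_card.
    pose F (i : 'I_C) : b.-tuple bool := insubd [tuple of nseq b true] (f i).
    rewrite (partition_big F predT) //=; apply: eq_bigr => w _.
    rewrite -sum1_card; apply: eq_bigl => i; rewrite inE /F.
    by rewrite -val_eqE /= val_insubd sf // eqxx.
  have : (\sum_w #|S w| <= \sum_(w : b.-tuple bool) M.-1)%N.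
    by apply: leq_sum => w _; rewrite -ltnS prednK // ltnNge Hn.
  rewrite sum_nat_const card_tuple card_bool => h1 h2; exfalso.
  by move: h1; rewrite h2 /C mulnC leq_pmul2l ?expn_gt0 // leqNgt prednK // leqnn.
exists w, (fun t => nth 0%N [seq val i | i <- enum (S w)] t); split; first by rewrite size_tuple.
  move=> t tM; have ht : (t < size (enum (S w)))%N by rewrite -cardE; apply: leq_trans Hw.
  have /mapP[i] : nth 0%N [seq val i | i <- enum (S w)] t \in [seq val i | i <- enum (S w)].
    by rewrite mem_nth // size_map.
  by rewrite mem_enum inE => /eqP fi ->; split=> //; apply: ltn_ord.
move=> t t' ht ht' /eqP; rewrite nth_uniq; first by move/eqP.
- by rewrite size_map -cardE; apply: leq_trans Hw.
- by rewrite size_map -cardE; apply: leq_trans Hw.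
by rewrite map_inj_uniq ?enum_uniq //; apply: val_inj.
Qed.

Section CloseCycle.
Variables (V : finType) (e : rel V) (l : nat) (o : 'I_l -> bool) (n : nat).
Variables (ws wc : nat -> seq bool) (x : nat -> V) (p c : nat -> seq V).

(** The pieces concatenate to a closed walk of [l] letters through [x 0]. Distinctness of its
    vertices is left to the global count in [factor_of_cover]. *)
Lemma close_cycle : (0 < l)%N ->
  [seq o i | i <- enum 'I_l] = flatten (mkseq (fun i => ws i ++ wc i) n) ->
  (forall i, (i < n)%N -> wpath e (ws i) (x i) (p i)) ->
  (forall i, (i < n)%N -> wpath e (wc i) (last (x i) (p i)) (rcons (c i) (x (i.+1 %% n)%N))) ->
  exists f : 'I_l -> V, (forall i, e (f (cyc_edge o i).1) (f (cyc_edge o i).2)) /\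
    forall i v, (i < n)%N -> v \in x i :: p i ++ c i -> exists j, f j = v.
Proof.
move=> l0 ow hp hc.
pose x' i := x (i %% n)%N.
pose L m := flatten (mkseq (fun i => p i ++ rcons (c i) (x' i.+1)) m).
have Lm m : (m <= n)%N -> wpath e (flatten (mkseq (fun i => ws i ++ wc i) m)) (x' 0%N) (L m) /\
    last (x' 0%N) (L m) = x' m.
  elim: m => [|m IH] mn; first by [].
  have [w1 l1] := IH (ltnW mn).
  rewrite /L !mkseqS !flatten_rcons wpath_cat; last by rewrite (size_wpath w1).
  rewrite w1 /= l1 {1}/x' modn_small // wpath_cat; last by rewrite (size_wpath (hp m mn)).
  by rewrite hp // hc // last_cat last_cat last_rcons.
have [wp lp] := Lm n (leqnn n); rewrite -ow in wp.
have sL := size_wpath wp; rewrite size_map size_enum_ord in sL.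
have x'n : x' n = x' 0%N by rewrite /x' modnn mod0n.
have n0 : (0 < n)%N.
  by case: (n) ow => // /(congr1 size); rewrite size_map size_enum_ord /= => E; rewrite E in l0.
exists (fun i => nth (x' 0%N) (x' 0%N :: L n) i).
(* [L n] ends with the starting vertex, so positions [l] and [0] of the list agree and [ordS] may
   wrap around. *)
have fS (i : 'I_l) : nth (x' 0%N) (x' 0%N :: L n) (ordS i) = nth (x' 0%N) (L n) i.
  rewrite /=; have [il|il] := ltnP i.+1 l; first by rewrite modn_small.
  have E : i.+1 = l by apply/eqP; rewrite eqn_leq il ltn_ord.
  rewrite E modnn /=; have := last_nth (x' 0%N) (x' 0%N) (L n); rewrite lp x'n sL.
  by rewrite -(congr1 (nth (x' 0%N) (x' 0%N :: L n)) E).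
split.
  move=> i; have := wpath_step wp; rewrite size_map size_enum_ord => /(_ i (ltn_ord i)).
  rewrite (nth_map i) ?size_enum_ord // nth_ord_enum /step /cyc_edge.
  by case: (o i); rewrite /= -?fS.
have cov v : v \in L n -> exists j : 'I_l, nth (x' 0%N) (x' 0%N :: L n) j = v.
  move=> vL; have hi : (index v (L n) < l)%N by rewrite -sL index_mem.
  by exists (ordS (Ordinal hi)); rewrite fS /= nth_index.
have covi i v : (i < n)%N -> v \in p i ++ rcons (c i) (x' i.+1) -> v \in L n.
  move=> hi vi; apply/flattenP; exists (p i ++ rcons (c i) (x' i.+1)) => //.
  by apply/mapP; exists i; rewrite ?mem_iota.
move=> i v hi; rewrite inE mem_cat => /or3P[/eqP->|vp|vc].
- have -> : x i = x' i by rewrite /x' modn_small.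
  apply: cov; have [i0|i0] := posnP i.
    rewrite i0 -x'n; apply: (covi n.-1); first by rewrite prednK.
    by rewrite mem_cat mem_rcons inE prednK // eqxx orbT.
  apply: (covi i.-1); first by apply: leq_ltn_trans (leq_pred _) hi.
  by rewrite mem_cat mem_rcons inE prednK // eqxx orbT.
- by apply: cov; apply: (covi i); rewrite // mem_cat vp.
by apply: cov; apply: (covi i); rewrite // mem_cat mem_rcons inE vc !orbT.
Qed.

End CloseCycle.

(* Injectivity comes for free by counting. *)
Lemma factor_of_cover (V : finType) (e : rel V) (l m : nat) (o : 'I_l -> bool) (F : 'I_m -> 'I_l -> V) :
  #|V| = (l * m)%N -> (forall j i, e (F j (cyc_edge o i).1) (F j (cyc_edge o i).2)) ->
  (forall v, exists j i, F j i = v) -> has_cycle_factor e o.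
Proof.
move=> cV hF cov.
have inj : injective (fun ji : 'I_m * 'I_l => F ji.1 ji.2).
  apply/injectiveP/card_uniqP; rewrite size_map -cardE card_prod !card_ord mulnC -cV.
  apply: eq_card => v; rewrite inE; apply/idP.
  by have [j [i <-]] := cov v; apply/codomP; exists (j, i).
exists m, F; split; last split=> //.
  by move=> j; split=> // i i' E; have [] := inj (j, i) (j, i') E.
by move=> j j' i i' E; have [] := inj (j, i) (j', i') E.
Qed.

(** * Absorbers, holes and connectors of all cycles *)

Definition fillers (V : finType) (e : rel V) (w : seq bool) (a b : V) : {set V} :=
  [set x | wpath e w a [:: x; b]].

Section Skeleton.
Variables (R : realType) (V : finType) (e : rel V) (eps : R) (k q : nat) (x0 : V).
Hypotheses (oe : oriented e) (eps0 : 0 < eps) (eps8 : eps <= 1/8).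
Hypothesis degV : semideg e (3/8 + eps) setT.
Hypotheses (k0 : (0 < k)%N) (hk : 2 + 2 / eps <= (2 * k).-1%:R) (hq : 2 + 2 / eps <= q%:R).
(** A lower bound for the densities of both kinds of target: [1/32] for the fillers of a hole,
    [8 ^- abs_rows k] for a common neighbourhood. *)
Let c : R := (32 * 8 ^ abs_rows k)%:R^-1.
Variable h : nat.
Hypotheses (h1 : h%:R <= c * eps * #|V|%:R) (h2 : c * eps * #|V|%:R <= 2 * h%:R).

Let c0 : 0 < c.
Proof. by rewrite invr_gt0 ltr0n muln_gt0 expn_gt0. Qed.

Let c32 : c <= 1/32.
Proof.
rewrite /c natrM invfM -[X in _ <= X]mulr1 div1r ler_pM2l ?invr_gt0 //.
by rewrite invf_le1 ?ltr0n ?ler1n expn_gt0.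
Qed.

Let h8 : h%:R <= eps / 8 * #|V|%:R.
Proof.
apply: le_trans h1 _; apply: ler_wpM2r => //.
have := ler_wpM2r (ltW eps0) c32; have := eps0; lra.
Qed.

Let h4 : (4 * h <= #|V|)%N.
Proof.
rewrite -(ler_nat R) natrM; have := h8.
have : eps * #|V|%:R <= 1/8 * #|V|%:R by apply: ler_wpM2r.
have : 0 <= #|V|%:R :> R by []. lra.
Qed.

(** The first neighbour is arbitrary. Its neighbourhood has at least [3/8 * #|V|] vertices, and by
    [codegree_card] a quarter of all vertices see an eighth of it, more than [#|V| / 32]. *)
Lemma hole_rich w : size w = 2%N ->
  rich setT h 2 (fun l => (size l == 2%N) && (#|V| <= 32 * #|fillers e w (head x0 l) (last x0 l)|)%N).
Proof.
case: w => [|s [|s' []]] //= _.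
rewrite (_ : [set v in _ | _] = setT); last first.
  apply/setP => p; rewrite !inE.
  pose T := nb e s p.
  have H := codegree_card eps0 degV s' T.
  suff : (h <= #|[set b | #|T| <= 8 * #|T :&: nb e (~~ s') b|]|)%N.
    move/leq_trans; apply; apply: subset_leq_card; apply/subsetP => b.
    rewrite !inE => Hb.
    have T3 : (32 * #|fillers e [:: s; s'] p b| >= 4 * #|T|)%N.
      rewrite -[32%N]/(4 * 8)%N -mulnA leq_pmul2l //; apply: leq_trans Hb _.
      rewrite leq_mul2l /=; apply: subset_leq_card; apply/subsetP => x.
      by rewrite !inE stepN /= andbT.
    apply: leq_trans T3; rewrite -(ler_nat R) natrM.
    have := degV p s; rewrite setIT cardsT -/T.
    have : 0 <= eps * #|V|%:R by rewrite mulr_ge0 // ltW.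
    have : 0 <= #|V|%:R :> R by [].
    lra.
  by have := leq_trans h4 H; rewrite leq_pmul2l.
by rewrite cardsT; apply: leq_trans h4; rewrite leq_pmull.
Qed.

Let N := abs_size k q.
Let c' := (c * eps / 4) ^+ N.

Lemma select_absorbers (I : finType) (sigma : I -> seq bool) :
  (forall i, size (sigma i) = q.+3) -> (2 * (#|I| * N + N) <= h)%N ->
  exists A : I -> seq V, [/\ forall i, size (A i) = N,
    uniq (flatten [seq A i | i <- enum I]),
    forall i, exists u U, absorbs e x0 k q (sigma i) u U (A i) &
    forall u w a b, size w = 2%N -> (#|V| <= 32 * #|fillers e w a b|)%N ->
      (1 + c' / 2) ^+ #|I| <= (4 * #|V| ^ 3)%:R *
        2 ^+ #|[set i | absorbs e x0 k q (sigma i) u (fillers e w a b) (A i)]|].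
Proof.
move=> ssig hN.
pose E := ((V * V * V) * 2.-tuple bool)%type.
(* A condition whose hole has few fillers is relaxed to [setT], so that absorbers are dense for
   every element of [E]; the final bound is claimed for holes with many fillers. *)
pose U (x : E) : {set V} := let F := fillers e x.2 x.1.1.2 x.1.2 in
  if (#|V| <= 32 * #|F|)%N then F else setT.
have U32 x : (#|V| <= 32 * #|U x|)%N.
  by rewrite /U; case: ifP => // _; rewrite cardsT leq_pmull.
have ce : c * eps <= 1.
  have : c * eps <= 1/32 * (1/8) by apply: ler_pM => //; exact: ltW.
  lra.
have ce0 : 0 < c * eps by rewrite mulr_gt0.
have ce4 : 0 < c * eps / 4 by rewrite divr_gt0.
have c'0 : 0 < c' by rewrite exprn_gt0.
have c'1 : c' <= 1 by rewrite exprn_ile1 //; [exact: ltW|lra].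
have [||A [A1 A2 A3]] := @greedy_selection_fin R E (N.-tuple V) V I (nseq_tuple N x0) (@tval N V) N
  (fun i x A => absorbs e x0 k q (sigma i) x.1.1.1 (U x) A) c' c'0 c'1 _ (@size_tuple N V).
- by apply/card_gt0P; exists (x0, x0, x0, [tuple true; true]).
- move=> i x F hF.
  have cU : c * #|V|%:R <= #|U x|%:R.
    have := U32 x; rewrite -(ler_nat R) natrM => H.
    have := ler_wpM2r (ler0n R #|V|) c32; lra.
  have [s1 [s2 [sg [s3 [Es sq]]]]] : exists s1 s2 sg s3, sigma i = s1 :: s2 :: rcons sg s3 /\ size sg = q.
    have := ssig i; case: (sigma i) => [|s1 [|s2 s]] //= [].
    by case/lastP: s => // sg s3; rewrite size_rcons => -[sq]; exists s1, s2, sg, s3.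
  have c8 : c <= (8 ^ abs_rows k)%:R^-1.
    rewrite lef_pV2 ?posrE ?ltr0n ?muln_gt0 ?expn_gt0 // ler_nat.
    by rewrite leq_pmull.
  have := absorber_rich x0 oe eps0 eps8 degV s1 s2 s3 x.1.1.1 k0 hk hq sq c0 c8 cU h4 h8 h1.
  rewrite -Es => /(rich_avoid F)/rich_card; rewrite -/N => H.
  apply: le_trans (_ : ((h - (#|F| + N)) ^ N)%:R <= _); last by rewrite ler_nat.
  rewrite card_tuple !natrX -exprMn.
  (* Forbidden vertices cost at most half of [h], and [h] is at least half of [c * eps * #|V|];
     hence the factor 4 in [c']. *)
  suff : c * eps / 4 * #|V|%:R <= (h - (#|F| + N))%:R.
    by apply: lerXn2r; rewrite nnegrE // mulr_ge0 // ltW.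
  have FN : (2 * (#|F| + N) <= h)%N.
    by apply: leq_trans hN; rewrite leq_mul2l /= leq_add2r.
  have FN' : (#|F| + N <= h)%N by apply: leq_trans FN; rewrite leq_pmull.
  rewrite natrB //; rewrite -(ler_nat R) natrM in FN.
  have := h2; lra.
exists (fun i => tval (A i)); split=> //.
- by move=> i; rewrite size_tuple.
- by move=> i; have [x Hx] := A2 i; exists x.1.1.1, (U x).
move=> u w a b sw HU; have w2 : size w == 2%N by rewrite sw.
have := A3 (u, a, b, Tuple w2); rewrite /U /= HU.
rewrite !card_prod card_tuple card_bool mulnC.
by rewrite (_ : (#|V| * #|V| * #|V|)%N = #|V| ^ 3)%N // !expnS expn0 muln1 mulnA.
Qed.

End Skeleton.

Definition allv (I : finType) (A : eqType) (l : I -> seq A) : seq A := flatten [seq l i | i <- enum I].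

Lemma size_allv (I : finType) (A : eqType) (l : I -> seq A) : size (allv l) = (\sum_i size (l i))%N.
Proof.
rewrite size_flatten /shape -map_comp sumnE big_map big_enum /=.
by apply: eq_bigr.
Qed.

Lemma allvP (I : finType) (A : eqType) (l : I -> seq A) v : v \in allv l -> exists i, v \in l i.
Proof. by case/flattenP => s /mapP[i _ ->]; exists i. Qed.

(* The word of each cycle is cut into items, each followed by a connector: first
   [u] windows carrying a row of an absorber (row [t] of absorber [ch] if
   [role i = Some (ch, t)]) or an arbitrary path (if [role i = None]), then [cH]
   holes, stored as the two neighbours of a vertex still to be chosen, then a
   single vertex at [n1 = u + cH], and finally the paths of [main_paths]. *)
Definition anchor (V : finType) (k q : nat) (x0 : V) (uA n : nat) (role : nat -> option ('I_uA * nat))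
  (A : 'I_uA -> seq V) (B : 'I_n.+1 -> seq V) (i : nat) : seq V :=
  if role i is Some (ch, t) then abs_a x0 k (A ch) t :: row_before x0 k q (A ch) t else B (inord i).

Section Skeleton2.
Variables (R : realType) (V : finType) (e : rel V) (eps : R) (k q : nat) (x0 : V).
Hypotheses (oe : oriented e) (eps0 : 0 < eps) (eps8 : eps <= 1/8).
Hypothesis degV : semideg e (3/8 + eps) setT.
Hypotheses (k0 : (0 < k)%N) (hk : 2 + 2 / eps <= (2 * k).-1%:R) (hq : 2 + 2 / eps <= q%:R).
Variable h : nat.
Let c : R := (32 * 8 ^ abs_rows k)%:R^-1.
Hypotheses (h1 : h%:R <= c * eps * #|V|%:R) (h2 : c * eps * #|V|%:R <= 2 * h%:R).
Let N := abs_size k q.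
Let c' := (c * eps / 4) ^+ N.

Variables (m uA u n1 g : nat) (ws wc : nat -> seq bool) (sigma : 'I_uA -> seq bool).
Variable role : nat -> option ('I_uA * nat).
Hypothesis hg : 2 + 2 / eps <= g%:R.
Hypothesis un : (u <= n1)%N.
Hypothesis sws1 : forall i, (i < u)%N -> size (ws i) = q.+3.
Hypothesis sws2 : forall i, (u <= i < n1)%N -> size (ws i) = 2%N.
Hypothesis swc : forall i, (i < n1)%N -> size (wc i) = g.+1.
Hypothesis ssig : forall ch, size (sigma ch) = q.+3.
Hypothesis Hrole : forall i ch t, role i = Some (ch, t) ->
  [/\ (i < u)%N, (t < abs_rows k)%N & ws i = sigma ch].
Hypothesis hh : (2 * (m * uA * N + m * n1.+1 * (q.+4 + g) + N) < h)%N.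

(** The absorbers come first, by weights; then windows without a role, holes and single vertices;
    then connectors, each batch greedily outside the earlier ones. Connectors stop at item [n1]: the
    rest of each cycle is found later among the remaining vertices. *)
Lemma skeleton : exists (A : 'I_m * 'I_uA -> seq V) (B C : 'I_m * 'I_n1.+1 -> seq V),
  let anc j := anchor k q x0 role (fun ch => A (j, ch)) (fun i => B (j, i)) in
  [/\ (forall ji, size (A ji) = N),
   (forall ji, exists u U, absorbs e x0 k q (sigma ji.2) u U (A ji)) &
   (forall u w a b, size w = 2%N -> (#|V| <= 32 * #|fillers e w a b|)%N ->
      (1 + c' / 2) ^+ (m * uA) <= (4 * #|V| ^ 3)%:R *
        2 ^+ #|[set ji | absorbs e x0 k q (sigma ji.2) u (fillers e w a b) (A ji)]|)] /\
  [/\ (forall j i, (i < u)%N -> role i = None -> size (B (j, inord i)) = q.+4 /\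
          wpath e (ws i) (head x0 (B (j, inord i))) (behead (B (j, inord i)))),
   (forall j i, (u <= i < n1)%N -> size (B (j, inord i)) = 2%N /\
      (#|V| <= 32 * #|fillers e (ws i) (head x0 (B (j, inord i))) (last x0 (B (j, inord i)))|)%N),
   (forall j, size (B (j, inord n1)) = 1%N) /\ (forall j, C (j, inord n1) = [::]) /\
     (forall j i, (i < u)%N -> role i <> None -> B (j, inord i) = [::]),
   (forall j i, (i < n1)%N -> size (C (j, inord i)) = g /\
      wpath e (wc i) (last x0 (anc j i)) (rcons (C (j, inord i)) (head x0 (anc j i.+1)))) &
   uniq (allv A ++ allv B ++ allv C)] /\
   (size (allv A ++ allv B ++ allv C) <= m * uA * N + m * n1.+1 * (q.+4 + g))%N.
Proof.
have cardI : #|{: 'I_m * 'I_uA}| = (m * uA)%N by rewrite card_prod !card_ord.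
have [||A [A1 A2 A3 A4]] := @select_absorbers R V e eps k q x0 oe eps0 eps8 degV k0 hk hq h h1 h2
   ('I_m * 'I_uA)%type (fun ji => sigma ji.2).
- by move=> i; apply: ssig.
- by rewrite cardI; apply: leq_trans (ltnW hh); rewrite leq_mul2l /= leq_add2r leq_addr.
have h8 : h%:R <= eps / 8 * #|[set: V]|%:R.
  rewrite cardsT; apply: le_trans h1 _; apply: ler_wpM2r => //.
  have : c <= 1/8.
    rewrite div1r lef_pV2 ?posrE ?ltr0n ?muln_gt0 ?expn_gt0 // ler_nat.
    by apply: leq_trans (leq_pmulr _ _); rewrite ?expn_gt0.
  by move=> c8; have := ler_wpM2r (ltW eps0) c8; lra.
have walkT w v : 2 + 2 / eps <= (size w)%:R ->
    rich setT h (size w) (fun l => wpath e w v l).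
  move=> sw; have TT : [set: V] \subset [set: V] by [].
  have hc : h%:R <= eps * (1/8) * #|[set: V]|%:R by move: h8; lra.
  have := walk_rich oe eps0 eps8 degV (c := 1) ltr01 h8 _ TT _ v sw.
  rewrite !mul1r => /(_ _ (lexx _)) H; apply: rich_sub (H _) => //.
    by move=> l _ _ /andP[].
  apply: le_trans h8 _; apply: ler_wpM2r => //; have := eps0; lra.
pose NB (x : 'I_m * 'I_n1.+1) : nat := if (x.2 < u)%N then (if role x.2 is Some _ then 0%N else q.+4)
   else if (x.2 < n1)%N then 2%N else 1%N.
pose PB (x : 'I_m * 'I_n1.+1) (l : seq V) : bool :=
   if (x.2 < u)%N then (if role x.2 is Some _ then true else wpath e (ws x.2) (head x0 l) (behead l))
   else if (x.2 < n1)%N then (size l == 2%N) && (#|V| <= 32 * #|fillers e (ws x.2) (head x0 l) (last x0 l)|)%N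
   else true.
have NBq x : (NB x <= q.+4)%N.
  by rewrite /NB; case: ifP => _; [case: (role _)|case: ifP].
have h0 : (0 < h)%N by apply: leq_ltn_trans hh.
have hV : (h <= #|[set: V]|)%N.
  rewrite -(ler_nat R); apply: le_trans h8 _.
  rewrite -[X in _ <= X]mul1r; apply: ler_wpM2r => //; have := eps8; lra.
have sumc (f : 'I_m * 'I_n1.+1 -> nat) b : (forall x, f x <= b)%N -> (\sum_x f x <= m * n1.+1 * b)%N.
  move=> Hf.
  have -> : (m * n1.+1 * b = \sum_(x : 'I_m * 'I_n1.+1) b)%N by rewrite sum_nat_const card_prod !card_ord.
  by apply: leq_sum => x _; apply: Hf.
pose FA := [set v | v \in allv A].
have sA : size (allv A) = (m * uA * N)%N.
  by rewrite size_allv (eq_bigr (fun=> N)) ?sum_nat_const ?cardI.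
have cFA : (#|FA| <= m * uA * N)%N by rewrite cardsE -sA card_size.
have mq : (m * n1.+1 * (q.+4 + g) = m * n1.+1 * q.+4 + m * n1.+1 * g)%N by rewrite mulnDr.
have hh' : (m * uA * N + (m * n1.+1 * q.+4 + m * n1.+1 * g) < h)%N.
  rewrite -mq; apply: leq_ltn_trans hh; rewrite mul2n -addnn.
  exact: leq_trans (leq_addr N _) (leq_addr _ _).
have [||B [B1 B2 B3]] := @greedy_rich V setT FA _ NB PB h.
- move=> x; rewrite /NB /PB; case: ifP => xu.
    case Er: (role x.2) => [a|] //.
    have sw : 2 + 2 / eps <= (size (ws x.2))%:R.
      by rewrite sws1 //; apply: le_trans hq _; rewrite ler_nat -addn3 leq_addr.
    change (h <= #|[set v in [set: V] | rich setT h q.+3 (fun l => wpath e (ws x.2) v l)]|)%N.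
    apply: leq_trans hV _; apply: subset_leq_card; apply/subsetP => v _.
    by rewrite !inE -(sws1 xu); apply: walkT.
  case: ifP => xn.
    have sw2 : size (ws x.2) = 2%N by apply: sws2; rewrite xn leqNgt xu.
    exact: (hole_rich x0 eps0 eps8 degV h1 sw2).
  change (h <= #|[set v in [set: V] | true]|)%N; apply: leq_trans hV _.
  by apply: subset_leq_card; apply/subsetP => v; rewrite !inE.
- apply: leq_ltn_trans hh'; apply: leq_add => //; apply: leq_trans (sumc NB q.+4 NBq) _.
  by rewrite leq_addr.
pose FB := [set v | v \in allv A ++ allv B].
have sB : (size (allv B) <= m * n1.+1 * q.+4)%N.
  rewrite size_allv; apply: leq_trans (sumc NB q.+4 NBq).
  by apply: leq_sum => x _; have [-> _ _] := B1 x.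
pose anc j := anchor k q x0 role (fun ch => A (j, ch)) (fun i => B (j, i)).
pose NC (x : 'I_m * 'I_n1.+1) : nat := if (x.2 < n1)%N then g else 0%N.
pose PC (x : 'I_m * 'I_n1.+1) (l : seq V) : bool := (x.2 < n1)%N ==>
  wpath e (wc x.2) (last x0 (anc x.1 x.2)) (rcons l (head x0 (anc x.1 x.2.+1))).
have NCg x : (NC x <= g)%N by rewrite /NC; case: ifP.
have [||C [C1 C2 C3]] := @greedy_rich V setT FB _ NC PC h.
- move=> x; rewrite /NC /PC; case: ifP => xn //=.
  have := swc xn; case/lastP: (wc x.2) => // w s; rewrite size_rcons => -[sw].
  have sw' : 2 + 2 / eps <= (size w)%:R by rewrite sw.
  by have := connect_rich oe eps0 eps8 s (last x0 (anc x.1 x.2))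
    (head x0 (anc x.1 x.2.+1)) degV h8 sw'; rewrite sw.
- apply: leq_ltn_trans hh'; rewrite addnA; apply: leq_add; last exact: sumc.
  rewrite cardsE; apply: leq_trans (card_size _) _.
  by rewrite size_cat sA leq_add2l.
have sC : (size (allv C) <= m * n1.+1 * g)%N.
  rewrite size_allv; apply: leq_trans (sumc NC g NCg).
  by apply: leq_sum => x _; have [-> _ _] := C1 x.
have io i : (i < n1.+1)%N -> nat_of_ord (inord i : 'I_n1.+1) = i by move=> hi; rewrite inordK.
exists A, B, C; split; [split=> //|split; [split|]].
- by move=> v w a b sw HU; rewrite -cardI; apply: A4.
- move=> j i iu ri; have [] := B1 (j, inord i).
  have iN : (i < n1.+1)%N := leqW (leq_trans iu un).
  by rewrite /NB /PB /= io // iu ri.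
- move=> j i /andP[ui iN]; have [sBi] := B1 (j, inord i).
  rewrite /PB /= io; last exact: leqW.
  by rewrite ltnNge ui /= iN => /andP[/eqP -> ->] _; split.
- split; last split.
  + move=> j; have [-> _ _] := B1 (j, inord n1).
    by rewrite /NB /= io // ltnn ltnNge un.
  + move=> j; have [+ _ _] := C1 (j, inord n1).
    by rewrite /NC /= io // ltnn => /size0nil.
  move=> j i iu; have [+ _ _] := B1 (j, inord i).
  rewrite /NB /= io; last exact: (leqW (leq_trans iu un)).
  by rewrite iu; case: (role i) => // a /size0nil.
- move=> j i iN; have [sCi HC _] := C1 (j, inord i).
  move: sCi HC; rewrite /PC /NC /= io; last exact: leqW.
  by rewrite iN; split.
- rewrite !cat_uniq A2 B2 C2 andbT has_cat negb_or /=; apply/andP; split.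
    apply/andP; split; apply/hasPn => v vB.
      by move/allP: B3 => /(_ v vB); rewrite inE.
    by move/allP: C3 => /(_ v vB); rewrite inE mem_cat negb_or => /andP[].
  apply/hasPn => v vC; move/allP: C3 => /(_ v vC).
  by rewrite inE mem_cat negb_or => /andP[].
by rewrite !size_cat sA mq leq_add2l leq_add.
Qed.

End Skeleton2.

(** * Insertion of the left-over vertices and closing of the cycles *)

Section Assemble.
Variables (V : finType) (e : rel V) (k q : nat) (x0 : V).
Let N := abs_size k q.
Let M := abs_rows k.
Variables (l m uA u cH g rem kk um : nat) (o : 'I_l -> bool) (ws wc : nat -> seq bool).
Variables (sigma : 'I_uA -> seq bool) (role : nat -> option ('I_uA * nat)).
Let n1 := (u + cH)%N.
Let n2 := (n1.+1 + um.+1)%N.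
Hypotheses (k0 : (0 < k)%N) (l0 : (0 < l)%N) (m0 : (0 < m)%N) (cH0 : (0 < cH)%N) (uA0 : (0 < uA)%N).
Hypothesis cV : #|V| = (l * m)%N.
Hypothesis ow : [seq o i | i <- enum 'I_l] = flatten (mkseq (fun i => ws i ++ wc i) n2).
Hypothesis suml : (u * (q.+4 + g) + cH * (g + 3) + (g + 1 + rem) + um.+1 * (kk.+1 + g))%N = l.
Hypothesis sws3 : size (ws n1) = 0%N.
Hypothesis swc : forall i, (i < n2)%N -> i != n1 -> size (wc i) = g.+1.
Hypothesis swc1 : size (wc n1) = (g + rem).+1.
Hypothesis Hrole1 : forall i ch t, role i = Some (ch, t) ->
  [/\ (i < u)%N, (t < M)%N & ws i = sigma ch].
Hypothesis Hrole2 : forall ch t, (t < M)%N -> exists2 i, (i < u)%N & role i = Some (ch, t).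
Hypothesis Hrole3 : #|[set i : 'I_u | role i != None]| = (uA * M)%N.

Variables (A : 'I_m * 'I_uA -> seq V) (B C : 'I_m * 'I_n1.+1 -> seq V).
Let anc j := anchor k q x0 role (fun ch => A (j, ch)) (fun i => B (j, i)).
Hypothesis sA : forall ji, size (A ji) = N.
Hypothesis absA : forall ji, exists v U, absorbs e x0 k q (sigma ji.2) v U (A ji).
Hypothesis hits : forall v w a b, size w = 2%N -> (#|V| <= 32 * #|fillers e w a b|)%N ->
  (m * cH <= #|[set ji | absorbs e x0 k q (sigma ji.2) v (fillers e w a b) (A ji)]|)%N.
Hypothesis dummy : forall j i, (i < u)%N -> role i = None -> size (B (j, inord i)) = q.+4 /\
  wpath e (ws i) (head x0 (B (j, inord i))) (behead (B (j, inord i))).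
Hypothesis hole : forall j i, (u <= i < n1)%N -> size (B (j, inord i)) = 2%N /\
  (#|V| <= 32 * #|fillers e (ws i) (head x0 (B (j, inord i))) (last x0 (B (j, inord i)))|)%N.
Hypothesis shole : forall i, (u <= i < n1)%N -> size (ws i) = 2%N.
Hypothesis Bnil : forall j i, (i < u)%N -> role i <> None -> B (j, inord i) = [::].
Hypothesis Cnil : forall j, C (j, inord n1) = [::].
Hypothesis sB1 : forall j, size (B (j, inord n1)) = 1%N.
Hypothesis conC : forall j i, (i < n1)%N -> size (C (j, inord i)) = g /\
  wpath e (wc i) (last x0 (anc j i)) (rcons (C (j, inord i)) (head x0 (anc j i.+1))).
Let sumB j : (uA * M * q.+4 + \sum_(i < n1.+1) size (B (j, i)))%N = (u * q.+4 + 2 * cH + 1)%N.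
Proof.
have E (i : 'I_n1.+1) : B (j, i) = B (j, inord i) by rewrite inord_val.
rewrite (eq_bigr (fun i : 'I_n1.+1 => size (B (j, inord i)))) => [|i _]; last by rewrite -E.
rewrite big_ord_recr /= sB1 addnA; congr (_ + _)%N.
rewrite -(big_mkord predT (fun i => size (B (j, inord i)))) /n1.
rewrite (@big_cat_nat _ _ _ u) //= ?leq_addr // addnA; congr (_ + _)%N; last first.
  rewrite (eq_big_nat _ _ (F2 := fun=> 2%N)); last by move=> i hi; have [] := hole j hi.
  by rewrite sum_nat_const_nat addKn mulnC.
rewrite big_mkord.
have : (\sum_(i < u) ((role i != None) * q.+4 + size (B (j, inord i))) = \sum_(i < u) q.+4)%N.
  apply: eq_bigr => i _; case Er: (role i) => [a|] /=; last by have [->] := dummy j (ltn_ord i) Er.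
  by rewrite Bnil // ?Er // mul1n addn0.
rewrite sum_nat_const card_ord big_split /= -big_distrl /= => <-; congr (_ * _ + _)%N.
by rewrite -Hrole3 -sum1_card big_mkcond /=; apply: eq_bigr => i _; rewrite inE; case: (role i).
Qed.

Lemma sum_pairs n (f : 'I_m * 'I_n -> nat) : (\sum_x f x = \sum_(j < m) \sum_(i < n) f (j, i))%N.
Proof. by rewrite pair_big; apply: eq_bigr => -[]. Qed.

Lemma size_skeleton :
  size (allv A ++ allv B ++ allv C) = (m * (u * (q.+4 + g) + cH * (2 + g) + 1))%N.
Proof.
have hA : size (allv A) = (\sum_(j < m) (uA * M * q.+4))%N.
  rewrite size_allv (eq_bigr (fun=> N)) // !sum_nat_const card_prod !card_ord.
  by rewrite /N /abs_size -/M !mulnA addn4.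
have hC : size (allv C) = (\sum_(j < m) (n1 * g))%N.
  rewrite size_allv sum_pairs; apply: eq_bigr => j _.
  rewrite big_ord_recr /=; have -> : (ord_max : 'I_n1.+1) = inord n1.
    by apply: val_inj; rewrite /= inordK.
  rewrite Cnil addn0 (eq_bigr (fun=> g)) ?sum_nat_const ?card_ord // => i _.
  have [<- _] := conC j (ltn_ord i); congr (size (C (j, _))).
  by apply: val_inj; rewrite /= inordK // ltnS ltnW.
rewrite !size_cat hA hC size_allv sum_pairs -!big_split /=.
rewrite (eq_bigr (fun=> (u * (q.+4 + g) + cH * (2 + g) + 1)%N)) ?sum_nat_const ?card_ord // => j _.
by rewrite addnA sumB /n1; clear; nia.
Qed.

Variables (X : 'I_m * 'I_um.+1 -> V) (P : 'I_m * 'I_um.+1 -> seq V) (D : 'I_m * 'I_um.+2 -> seq V).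
Hypothesis pathX : forall j (i : 'I_um.+1), wpath e (ws (n1.+1 + i)%N) (X (j, i)) (P (j, i)).
Hypothesis sP : forall ji, size (P ji) = kk.
Definition head0 j i := if (i < n1.+1)%N then head x0 (anc j i) else X (j, inord (i - n1.+1)).
Definition last0 j i := if (i < n1.+1)%N then last x0 (anc j i)
  else last (X (j, inord (i - n1.+1))) (P (j, inord (i - n1.+1))).
Hypothesis conD : forall j (i : 'I_um.+2),
  wpath e (wc (n1 + i)%N) (last0 j (n1 + i)) (rcons (D (j, i)) (head0 j ((n1 + i).+1 %% n2))).
Let used := (allv A ++ allv B ++ allv C) ++ allv (fun ji => X ji :: P ji) ++ allv D.
Hypothesis used_uniq : uniq used.

Let L := [set v | v \notin used].

Let sD j (i : 'I_um.+2) : size (D (j, i)) = (g + if i == 0%N :> nat then rem else 0)%N.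
Proof.
have := size_wpath (conD j i); rewrite size_rcons; have [i0|i0] := eqVneq (i : nat) 0%N.
  by rewrite i0 addn0 swc1 => -[].
rewrite swc; [by case=> ->; rewrite addn0| |by rewrite -[X in _ != X]addn0 eqn_add2l].
by rewrite /n2 addSnnS ltn_add2l.
Qed.

(** By [suml] the items of a cycle fill its [l] positions, except that a hole stores two of its
    three vertices; what is missing is one vertex per hole. *)
Let cL : (#|L| <= m * cH)%N.
Proof.
have : (#|L| + size used = l * m)%N.
  rewrite -cV -(cardC (mem used)) addnC; congr (_ + _)%N; first by rewrite (card_uniqP used_uniq).
  by apply: eq_card => v; rewrite inE.
have hX : size (allv (fun ji => X ji :: P ji)) = (m * (um.+1 * kk.+1))%N.
  rewrite size_allv (eq_bigr (fun=> kk.+1)) => [|i _]; last by rewrite /= sP.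
  by rewrite sum_nat_const card_prod !card_ord mulnA.
have hD : size (allv D) = (m * (um.+2 * g + rem))%N.
  rewrite size_allv sum_pairs (eq_bigr (fun=> (um.+2 * g + rem)%N)) ?sum_nat_const ?card_ord // => j _.
  under eq_bigr do rewrite sD.
  rewrite big_split /= sum_nat_const card_ord; congr (_ + _)%N.
  by rewrite big_ord_recl /= big1 ?addn0.
rewrite /used size_cat size_skeleton size_cat hX hD -suml; move: #|L| => sl.
by clear; nia.
Qed.

Let a0 : 'I_m * 'I_cH := (Ordinal m0, Ordinal cH0).
Let b0 : 'I_m * 'I_uA := (Ordinal m0, Ordinal uA0).

Definition hole_fill (h : 'I_m * 'I_cH) :=
  let b := B (h.1, inord (u + h.2)) in fillers e (ws (u + h.2)) (head x0 b) (last x0 b).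

Let hole_idx (h : 'I_m * 'I_cH) : (u <= u + h.2 < n1)%N.
Proof. by rewrite leq_addr ltn_add2l ltn_ord. Qed.

Lemma assemble : has_cycle_factor e o.
Proof.
(* [eta] sends each left-over vertex to its own hole, and [chi] to its own absorber, which releases
   a vertex fitting that hole. *)
have [|eta [_ eta_inj]] := @card_le_injection V ('I_m * 'I_cH)%type a0 L [set: _].
  by rewrite cardsT card_prod !card_ord.
have [|chi [chi_inj chiC]] := @distinct_representatives V ('I_m * 'I_uA)%type b0 L
   (fun v => [set ji | absorbs e x0 k q (sigma ji.2) v (hole_fill (eta v)) (A ji)]).
  move=> v _; apply: leq_trans cL _; apply: hits.
    exact: shole (hole_idx (eta v)).
  by have [] := hole (eta v).1 (hole_idx (eta v)).
pose asg ji := [pick v in L | chi v == ji].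
pose hol h := [pick v in L | eta v == h].
have fill_ne h : exists y, y \in hole_fill h.
  apply/card_gt0P; have [_] := hole h.1 (hole_idx h).
  by rewrite -/(hole_fill h) lt0n; case: eqP => // ->; rewrite muln0 leqNgt cV muln_gt0 l0 m0.
(* A hole to which no vertex is sent would take any filler. It is enough to cover [V], as
   disjointness follows by counting. *)
have [dfl dflP] := fin_all_exists fill_ne.
pose y h := if hol h is Some v then abs_y x0 k (A (chi v)) k else dfl h.
have yP h : y h \in hole_fill h.
  rewrite /y /hol; case: pickP => [v /andP[vL /eqP <-]|_ //].
  by have := chiC v vL; rewrite inE => /andP[].
pose rows ji t := if asg ji is Some v then row_after x0 k q v (A ji) t else row_before x0 k q (A ji) t.
(* The anchors after insertion and filling. They begin and end as in [anc], so the connectors chosen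
   for [anc] still fit. *)
pose fanc (j : 'I_m) i : seq V := match role i with
  | Some (ch, t) => abs_a x0 k (A (j, ch)) t :: rows (j, ch) t
  | None => if insub (i - u)%N is Some h then
      if (u <= i)%N then [:: head x0 (B (j, inord i)); y (j, h); last x0 (B (j, inord i))] else B (j, inord i)
      else B (j, inord i) end.
have headE j i : (i <= n1)%N -> head x0 (fanc j i) = head x0 (anc j i).
  move=> hi; rewrite /fanc /anc /anchor; case: (role i) => [[ch t]|] //.
  by case: insubP => // h _ _; case: ifP.
have lastE j i : (i <= n1)%N -> last x0 (fanc j i) = last x0 (anc j i).
  move=> hi; rewrite /fanc /anc /anchor; case: (role i) => [[ch t]|] /=.
    by rewrite /rows; case: (asg _) => [v|] //; symmetry; apply: last_row.
  by case: insubP => // h _ _; case: ifP.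
pose x j i := if (i < n1.+1)%N then head x0 (fanc j i) else X (j, inord (i - n1.+1)).
pose p j i := if (i < n1.+1)%N then behead (fanc j i) else P (j, inord (i - n1.+1)).
pose cc j i := if (i < n1)%N then C (j, inord i) else D (j, inord (i - n1)).
have fanc_ne j i : (i < n1.+1)%N -> fanc j i = head x0 (fanc j i) :: behead (fanc j i).
  move=> hi; suff : fanc j i != [::] by case: (fanc j i).
  rewrite /fanc; case Er: (role i) => [[ch t]|] //.
  have [iu|iu] := ltnP i u.
    have sb : B (j, inord i) != [::] by have [+ _] := dummy j iu Er; case: (B _).
    by case: insubP => // h _ _; rewrite ifF // leqNgt iu.
  move: hi; rewrite ltnS leq_eqVlt => /orP[/eqP E|hi].
    have sb : B (j, inord i) != [::] by rewrite E; have := sB1 j; case: (B _).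
    by case: insubP => // h _ _; rewrite iu.
  have sb : B (j, inord i) != [::] by have [+ _] := hole j (introT andP (conj iu hi)); case: (B _).
  by case: insubP => // h _ _; rewrite iu.
have xE j i : (i < n2)%N -> x j i = head0 j i.
  by move=> hi; rewrite /x /head0; case: ltnP => // h; rewrite headE.
have xpE j i : (i < n2)%N -> last (x j i) (p j i) = last0 j i.
  move=> hi; rewrite /x /p /last0; case: ltnP => // h; rewrite -lastE //.
  by rewrite [in RHS](fanc_ne j i).
have hpath j i : (i < n2)%N -> wpath e (ws i) (x j i) (p j i).
  move=> hi; rewrite /x /p; case: ltnP => h; last first.
    have := pathX j (inord (i - n1.+1)); rewrite inordK ?subnKC //.
    by rewrite ltn_subLR.
  rewrite /fanc; case Er: (role i) => [[ch t]|].
    have [iu tM ->] := Hrole1 Er; rewrite /= /rows /asg; case: pickP => [v /andP[vL /eqP E]|_].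
      have := chiC v vL; rewrite inE E => /andP[_ /forallP/(_ (Ordinal tM))/andP[]] //.
    by have [v [U /andP[_ /forallP/(_ (Ordinal tM))/andP[]]]] := absA (j, ch).
  have [iu|iu] := ltnP i u.
    have [_ wB] := dummy j iu Er.
    by case: insubP => // s _ _.
  move: h; rewrite ltnS leq_eqVlt => /orP[/eqP E|h].
    have sz := sB1 j; rewrite E /n1 addKn insubF ?ltnn //.
    have := sws3; rewrite /n1; move: sz; rewrite /n1.
    by case: (ws _) => //; case: (B _) => // a [].
  have hic : (i - u < cH)%N by rewrite ltn_subLR.
  rewrite insubT /=; have := yP (j, Ordinal hic).
  by rewrite /hole_fill /= subnKC // inE.
have hcon j i : (i < n2)%N -> wpath e (wc i) (last (x j i) (p j i)) (rcons (cc j i) (x j (i.+1 %% n2)%N)).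
  move=> hi; have hi' : (i.+1 %% n2 < n2)%N by rewrite ltn_mod.
  rewrite xpE // xE // /cc; case: ltnP => h.
    have [_] := conC j h; rewrite modn_small.
      by rewrite /last0 /head0 !ltnS (ltnW h) h.
    by rewrite /n2 addSn ltnS (leq_trans h) // leq_addr.
  have := conD j (inord (i - n1)); rewrite inordK ?subnKC //.
  by rewrite ltn_subLR // addnS -addSn.
have hfj j : exists f : 'I_l -> V, (forall i, e (f (cyc_edge o i).1) (f (cyc_edge o i).2)) /\
    forall i v, (i < n2)%N -> v \in x j i :: p j i ++ cc j i -> exists s, f s = v.
  by apply: (close_cycle l0 ow); [apply: hpath | apply: hcon].
have [f hf] := fin_all_exists hfj.
apply: (factor_of_cover (F := f) cV) => [j|v]; first by have [] := hf j.
suff [j [i [hi vi]]] : exists j i, (i < n2)%N /\ v \in x j i :: p j i ++ cc j i.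
  by have [_ /(_ i v hi vi)[s <-]] := hf j; exists j, s.
have n12 i : (i <= n1)%N -> (i < n2)%N by move=> hi; rewrite /n2 addSn ltnS (leq_trans hi) // leq_addr.
have covA j i : (i <= n1)%N -> v \in fanc j i -> exists j i, (i < n2)%N /\ v \in x j i :: p j i ++ cc j i.
  move=> hi vi; exists j, i; split; first exact: n12.
  by rewrite -cat_cons mem_cat /x /p ltnS hi -fanc_ne ?vi.
have covR ji t : (t < M)%N -> v \in abs_a x0 k (A ji) t :: rows ji t ->
    exists j i, (i < n2)%N /\ v \in x j i :: p j i ++ cc j i.
  case: ji => j ch tM vr; have [i iu Er] := Hrole2 ch tM.
  apply: (covA j i); first by rewrite /n1 (leq_trans (ltnW iu)) // leq_addr.
  by rewrite /fanc Er.
(* An inserted vertex stands in row [0] of its absorber, as the [Y_0] of the exchange. *)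
have [vL|vL] := boolP (v \in L).
  apply: (covR (chi v) 0%N); first by rewrite /M /abs_rows; case: (k) k0 => // a _; rewrite mulnS.
  rewrite /rows /asg; case: pickP => [v' /andP[vL' /eqP E]|/(_ v)]; last by rewrite /= vL eqxx.
  by rewrite (chi_inj _ _ vL' vL E) /row_after /= !inE eqxx orbT.
move: vL; rewrite inE negbK /used !mem_cat => /orP[/or3P[vA|vB|vC]|/orP[vX|vD]].
- have [ji vji] := allvP vA.
  case Ea: (asg ji) => [v'|]; last first.
    have [t tM vt] := mem_row_before x0 k0 (sA ji) vji.
    by apply: (covR ji t tM); rewrite /rows Ea.
  have [vy|vy] := eqVneq v (abs_y x0 k (A ji) k); last first.
    have [t tM vt] := mem_row_after v' k0 (sA ji) vji vy.
    by apply: (covR ji t tM); rewrite /rows Ea.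
  move: Ea; rewrite /asg; case: pickP => // v'' /andP[vL'' /eqP E] _.
  pose h := eta v''.
  apply: (covA h.1 (u + h.2)%N); first by have /andP[_ /ltnW] := hole_idx h.
  have Er : role (u + h.2) = None.
    by case Er: (role _) => [[ch t]|] //; have [] := Hrole1 Er; rewrite ltnNge leq_addr.
  rewrite /fanc Er addKn leq_addr (insubT (fun i => i < cH)%N (ltn_ord h.2)) !inE.
  apply/orP; right; apply/orP; left.
  have -> : (h.1, Sub (h.2 : nat) (ltn_ord h.2)) = h by case: (h) => a b; congr (_, _); apply: val_inj.
  rewrite /y /hol; case: pickP => [w /andP[wL /eqP Ew]|/(_ v'')]; last by rewrite /= vL'' eqxx.
  by rewrite (eta_inj _ _ wL vL'' Ew) E vy.
- have [[j i] vi] := allvP vB; have iE : inord (i : nat) = i by rewrite inord_val.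
  case Er: (role i) => [[ch t]|].
    have [iu _ _] := Hrole1 Er; have := @Bnil j i iu; rewrite Er iE => /(_ _)E.
    by rewrite E in vi.
  apply: (covA j i); first by rewrite -ltnS.
  rewrite /fanc Er iE; case: insubP => // h hc _; case: ifP => // ui.
  have hic : (u <= i < n1)%N by rewrite ui /= -(subnKC ui) ltn_add2l.
  have [+ _] := hole j hic; rewrite iE; move: vi.
  case: (B (j, i)) => // a [|b []] //=; rewrite !inE => /orP[/eqP->|/eqP->] _.
    by rewrite eqxx.
  by rewrite eqxx !orbT.
- have [[j i] vi] := allvP vC; have iE : inord (i : nat) = i by rewrite inord_val.
  exists j, (i : nat); split; first by apply: n12; rewrite -ltnS.
  have [ic|ic] := ltnP i n1; first by rewrite -cat_cons mem_cat /cc ic iE vi orbT.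
  have E : (i : nat) = n1 by apply/eqP; rewrite eqn_leq ic -ltnS ltn_ord.
  by move: vi; rewrite -iE E Cnil.
- have [[j i] vi] := allvP vX.
  exists j, (n1.+1 + i)%N; split; first by rewrite ltn_add2l.
  by rewrite -cat_cons mem_cat /x /p ltnNge leq_addr /= addKn inord_val vi.
have [[j i] vi] := allvP vD.
exists j, (n1 + i)%N; split; first by rewrite /n2 addSnnS ltn_add2l.
by rewrite -cat_cons mem_cat /cc ltnNge leq_addr /= addKn inord_val vi orbT.
Qed.

End Assemble.

(* Each of the [uA] blocks of [M * 2 ^ b] windows contains [M] windows with a
   common word, which receive the rows of one absorber. *)
Lemma chunk_roles (uA M b : nat) (ws : nat -> seq bool) :
  (forall i, (i < uA * (M * 2 ^ b))%N -> size (ws i) = b) ->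
  exists (sigma : 'I_uA -> seq bool) (role : nat -> option ('I_uA * nat)),
  [/\ forall ch, size (sigma ch) = b,
    forall i ch t, role i = Some (ch, t) ->
      [/\ (i < uA * (M * 2 ^ b))%N, (t < M)%N & ws i = sigma ch],
    forall ch t, (t < M)%N -> exists2 i, (i < uA * (M * 2 ^ b))%N & role i = Some (ch, t) &
    #|[set i : 'I_(uA * (M * 2 ^ b)) | role i != None]| = (uA * M)%N].
Proof.
set K := (M * 2 ^ b)%N => sws.
have blk (ch : 'I_uA) r : (r < K)%N -> (ch * K + r < uA * K)%N.
  move=> hr; apply: (@leq_trans (ch.+1 * K)); first by rewrite mulSn addnC ltn_add2r.
  by rewrite leq_mul2r ltn_ord orbT.
have pig (ch : 'I_uA) : exists wp : seq bool * (nat -> nat), [/\ size wp.1 = b,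
    (forall t, (t < M)%N -> (wp.2 t < K)%N /\ ws (ch * K + wp.2 t)%N = wp.1) &
    (forall t t', (t < M)%N -> (t' < M)%N -> wp.2 t = wp.2 t' -> t = t')].
  have [|w [pos H]] := @pigeonhole_word M b (fun r => ws (ch * K + r)%N).
    by move=> r hr; apply: sws; apply: blk.
  by exists (w, pos).
have [wp wpP] := fin_all_exists pig.
pose role i : option ('I_uA * nat) := if insub (i %/ K)%N is Some ch then
  if [pick t : 'I_M | (wp ch).2 t == (i %% K)%N] is Some t then Some (ch, nat_of_ord t) else None else None.
have role_spec i ch t : role i = Some (ch, t) -> (t < M)%N /\ i = (ch * K + (wp ch).2 t)%N.
  rewrite /role; case: insubP => // ch' _ Ech; case: pickP => // t' /eqP Et [<- <-].
  by split; rewrite ?ltn_ord // Et Ech -divn_eq.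
have role_inv (ch : 'I_uA) t : (t < M)%N -> role (ch * K + (wp ch).2 t)%N = Some (ch, t).
  move=> tM; have [_ /(_ t tM)[pK _] pinj] := wpP ch.
  have K0 : (0 < K)%N by apply: leq_ltn_trans pK.
  rewrite /role divnMDl // divn_small // addn0 valK modnMDl modn_small //.
  case: pickP => [t' /eqP/(pinj _ _ (ltn_ord t') tM)-> //|/(_ (Ordinal tM))].
  by rewrite eqxx.
exists (fun ch => (wp ch).1), role; split.
- by move=> ch; have [] := wpP ch.
- move=> i ch t /role_spec[tM ->]; have [_ /(_ t tM)[pK wE] _] := wpP ch.
  by split=> //; apply: blk.
- move=> ch t tM; exists (ch * K + (wp ch).2 t)%N; last exact: role_inv.
  by have [_ /(_ t tM)[pK wE] _] := wpP ch; apply: blk.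
have hF (x : 'I_uA * 'I_M) : (x.1 * K + (wp x.1).2 x.2 < uA * K)%N.
  by have [_ /(_ x.2 (ltn_ord _))[pK _] _] := wpP x.1; apply: blk.
have -> : (uA * M)%N = #|[set Ordinal (hF x) | x in [set: 'I_uA * 'I_M]]|.
  rewrite card_imset ?cardsT ?card_prod ?card_ord // => -[ch t] [ch' t'] /(congr1 val) /= E.
  have := role_inv ch t (ltn_ord t); rewrite E role_inv // => -[-> Et].
  by congr (_, _); apply: val_inj.
apply: eq_card => i; rewrite inE; apply/idP/imsetP.
  case Er: (role i) => [[ch t]|] // _; have [tM E] := role_spec _ _ _ Er.
  by exists (ch, Ordinal tM); rewrite ?inE //; apply: val_inj.
by case=> -[ch t] _ ->; rewrite /= role_inv.
Qed.

(** * Numerical bounds and choice of the constants *)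

Lemma bernoulli (R : realType) (x : R) n : 0 <= x -> 1 + n%:R * x <= (1 + x) ^+ n.
Proof.
move=> x0; elim: n => [|n IH]; first by rewrite mul0r addr0 expr0.
rewrite exprS -natr1; have := ler_wpM2l (addr_ge0 ler01 x0) IH.
have : 0 <= n%:R * (x * x) by rewrite mulr_ge0 // mulr_ge0.
lra.
Qed.

Lemma exists_nat_ge (R : realType) (x : R) : exists n : nat, (0 < n)%N /\ x <= n%:R.
Proof.
have [x0|x0] := leP x 0; first by exists 1%N; split=> //; lra.
have [n [_ h]] := exists_floor (ltW x0).
by exists n.+1; split=> //; rewrite -natr1 ltW.
Qed.

(** With [a = r %/ 4] one has [(a + 1) ^ 4 <= 2 ^ r] and [r < 4 * (a + 1)]; the spare factor [a + 1]
    absorbs [256 * K ^ 3], and [1024 = 4 * 256]. *)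
Lemma cube_lt_exp2 (K r : nat) : (1024 * K ^ 3 <= r)%N -> (4 * (K * r) ^ 3 < 2 ^ r)%N.
Proof.
move=> hr; have [r0|r0] := posnP r.
  by rewrite r0 muln0.
pose a := (r %/ 4)%N.
have ra : (r < 4 * a.+1)%N by rewrite mulnC ltn_ceil.
have h2 : (a.+1 <= 2 ^ a)%N by rewrite ltn_expl.
have h3 : ((2 ^ a) ^ 4 <= 2 ^ r)%N by rewrite -expnM leq_exp2l // /a leq_divM.
have h4 : (a.+1 ^ 4 <= 2 ^ r)%N by apply: leq_trans h3; rewrite leq_exp2r.
apply: leq_trans h4.
have h5 : (256 * K ^ 3 <= a.+1)%N.
  have := leq_ltn_trans hr ra; rewrite -[1024%N]/(4 * 256)%N -mulnA ltn_pmul2l //.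
  exact: ltnW.
have h6 : (r ^ 3 < (4 * a.+1) ^ 3)%N by rewrite ltn_exp2r.
have [K0|K0] := posnP K; first by rewrite K0 mul0n exp0n // muln0 expn_gt0.
apply: (@leq_trans (4 * (K ^ 3 * (4 * a.+1) ^ 3))).
  by rewrite expnMn ltn_pmul2l // ltn_pmul2l // expn_gt0 K0.
rewrite expnMn [(K ^ 3 * _)%N]mulnCA mulnA -[(4 * 4 ^ 3)%N]/256%N mulnA [leqRHS]expnS.
by rewrite leq_mul2r h5 orbT.
Qed.

(** Having [G0 * r] absorbers makes the left side of the weight bound at least [4 ^ r], while the
    number [4 * n ^ 3] of conditions is below [2 ^ r]; so there are at least [r] hits. *)
Lemma hits_ge (R : realType) (x : R) (G0 K r0 r n y : nat) :
  0 <= x -> 4 <= (1 + x) ^+ G0 -> (G0 * r <= r0)%N -> (n <= K * r)%N -> (1024 * K ^ 3 <= r)%N ->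
  (1 + x) ^+ r0 <= (4 * n ^ 3)%:R * 2 ^+ y -> (r <= y)%N.
Proof.
move=> x0 hG hr hn hK H; rewrite leqNgt; apply/negP => yr.
have c1 := cube_lt_exp2 hK.
have c2 : (4 * n ^ 3 < 2 ^ r)%N.
  by apply: leq_ltn_trans c1; rewrite leq_mul2l /= leq_exp2r.
have x1 : 1 <= 1 + x by rewrite lerDl.
have h1 : 4 ^+ r <= (1 + x) ^+ r0.
  apply: le_trans (_ : (1 + x) ^+ (G0 * r) <= _); last exact: ler_weXn2l.
  by rewrite exprM; apply: lerXn2r; rewrite ?nnegrE ?exprn_ge0 // (le_trans ler01).
have h2 : (4 * n ^ 3)%:R * 2 ^+ y < (2 ^ r)%:R * 2 ^+ r :> R.
  apply: lt_le_trans (_ : (2 ^ r)%:R * 2 ^+ y <= _).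
    by rewrite ltr_pM2r ?exprn_gt0 // ltr_nat.
  by apply: ler_wpM2l => //; apply: ler_weXn2l; [rewrite ler1n|exact: ltnW].
have := le_lt_trans (le_trans h1 H) h2.
by rewrite natrX -exprMn -natrM ltxx.
Qed.

(** A path has one vertex more than letters and a connector one letter more than inner vertices, so
    each item with its connector uses as many letters as it owns vertices. *)
Lemma item_sizes (u cH g rem kk um q l : nat) :
  let a i := (if (i < u)%N then q.+3 else if (i < u + cH)%N then 2 else if i == (u + cH)%N then 0 else kk)%N in
  let b i := (if i == (u + cH)%N then (g + rem).+1 else g.+1) in
  (u * (q.+4 + g) + cH * (g + 3) + (g + 1 + rem) + um.+1 * (kk.+1 + g))%N = l ->
  (\sum_(i < (u + cH).+1 + um.+1) (a i + b i))%N = l.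
Proof.
move=> a b <-.
have E1 i : (0 <= i < u)%N -> (a i + b i = q.+4 + g)%N.
  move=> /andP[_ iu]; rewrite /a /b iu ifN; first by rewrite addnS addSn.
  by rewrite neq_ltn (leq_trans iu) // leq_addr.
have E2 i : (u <= i < u + cH)%N -> (a i + b i = g + 3)%N.
  move=> /andP[ui iu]; rewrite /a /b ltnNge ui iu /= ifN; first by rewrite addnC addn2 addn3.
  by rewrite neq_ltn iu.
have E3 : (a (u + cH) + b (u + cH) = g + 1 + rem)%N.
  by rewrite /a /b ltnNge leq_addr /= ltnn eqxx add0n addn1 addSn.
have E4 i : ((u + cH).+1 <= i < (u + cH).+1 + um.+1)%N -> (a i + b i = kk.+1 + g)%N.
  move=> /andP[ui _]; rewrite /a /b.
  rewrite (_ : i < u = false)%N; last by apply/negbTE; rewrite -leqNgt (leq_trans _ (ltnW ui)) // leq_addr.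
  rewrite (_ : i < u + cH = false)%N; last by apply/negbTE; rewrite -leqNgt ltnW.
  by rewrite (_ : i == u + cH = false)%N ?addnS ?addSn //; apply/negbTE; rewrite neq_ltn ui orbT.
clearbody a b; rewrite -(big_mkord predT (fun i => a i + b i)%N).
rewrite (@big_cat_nat _ _ _ (u + cH).+1) ?leq_addr //= big_nat_recr //= E3.
rewrite (@big_cat_nat _ _ _ u) ?leq_addr //=.
rewrite (eq_big_nat _ _ E1) (eq_big_nat _ _ E2) (eq_big_nat _ _ E4) !sum_nat_const_nat.
by rewrite subn0 !addKn.
Qed.

Lemma factor_small_eps (R : realType) (eps : R) : 0 < eps -> eps <= 1/8 ->
  exists l0 : nat, forall l : nat, (l0 <= l)%N -> forall (o : 'I_l -> bool) (m : nat), (1 <= m)%N ->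
  forall (V : finType) (e : rel V), oriented e -> #|V| = (l * m)%N ->
  semideg e (3/8 + eps) setT -> has_cycle_factor e o.
Proof.
move=> eps0 eps8.
have [j [j0 hj]] := exists_nat_ge (2 + 2 / eps).
(* Connectors inside the reserve have only a surplus [eps / 4]: [W] keeps [eps / 2], and its random
   subset half of that. *)
have [g [g0 hg]] := exists_nat_ge (2 + 2 / (eps / 2 / 2)).
pose M := abs_rows j; pose N := abs_size j j.
pose c : R := (32 * 8 ^ M)%:R^-1.
have c0 : 0 < c by rewrite invr_gt0 ltr0n muln_gt0 expn_gt0.
pose ce := c * eps; have ce0 : 0 < ce by rewrite mulr_gt0.
have c32 : c <= 1/32.
  rewrite /c natrM invfM -[X in _ <= X]mulr1 div1r ler_pM2l ?invr_gt0 //.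
  by rewrite invf_le1 ?ltr0n ?ler1n expn_gt0.
have ce32 : ce <= eps / 32 by have := ler_wpM2r (ltW eps0) c32; rewrite /ce; lra.
pose c' := (ce / 4) ^+ N; have c'0 : 0 < c' by rewrite exprn_gt0 // divr_gt0.
have [G0 [G00 hG0]] := exists_nat_ge (3 / (c' / 2)).
have hG : 4 <= (1 + c' / 2) ^+ G0.
  have c'2 : 0 < c' / 2 by rewrite divr_gt0.
  apply: le_trans (bernoulli _ (ltW c'2)); rewrite ler_pdivrMr // in hG0; lra.
pose C0 := (M * 2 ^ j.+3)%N.
(* Bounds the skeleton per absorber: its vertices, its [C0] windows and at most two further items
   with their connectors. One absorber per [Bq] vertices then keeps the skeleton within [ce / 16] of
   the graph. *)
pose A2 := (N + (C0 + 2) * (j.+4 + g) + N)%N.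
have [Bq [Bq0 hBq]] := exists_nat_ge (16 * A2%:R / ce).
rewrite ler_pdivrMr // in hBq.
(* Holes make up at least [1 / K] of each cycle; the factor 2 pays for rounding in the divisions by
   [Bq] and [G0]. *)
pose K := (2 * Bq * G0)%N.
have K0 : (0 < K)%N by rewrite !muln_gt0 Bq0 G00.
have K0' : 0 < K%:R :> R by rewrite ltr0n.
pose rho : R := K%:R^-1; have rho0 : 0 < rho by rewrite invr_gt0.
have rho1 : rho <= 1 by rewrite invf_le1 // ler1n.
(* The reserve has at least [rho / 4 * #|V|] vertices and allows [eps / 32] of its size as choices,
   that is [2 * lam * #|V|]. *)
pose lam := eps * rho / 256; have lam0 : 0 < lam by rewrite divr_gt0 // mulr_gt0.
(* Main paths are so long that [g] connecting vertices per path use at most half of the budget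
   [lam]. *)
have [kk [kk0 hkk]] := exists_nat_ge (2 * g%:R / lam).
rewrite ler_pdivrMr // in hkk.
have e20 : 0 < eps / 2 by rewrite divr_gt0.
have e28 : eps / 2 <= 1/8 by lra.
have [nm hm] := main_paths kk e20 e28 rho0 rho1.
have [l1 [_ hl1]] := exists_nat_ge (4 / ce).
have [l2 [_ hl2]] := exists_nat_ge ((2 * (2 * g + kk.+1)%:R + 2) / lam).
(* [K] ensures a hole in each cycle, [l1] that rounding at most halves [ce * #|V|], [l2] that the
   connectors fit into the reserve, [nm] serves [main_paths], [1024 * K ^ 3 * K] serves [hits_ge],
   and the last term yields a main path per cycle. *)
exists (K + l1 + l2 + 2 * nm + 1024 * K ^ 3 * K + 2 * (kk.+1 + g))%N.
move=> l hl o m m1 V e oe cV degV.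
have lkk : (2 * (kk.+1 + g) <= l)%N := leq_trans (leq_addl _ _) hl.
have {}hl := leq_trans (leq_addr _ _) hl.
have lcube : (1024 * K ^ 3 * K <= l)%N := leq_trans (leq_addl _ _) hl.
have {}hl := leq_trans (leq_addr _ _) hl.
have lnm : (2 * nm <= l)%N := leq_trans (leq_addl _ _) hl.
have {}hl := leq_trans (leq_addr _ _) hl.
have ll2 : (l2 <= l)%N := leq_trans (leq_addl _ _) hl.
have {}hl := leq_trans (leq_addr _ _) hl.
have ll1 : (l1 <= l)%N := leq_trans (leq_addl _ _) hl.
have lK : (K <= l)%N := leq_trans (leq_addr _ _) hl.
clear hl.
have l0 : (0 < l)%N := leq_trans K0 lK.
pose uA := (l %/ Bq)%N; pose cH := (uA %/ G0)%N; pose u := (uA * C0)%N; pose n1 := (u + cH)%N.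
have uAB : (uA * Bq <= l)%N by apply: leq_divM.
have cHG : (G0 * cH <= uA)%N by rewrite mulnC leq_divM.
have lcH : (l <= K * cH)%N.
  have b1 : (l < uA.+1 * Bq)%N by apply: ltn_ceil.
  have b2 : (uA.+1 * Bq <= cH.+1 * G0 * Bq)%N by rewrite leq_mul2r (ltn_ceil _ G00) orbT.
  have {b1 b2} := leq_trans b1 b2; move: lK; rewrite /K -!mulnA (mulnC G0 Bq) [(cH.+1 * _)%N]mulSn.
  have -> : (Bq * (G0 * cH) = cH * (Bq * G0))%N by rewrite mulnA mulnC.
  by move: (Bq * G0)%N => p; move: (cH * p)%N => p'; clear; lia.
have cH0 : (0 < cH)%N.
  by rewrite lt0n; apply: contraTneq l0 => E; move: lcH; rewrite E muln0 leqn0 => /eqP->.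
have cHuA : (cH <= uA)%N by apply: leq_div.
have uA0 : (0 < uA)%N by apply: leq_trans cHuA.
clearbody cH uA.
pose S := (u * (j.+4 + g) + cH * (g + 3) + (g + 1))%N.
have SA : (S <= uA * A2)%N.
  rewrite /S /A2 /u; move: cHuA uA0; clear; move: C0 N cH uA => a b d f; nia.
have n1A : (n1.+1 <= uA * (C0 + 2))%N.
  by rewrite /n1 /u; move: cHuA uA0; clear; move: C0 cH uA => a d f; nia.
have totA : (m * uA * N + m * n1.+1 * (j.+4 + g) + N <= m * (uA * A2))%N.
  have : (m * n1.+1 * (j.+4 + g) <= m * (uA * (C0 + 2)) * (j.+4 + g))%N.
    by rewrite leq_mul2r leq_mul2l n1A !orbT.
  have : (N <= m * uA * N)%N by rewrite leq_pmull // muln_gt0 m1 uA0.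
  rewrite /A2; move: (n1) => d; clear; move: C0 N uA => a b f; nia.
have uAce : 16 * (uA * A2)%:R <= ce * l%:R.
  have uB : (uA * Bq)%:R <= l%:R :> R by rewrite ler_nat.
  rewrite natrM in uB; rewrite natrM.
  have b1 := ler_wpM2l (ler0n R uA) hBq.
  have b2 := ler_wpM2l (ltW ce0) uB; clear - b1 b2; lra.
have ce1 : ce <= 1 by clear - ce32 eps8; lra.
have S16 : (16 * S <= l)%N.
  rewrite -(ler_nat R) natrM.
  have b1 : S%:R <= (uA * A2)%:R :> R by rewrite ler_nat.
  have b2 := ler_wpM2r (ler0n R l) ce1.
  clear - b1 b2 uAce; lra.
have T0 : (0 < kk.+1 + g)%N by [].
(* The remainder [rem] lengthens the connector after the single vertex, so that every length [l] is
   attained. *)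
pose um := ((l - S) %/ (kk.+1 + g)).-1%N; pose rem := ((l - S) %% (kk.+1 + g))%N.
have umE : um.+1 = ((l - S) %/ (kk.+1 + g))%N.
  by rewrite /um prednK // divn_gt0 //; move: S16 lkk; clear; move: S (kk.+1 + g)%N => a b; lia.
have Sl : (S <= l)%N by move: S16; clear; move: S => a; lia.
have suml : (u * (j.+4 + g) + cH * (g + 3) + (g + 1 + rem) + um.+1 * (kk.+1 + g))%N = l.
  have := divn_eq (l - S) (kk.+1 + g); rewrite -umE -/rem => E.
  by rewrite addnA -/S -addnA [(rem + _)%N]addnC -E subnKC.
have remT : (rem <= kk.+1 + g)%N by apply/ltnW; rewrite ltn_mod.
have umT : (um.+1 * kk.+1 <= l)%N.
  rewrite -suml; apply: leq_trans (leq_addl _ _); rewrite leq_mul2l leq_addr orbT //.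
clearbody um rem.
pose n2 := (n1.+1 + um.+1)%N.
have [|ws [wc [sw ow]]] := @word_split [seq o i | i <- enum 'I_l] _ _ n2
    (etrans (item_sizes suml) _); first by rewrite size_map size_enum_ord.
have un : (u <= n1)%N by apply: leq_addr.
have n12 : (n1 < n2)%N by rewrite /n2 addSn ltnS leq_addr.
have sws1 i : (i < u)%N -> size (ws i) = j.+3.
  move=> iu; have [|-> _] := sw i; first by apply: ltn_trans n12; apply: leq_trans un.
  by rewrite iu.
have sws2 i : (u <= i < n1)%N -> size (ws i) = 2%N.
  move=> /andP[ui iu]; have [|-> _] := sw i; first by apply: ltn_trans n12.
  by rewrite ltnNge ui iu.
have sws3 : size (ws n1) = 0%N.
  by have [//|-> _] := sw n1; rewrite ltnNge un /= ltnn eqxx.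
have sws4 (i : 'I_um.+1) : size (ws (n1.+1 + i)%N) = kk.
  have [|-> _] := sw (n1.+1 + i)%N; first by rewrite ltn_add2l.
  have h1 : (n1 < n1.+1 + i)%N by rewrite addSn ltnS leq_addr.
  have f1 : (n1.+1 + i < u)%N = false by apply/negbTE; rewrite -leqNgt (leq_trans un (ltnW h1)).
  have f2 : (n1.+1 + i < u + cH)%N = false by apply/negbTE; rewrite -leqNgt (ltnW h1).
  have f3 : (n1.+1 + i == u + cH)%N = false by apply/negbTE; rewrite neq_ltn h1 orbT.
  by rewrite f1 f2 f3.
have swc i : (i < n2)%N -> i != n1 -> size (wc i) = g.+1.
  by move=> hi; have [_ ->] := sw i hi; move=> /negbTE->.
have swc1 : size (wc n1) = (g + rem).+1.
  by have [//|_ ->] := sw n1; rewrite eqxx.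
have [|sigma [role [ssig Hrole1 Hrole2 Hrole3]]] := @chunk_roles uA M j.+3 ws.
  by move=> i; apply: sws1.
have nE : #|V|%:R = l%:R * m%:R :> R by rewrite cV natrM.
have m1' : 1 <= m%:R :> R by rewrite ler1n.
have ln : l%:R <= #|V|%:R :> R by rewrite nE ler_peMr.
have n0 : 0 < #|V|%:R :> R by apply: lt_le_trans ln; rewrite ltr0n.
have cen4 : 4 <= ce * #|V|%:R.
  have : 4 / ce <= l%:R by apply: le_trans hl1 _; rewrite ler_nat.
  rewrite ler_pdivrMr // mulrC => /le_trans; apply; rewrite ler_pM2l //.
have [h [h1 h2]] := exists_floor (ltW (mulr_gt0 ce0 n0)).
have h2' : ce * #|V|%:R <= 2 * h%:R by clear - h2 cen4; lra.
have totce : 16 * (m * (uA * A2))%:R <= ce * #|V|%:R.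
  rewrite natrM nE; have := ler_wpM2l (ler0n R m) uAce; clear; lra.
have hh : (2 * (m * uA * N + m * n1.+1 * (j.+4 + g) + N) < h)%N.
  rewrite -(ltr_nat R) natrM.
  have : (m * uA * N + m * n1.+1 * (j.+4 + g) + N)%:R <= (m * (uA * A2))%:R :> R by rewrite ler_nat.
  clear - h2 totce cen4; lra.
have /card_gt0P[x0 _] : (0 < #|V|)%N by rewrite -(ltr0n R).
have hk : 2 + 2 / eps <= (2 * j).-1%:R.
  by apply: le_trans hj _; rewrite ler_nat; move: j0; clear; lia.
have hg' : 2 + 2 / eps <= g%:R.
  apply: le_trans hg; rewrite lerD2l ler_pM2l // lef_pV2 ?posrE ?divr_gt0 //.
  by clear - eps0; lra.
have swc' i : (i < n1)%N -> size (wc i) = g.+1.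
  by move=> hi; apply: swc; [apply: ltn_trans n12|rewrite neq_ltn hi].
have [A [B [C [[A1 A2' A3] [[B1 B2 [B3 [C1 B4]] C2 uq] sz]]]]] :=
  @skeleton R V e eps j j x0 oe eps0 eps8 degV j0 hk hj h h1 h2' m uA u n1 g ws wc sigma role
    hg' un sws1 sws2 swc' ssig hh.
have hitsA v w a b : size w = 2%N -> (#|V| <= 32 * #|fillers e w a b|)%N ->
    (m * cH <= #|[set ji | absorbs e x0 j j (sigma ji.2) v (fillers e w a b) (A ji)]|)%N.
  move=> sw2 hf; have := A3 v w a b sw2 hf.
  have c'2 : 0 <= c' / 2 by rewrite divr_ge0 // ltW.
  have GmH : (G0 * (m * cH) <= m * uA)%N by rewrite mulnCA leq_mul2l cHG orbT.
  have VK : (#|V| <= K * (m * cH))%N by rewrite cV mulnC mulnCA leq_mul2l lcH orbT.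
  apply: hits_ge c'2 hG GmH VK _.
  rewrite -(leq_pmul2r K0); apply: leq_trans lcube (leq_trans lcH _).
  by rewrite [leqRHS]mulnC leq_mul2l leq_pmull ?orbT.
have sk : size (allv A ++ allv B ++ allv C) = (m * (u * (j.+4 + g) + cH * (2 + g) + 1))%N.
  exact: (size_skeleton Hrole3 A1 B1 B2 B4 C1 B3 C2).
set Sk := allv A ++ allv B ++ allv C in uq sz sk.
pose W := ~: [set v in Sk].
have cW : (#|W| + size Sk = #|V|)%N.
  have cS : #|[set v in Sk]| = size Sk by rewrite cardsE; apply/card_uniqP.
  by rewrite -cS addnC cardsC.
have cW' : #|W|%:R + (size Sk)%:R = #|V|%:R :> R by rewrite -natrD cW.
have skce : 16 * (size Sk)%:R <= ce * #|V|%:R.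
  apply: le_trans totce; rewrite ler_pM2l // ler_nat; apply: leq_trans sz _.
  by apply: leq_trans totA; rewrite leq_addr.
have en : ce * #|V|%:R <= eps / 32 * #|V|%:R by rewrite ler_pM2r.
have e8n : eps * #|V|%:R <= 1/8 * #|V|%:R by rewrite ler_pM2r.
have degW : semideg e (3/8 + eps / 2) W.
  move=> v s; have := degV v s; rewrite setIT cardsT.
  have b1 : (#|nb e s v| <= #|nb e s v :&: W| + size Sk)%N.
    rewrite -(cardsID W) leq_add2l; apply: leq_trans (card_size Sk); apply: subset_leq_card.
    by apply/subsetP => y; rewrite !inE negbK => /andP[].
  rewrite -(ler_nat R) natrD in b1.
  have b2 : (3/8 + eps / 2) * #|W|%:R <= (3/8 + eps / 2) * #|V|%:R.
    by apply: ler_wpM2l; [clear - eps0; lra|rewrite -cW' lerDl].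
  have b3 : 0 < eps * #|V|%:R by rewrite mulr_gt0.
  clear - b1 b2 b3 skce en; lra.
have W2 : #|V|%:R <= 2 * #|W|%:R :> R by clear - cW' skce en e8n n0; lra.
have W2' : (#|V| <= 2 * #|W|)%N by rewrite -(ler_nat R) natrM.
have nmW : (nm <= #|W|)%N.
  rewrite -(leq_pmul2l (isT : 0 < 2)%N); apply: leq_trans lnm (leq_trans _ W2').
  by rewrite cV leq_pmulr.
have rl : rho * #|V|%:R <= (m * cH)%:R.
  rewrite /rho mulrC ler_pdivrMr // -natrM ler_nat cV mulnC -mulnA leq_mul2l [(cH * K)%N]mulnC lcH orbT //.
(* Skeleton and main paths leave at least the [m * cH] vertices owed to the holes, hence
   [rho * #|V|]; this is the room for the reserve. *)
have JW : kk.+1%:R * #|{: 'I_m * 'I_um.+1}|%:R <= (1 - rho) * #|W|%:R.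
  have b1 : (kk.+1 * #|{: 'I_m * 'I_um.+1}| + m * cH <= #|W|)%N.
    rewrite card_prod !card_ord -(leq_add2r (size Sk)) cW cV sk -suml; clear; nia.
  rewrite -(ler_nat R) natrD natrM in b1.
  have b2 : rho * #|W|%:R <= rho * #|V|%:R by rewrite ler_pM2l // -cW' lerDl.
  clear - b1 b2 rl; lra.
pose w (x : 'I_m * 'I_um.+1) : kk.-tuple bool := insubd [tuple of nseq kk true] (ws (n1.+1 + x.2)%N).
have wE x : w x = ws (n1.+1 + x.2)%N :> seq bool by rewrite /w val_insubd sws4 eqxx.
have [Res [X [P [[RW Rc degR] [pathX uX XW]]]]] := hm V e W _ w oe degW nmW W2' JW.
have e40 : 0 < eps / 2 / 2 by rewrite divr_gt0.
have e48 : eps / 2 / 2 <= 1/8 by clear - eps8 eps0; lra.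
have Rn : 0 <= eps / 2 / 2 / 8 * #|Res|%:R by rewrite mulr_ge0 // ltW // divr_gt0.
have [hR [hR1 hR2]] := exists_floor Rn.
have lamn : 2 * (lam * #|V|%:R) <= eps / 2 / 2 / 8 * #|Res|%:R.
  have b1 : rho / 2 * (#|V|%:R / 2) <= rho / 2 * #|W|%:R.
    by rewrite ler_pM2l ?divr_gt0 // ; clear - W2; lra.
  have b2 : eps * (rho / 2 * (#|V|%:R / 2)) <= eps * #|Res|%:R by rewrite ler_pM2l // (le_trans b1).
  rewrite /lam; clear - b2; lra.
have l2' : (2 * (2 * g + kk.+1)%:R + 2) <= lam * l%:R.
  have : (2 * (2 * g + kk.+1)%:R + 2) / lam <= l%:R by apply: le_trans hl2 _; rewrite ler_nat.
  by rewrite ler_pdivrMr // [_ * lam]mulrC.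
have Dtot : (m * (um.+2 * g + rem) < hR)%N.
  rewrite -(ltr_nat R); apply: lt_le_trans (_ : lam * #|V|%:R <= _).
    rewrite natrM nE mulrCA [X in _ < X]mulrC mulrAC [X in X < _]mulrC ltr_pM2r //; last by rewrite ltr0n.
    have b1 : (um.+2 * g + rem <= um.+1 * g + (2 * g + kk.+1))%N by move: remT; clear; nia.
    have b1' : (um.+2 * g + rem)%:R <= (um.+1 * g)%:R + (2 * g + kk.+1)%:R :> R by rewrite -natrD ler_nat.
    have b2 : 2 * g%:R <= kk.+1%:R * lam.
      by apply: le_trans hkk _; rewrite ler_pM2r // ler_nat.
    have b3 := ler_wpM2l (ler0n R um.+1) b2.
    have b4 : (um.+1 * kk.+1)%:R * lam <= l%:R * lam by rewrite ler_pM2r // ler_nat.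
    rewrite natrM in b1'; rewrite natrM in b4; clear - b1' b3 b4 l2'; lra.
  have b5 : lam * l%:R <= lam * #|V|%:R by rewrite ler_pM2l.
  have b6 : 0 <= (2 * g + kk.+1)%:R :> R by [].
  clear - hR2 lamn l2' b5 b6; lra.
pose ND (x : 'I_m * 'I_um.+2) : nat := (size (wc (n1 + x.2)%N)).-1.
pose PD (x : 'I_m * 'I_um.+2) (s : seq V) : bool := wpath e (wc (n1 + x.2)%N)
  (last0 j j x0 role A B X P x.1 (n1 + x.2)) (rcons s (head0 j j x0 role A B X x.1 ((n1 + x.2).+1 %% n2))).
have swcD (i : 'I_um.+2) : size (wc (n1 + i)%N) = (g + (if i == 0%N :> nat then rem else 0)).+1%N.
  have [i0|i0] := eqVneq (i : nat) 0%N; first by rewrite i0 addn0 swc1.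
  rewrite swc ?addn0 //; first by rewrite /n2 addSnnS ltn_add2l.
  by rewrite -[X in _ != X]addn0 eqn_add2l.
have [||D [D1 D2 D3]] := @greedy_rich V Res set0 _ ND PD hR.
- move=> x; rewrite /ND /PD; have := swcD x.2.
  case/lastP: (wc _) => // ww s; rewrite size_rcons => -[sww]; rewrite [(_.+1).-1]/=.
  have sw' : 2 + 2 / (eps / 2 / 2) <= (size ww)%:R.
    by rewrite sww; apply: le_trans hg _; rewrite ler_nat leq_addr.
  exact: (connect_rich oe e40 e48 s _ _ degR hR1 sw').
- rewrite cards0 add0n; apply: leq_ltn_trans Dtot.
  rewrite sum_pairs -[X in (_ <= X * _)%N]card_ord -sum_nat_const; apply: leq_sum => jj _.
  rewrite /ND (eq_bigr (fun i : 'I_um.+2 => (g + (if i == 0%N :> nat then rem else 0))%N)) => [|i _];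
    last by rewrite swcD.
  rewrite big_split /= sum_nat_const card_ord leq_add2l.
  by rewrite big_ord_recl /= big1 ?addn0.
have inX v : v \in allv (fun ji => X ji :: P ji) -> (v \in W) && (v \notin Res).
  by move=> /allvP[ji vji]; have /allP/(_ v vji) := XW ji; rewrite !inE andbC.
have inD v : v \in allv D -> v \in Res.
  by move=> /allvP[ji vji]; have [_ _ /allP/(_ v vji)] := D1 ji.
apply: (@assemble V e j j x0 l m uA u cH g rem kk um o ws wc sigma role j0 l0 m1 cH0 uA0 cV ow suml
  sws3 swc swc1 Hrole1 Hrole2 Hrole3 A B C A1 A2' hitsA B1 B2 sws2 B4 C1 B3 C2 X P D).
- by move=> jj i; have := pathX (jj, i); rewrite wE.
- by move=> ji; rewrite (size_wpath (pathX ji)) size_tuple.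
- by move=> jj i; have [_ + _] := D1 (jj, i).
rewrite cat_uniq uq cat_uniq [uniq (allv _)]uX [uniq (allv D)]D2 andbT has_cat negb_or /=.
apply/andP; split.
- apply/andP; split; apply/hasPn => v.
    by move/inX => /andP[]; rewrite !inE.
  by move/inD/(subsetP RW); rewrite !inE.
- by apply/hasPn => v /inD vR; apply/negP => /inX; rewrite vR andbF.
Qed.

Theorem theorem1p2 (R : realType) (eps : R) :
  0 < eps ->
  exists l0 : nat, forall l : nat, (l0 <= l)%N -> (3 <= l)%N ->
  forall (o : 'I_l -> bool) (m : nat), (1 <= m)%N ->
  forall (V : finType) (e : rel V),
    oriented e -> #|V| = (l * m)%N ->
    (forall v : V, (3 / 8 + eps) * (m * l)%:R <= (outdeg e v)%:R /\
                   (3 / 8 + eps) * (m * l)%:R <= (indeg e v)%:R) ->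
    has_cycle_factor e o.
Proof.
(* Lowering [eps] weakens the degree condition, and [expansion] is proved for [eps <= 1/8]. *)
move=> eps0; pose eps' := Num.min eps (1/8).
have e1 : 0 < eps' by rewrite lt_min eps0 divr_gt0.
have e2 : eps' <= 1/8 by rewrite ge_min lexx orbT.
have e3 : eps' <= eps by rewrite ge_min lexx.
have [l0 H] := factor_small_eps e1 e2.
exists l0 => l hl _ o m m1 V e oe cV deg; apply: (H l hl o m m1 V e oe cV) => v s.
rewrite setIT cardsT cV mulnC; apply: le_trans (_ : (3/8 + eps) * (m * l)%:R <= _).
  by apply: ler_wpM2r => //; rewrite lerD2l.
by have [h1 h2] := deg v; case: s.
Qed.
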